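(* Let $(M,\mathcal{F})$ be a minimal compact lamination by hyperbolic surfaces all of whose leaves are coarsely tame. Then the horocycle flow on the unit tangent bundle $T^1\mathcal{F}$ is minimal, i.e. every orbit of the horocycle flow is dense in $T^1\mathcal{F}$.
   Context: A compact lamination by surfaces $(M,\mathcal{F})$ is a compact metrizable space $M$ with an open cover $\{U_\alpha\}$ and homeomorphisms $\varphi_\alpha:U_\alpha\to D\times T$, where $D$ is a disk in $\mathbb{R}^2$ and $T$ is a separable locally compact metrizable space (possibly depending on $\alpha$), such that the changes of coordinates have the form $\varphi_\alpha\circ\varphi_\beta^{-1}(x,t)=(\lambda^t_{\alpha\beta}(x),\tau_{\alpha\beta}(t))$ with $\lambda^t_{\alpha\beta}$ smooth and depending continuously on $t$ in the $C^\infty$ topology. The plaques $\varphi_\alpha^{-1}(D\times\{t\})$ glue together to form maximal connected surfaces called leaves. The lamination is minimal if all its leaves are dense in $M$. A hyperbolic surface is a quotient $S=\Gamma\backslash\mathbb{H}$ of the hyperbolic plane by a torsion-free discrete subgroup $\Gamma$ of $PSL(2,\mathbb{R})$ (so it is complete, oriented, of constant curvature $-1$). Its unit tangent bundle is identified with $\Gamma\backslash PSL(2,\mathbb{R})$. A hyperbolic surface $S$ is coarsely tame if it is noncompact and there exists a constant $b>0$ such that any geodesic ray in $S$ either stays in a compact region or intersects infinitely many closed geodesics whose lengths are bounded from above by $b$. A (compact) lamination by hyperbolic surfaces is a compact lamination by surfaces whose leaves are endowed with Riemannian metrics, varying continuously in the $C^\infty$ topology from leaf to leaf, for which every leaf is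 a hyperbolic surface. The unit tangent bundle $T^1\mathcal{F}$ is the circle bundle over $M$ consisting of the unit vectors tangent to the leaves; it is a lamination whose leaves are the unit tangent bundles of the leaves of $\mathcal{F}$. There is a continuous right $PSL(2,\mathbb{R})$-action on $T^1\mathcal{F}$ which on the unit tangent bundle $\Gamma\backslash PSL(2,\mathbb{R})$ of each leaf is right translation. The horocycle flow $h_s$ on $T^1\mathcal{F}$ is the action of the one-parameter subgroup of matrices $\begin{pmatrix}1&s\\0&1\end{pmatrix}$, $s\in\mathbb{R}$. *)

(* Defs.v *)
From HB Require Import structures.
From mathcomp Require Import all_boot all_order all_algebra.
From mathcomp Require Import all_classical all_reals all_analysis.
Set Implicit Arguments.
Unset Strict Implicit.
Unset Printing Implicit Defensive.
Import Order.TTheory GRing.Theory Num.Theory.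
Import numFieldNormedType.Exports.
Local Open Scope classical_set_scope.
Local Open Scope ring_scope.

Notation plane R := 'rV[R]_2.

Section SmoothFamilies.
Context {R : realType} {W : normedModType R}.

Fixpoint iter_partial (w : seq 'I_2) (f : plane R -> W) : plane R -> W :=
  if w is i :: w' then fun x => 'D_(delta_mx 0 i) (iter_partial w' f) x else f.

Definition smooth_on (O : set (plane R)) (f : plane R -> W) : Prop :=
  forall (w : seq 'I_2) (x : plane R), O x ->
    (forall i, derivable (iter_partial w f) x (delta_mx 0 i)) /\
    {for x, continuous (iter_partial w f)}.

(* The slices of the open set O may vary with t.  By the tube lemma a compact
   subset K of the slice at t0 lies in the slices at all t near t0, so the second
   clause is uniform convergence on compact sets of all partial derivatives. *)
Definition smooth_family (T : topologicalType) (O : set (plane R * T))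
    (f : plane R -> T -> W) : Prop :=
  (forall t, smooth_on [set x | O (x, t)] (f^~ t)) /\
  (forall (t0 : T) (w : seq 'I_2) (K : set (plane R)) (e : R),
     compact K -> K `<=` [set x | O (x, t0)] -> 0 < e ->
     \forall t \near t0, forall x, K x ->
       `|iter_partial w (f^~ t) x - iter_partial w (f^~ t0) x| < e).

End SmoothFamilies.

Section Laminations.
Context {R : realType}.

Definition disk (c : plane R) (r : R) : set (plane R) :=
  [set x | (x 0 0 - c 0 0) ^+ 2 + (x 0 1 - c 0 1) ^+ 2 < r ^+ 2].

(* chart_map a is only meaningful on chart_dom a, and chart_inv a only on
   disk (chart_center a) (chart_radius a) `*` setT. *)
Record compact_lamination (M : metricType R) := CompactLamination {
  lam_compact : compact [set: M];
  chart : Type;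
  transversal : chart -> metricType R;
  transversal_separable : forall a,
    exists2 S : set (transversal a), countable S & dense S;
  transversal_locally_compact : forall a, locally_compact [set: transversal a];
  chart_center : chart -> plane R;
  chart_radius : chart -> R;
  chart_radius_gt0 : forall a, 0 < chart_radius a;
  chart_dom : chart -> set M;
  chart_map : forall a, M -> plane R * transversal a;
  chart_inv : forall a, plane R * transversal a -> M;
  chart_dom_open : forall a, open (chart_dom a);
  chart_cover : forall m, exists a, chart_dom a m;
  chart_map_disk : forall a m, chart_dom a m ->
    disk (chart_center a) (chart_radius a) (chart_map a m).1;
  chart_inv_dom : forall a x (t : transversal a),
    disk (chart_center a) (chart_radius a) x -> chart_dom a (chart_inv (x, t));
  chart_mapK : forall a m, chart_dom a m -> chart_inv (chart_map a m) = m;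
  chart_invK : forall a x (t : transversal a),
    disk (chart_center a) (chart_radius a) x ->
    chart_map a (chart_inv (x, t)) = (x, t);
  chart_map_continuous : forall a,
    {within chart_dom a, continuous (chart_map a)};
  chart_inv_continuous : forall a,
    {within disk (chart_center a) (chart_radius a) `*` [set: transversal a],
      continuous (@chart_inv a)};
  chart_change_transversal : forall a b,
    exists tau : transversal b -> transversal a, forall x (t : transversal b),
      disk (chart_center b) (chart_radius b) x ->
      chart_dom a (chart_inv (x, t)) ->
      (chart_map a (chart_inv (x, t))).2 = tau t;
  chart_change_smooth : forall a b,
    smooth_family
      [set xt : plane R * transversal b |
                disk (chart_center b) (chart_radius b) xt.1 /\
                chart_dom a (chart_inv xt)]
      (fun x (t : transversal b) => (chart_map a (chart_inv (x, t))).1)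
}.

Definition chart_disk (M : metricType R) (F : compact_lamination M)
    (a : chart F) : set (plane R) := disk (chart_center a) (chart_radius a).

(* lambda_{ab}^t, defined where chart b at level t meets the domain of chart a. *)
Definition chart_change (M : metricType R) (F : compact_lamination M)
    (a b : chart F) (t : transversal b) (x : plane R) : plane R :=
  (chart_map a (chart_inv (x, t))).1.

Definition plaque (M : metricType R) (F : compact_lamination M)
    (a : chart F) (t : transversal a) : set M :=
  [set chart_inv (x, t) | x in chart_disk a].

Inductive same_leaf (M : metricType R) (F : compact_lamination M) :
    M -> M -> Prop :=
| same_leaf_refl m : same_leaf F m m
| same_leaf_step m n q (a : chart F) (t : transversal a) :
    same_leaf F m n -> plaque t n -> plaque t q -> same_leaf F m q.

Definition leaf (M : metricType R) (F : compact_lamination M) (m : M) : set M :=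
  [set n | same_leaf F m n].

Definition minimal_lamination (M : metricType R) (F : compact_lamination M) :=
  forall m, dense (leaf F m).

(* M with the leaf topology, in which the leaves are the connected components
   and carry their topology of surfaces. *)
Definition leaf_space (M : metricType R) (F : compact_lamination M) : Type := M.

Section LeafTopology.
Variables (M : metricType R) (F : compact_lamination M).

HB.instance Definition _ := Choice.on (leaf_space F).

Definition leaf_open (O : set (leaf_space F)) : Prop :=
  forall (a : chart F) (t : transversal a),
    open [set x | chart_disk a x /\ O (chart_inv (x, t))].

Lemma disk_open (c : plane R) (r : R) : open (disk c r).
Proof.
have sq i : continuous (fun x : plane R => (x 0 i - c 0 i) ^+ 2).
  move=> x; have cx : {for x, continuous (fun x : plane R => x 0 i - c 0 i)}.
    have xi := @coord_continuous R 1 2 0 i x.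
    by apply: (@cvgB _ R^o _ _ _ _ _ _ _ xi); exact: cvg_cst.
  by rewrite /continuous_at expr2; apply: (cvgM cx cx).
have cts : continuous (fun x : plane R =>
    (x 0 0 - c 0 0) ^+ 2 + (x 0 1 - c 0 1) ^+ 2).
  by move=> x; exact: (cvgD (sq 0 x) (sq 1 x)).
move/continuousP: cts => /(_ [set y | y < r ^+ 2]); apply.
exact: open_lt.
Qed.

Lemma leaf_openT : leaf_open setT.
Proof.
move=> a t; rewrite (_ : [set x | _] = chart_disk a); first exact: disk_open.
by apply/seteqP; split => x //= [].
Qed.

Lemma leaf_openI : setI_closed leaf_open.
Proof.
move=> A B oA oB a t; rewrite (_ : [set x | _] =
  [set x | chart_disk a x /\ A (chart_inv (x, t))] `&`
  [set x | chart_disk a x /\ B (chart_inv (x, t))]); first exact: openI.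
by apply/seteqP; split => x /= [] => [? []|[? ?] []].
Qed.

Lemma leaf_open_bigU (I : Type) (f : I -> set (leaf_space F)) :
  (forall i, leaf_open (f i)) -> leaf_open (\bigcup_i f i).
Proof.
move=> of_ a t; rewrite (_ : [set x | _] =
  \bigcup_i [set x | chart_disk a x /\ f i (chart_inv (x, t))]).
  by apply: bigcup_open => i _; exact: of_.
apply/seteqP; split => x /=.
  by move=> [Dx [i _ fi]]; exists i.
by move=> [i _ [Dx fi]]; split => //; exists i.
Qed.

HB.instance Definition _ := isOpenTopological.Build (leaf_space F)
  leaf_openT leaf_openI leaf_open_bigU.

End LeafTopology.

Definition bilinear_form (G : 'M[R]_2) (v w : plane R) : R :=
  (v *m G *m w^T) 0 0.

Definition oriented (M : metricType R) (F : compact_lamination M) : Prop :=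
  forall (a b : chart F) (x : plane R) (t : transversal b),
    chart_disk b x -> chart_dom a (chart_inv (x, t)) ->
    0 < \det (jacobian (chart_change a t) x).

(* Leafwise metric tensors in the charts: metric a x t is the Gram matrix at the
   point chart_inv (x, t). *)
Record riemannian_lamination (M : metricType R) := RiemannianLamination {
  rl_lamination :> compact_lamination M;
  metric : forall a : chart rl_lamination,
    plane R -> transversal a -> 'M[R]_2;
  metric_sym : forall (a : chart rl_lamination) x (t : transversal a),
    chart_disk a x -> (metric x t)^T = metric x t;
  metric_pos : forall (a : chart rl_lamination) x (t : transversal a) v,
    chart_disk a x -> v != 0 -> 0 < bilinear_form (metric x t) v v;
  metric_compat : forall (a b : chart rl_lamination) x (t : transversal b) v w,
    chart_disk b x -> chart_dom a (chart_inv (x, t)) ->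
    let m := chart_map a (chart_inv (x, t)) in
    bilinear_form (metric m.1 m.2)
      ('D_v (chart_change a t) x) ('D_w (chart_change a t) x) =
    bilinear_form (metric x t) v w;
  metric_smooth : forall a : chart rl_lamination,
    smooth_family (chart_disk a `*` [set: transversal a]) (@metric a)
}.

Definition half_plane : set (plane R) := [set z | 0 < z 0 1].

Definition hpoint (x y : R) : plane R := \row_j (if j == 0 then x else y).

(* z |-> (a z + b) / (c z + d), split into real and imaginary parts. *)
Definition mobius (A : 'M[R]_2) (z : plane R) : plane R :=
  let x := z 0 0 in let y := z 0 1 in
  let N := (A 1 0 * x + A 1 1) ^+ 2 + (A 1 0 * y) ^+ 2 in
  hpoint (((A 0 0 * x + A 0 1) * (A 1 0 * x + A 1 1) + A 0 0 * A 1 0 * y ^+ 2) / N)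
         (\det A * y / N).

(* A torsion-free discrete subgroup of PSL(2,R), given by its full preimage in
   SL(2,R), which contains -1. *)
Definition torsion_free_fuchsian (G : set 'M[R]_2) : Prop :=
  [/\ (forall A, G A -> \det A = 1), G 1 /\ G (- 1),
      (forall A B, G A -> G B -> G (A * B) /\ G (invmx A)),
      (exists2 e : R, 0 < e & forall A, G A -> `|A - 1| < e -> A = 1) &
      (forall A n, G A -> A ^+ n.+1 = 1 \/ A ^+ n.+1 = - 1 -> A = 1 \/ A = - 1)].

Section HyperbolicLaminations.
Variables (M : metricType R) (F : riemannian_lamination M).

(* p is the composition of the quotient map H -> G\H with an orientation
   preserving isometry from G\H onto the leaf L; its values outside the half-plane
   are irrelevant.  H carries the metric |dz|^2 / (Im z)^2. *)
Definition uniformization (G : set 'M[R]_2) (p : plane R -> M) (L : set M) :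
    Prop :=
  [/\ torsion_free_fuchsian G,
      p @` half_plane = L,
      (forall z w, half_plane z -> half_plane w ->
         (p z = p w <-> exists2 A, G A & w = mobius A z)) &
      (forall z (a : chart F), half_plane z -> chart_dom a (p z) ->
         let f w := (chart_map a (p w)).1 in
         let t := (chart_map a (p z)).2 in
         [/\ (exists2 O : set (plane R), open O /\ O z &
                (forall w, O w ->
                   chart_dom a (p w) /\ (chart_map a (p w)).2 = t) /\
                smooth_on O f),
             (forall v, bilinear_form (metric (f z) t) ('D_v f z) ('D_v f z) =
                (v 0 0 ^+ 2 + v 0 1 ^+ 2) / z 0 1 ^+ 2) &
             0 < \det (jacobian f z)])].

Definition hyperbolic_leaves : Prop :=
  forall m, exists G p, uniformization G p (leaf F m).

End HyperbolicLaminations.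

Record hyperbolic_lamination (M : metricType R) := HyperbolicLamination {
  hl_lamination :> riemannian_lamination M;
  hl_oriented : oriented hl_lamination;
  hl_hyperbolic : hyperbolic_leaves hl_lamination
}.

(* A unit vector tangent to a leaf at ut_base: its components in all the charts
   around that point, related by the changes of coordinates.  The components in
   the other charts are set to 0. *)
Record unit_tangent (M : metricType R) (F : riemannian_lamination M) :=
  UnitTangent {
  ut_base : M;
  ut_vec : chart F -> plane R;
  ut_vec_out : forall a, ~ chart_dom a ut_base -> ut_vec a = 0;
  ut_vec_change : forall a b, chart_dom a ut_base -> chart_dom b ut_base ->
    ut_vec a = 'D_(ut_vec b) (chart_change a (chart_map b ut_base).2)
                 (chart_map b ut_base).1;
  ut_vec_unit : forall a, chart_dom a ut_base ->
    let m := chart_map a ut_base in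
    bilinear_form (metric m.1 m.2) (ut_vec a) (ut_vec a) = 1
}.

Section UnitTangentTopology.
Variables (M : metricType R) (F : riemannian_lamination M).

HB.instance Definition _ := gen_eqMixin (unit_tangent F).
HB.instance Definition _ := gen_choiceMixin (unit_tangent F).

(* Over each chart domain, the unit tangent bundle is topologized as a subspace
   of chart_dom a `*` plane R. *)
Definition ut_open (O : set (unit_tangent F)) : Prop :=
  forall a : chart F, exists2 A : set (M * plane R), open A &
    forall u, chart_dom a (ut_base u) -> (O u <-> A (ut_base u, ut_vec u a)).

Lemma ut_openT : ut_open setT.
Proof. by move=> a; exists setT => //; exact: openT. Qed.

Lemma ut_openI : setI_closed ut_open.
Proof.
move=> O P oO oP a; have [A oA OA] := oO a; have [B oB PB] := oP a.
exists (A `&` B); first exact: openI.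
move=> u au; split=> [[/(OA _ au) ? /(PB _ au) ?]//|[/(OA _ au) ? /(PB _ au) ?]//].
Qed.

Lemma ut_open_bigU (I : Type) (f : I -> set (unit_tangent F)) :
  (forall i, ut_open (f i)) -> ut_open (\bigcup_i f i).
Proof.
move=> of_ a; have /choice [A AP] : forall i, exists A : set (M * plane R),
    open A /\ forall u, chart_dom a (ut_base u) ->
      (f i u <-> A (ut_base u, ut_vec u a)).
  by move=> i; have [A oA fA] := of_ i a; exists A.
exists (\bigcup_i A i); first by apply: bigcup_open => i _; exact: (AP i).1.
move=> u au; split=> [[i _ /((AP i).2 _ au) ?]|[i _ /((AP i).2 _ au) ?]];
  by exists i.
Qed.

HB.instance Definition _ := isOpenTopological.Build (unit_tangent F)
  ut_openT ut_openI ut_open_bigU.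

End UnitTangentTopology.

Section PSL2Action.
Variables (M : metricType R) (F : riemannian_lamination M).

(* PSL(2,R) is identified with the unit tangent bundle of H by sending A to the
   image under mobius A of the upward unit vector at i; u is the image of that
   vector by the differential of p. *)
Definition frame_at (p : plane R -> M) (A : 'M[R]_2) (u : unit_tangent F) :
    Prop :=
  ut_base u = p (mobius A (hpoint 0 1)) /\
  forall a, chart_dom a (ut_base u) ->
    ut_vec u a =
      'D_(hpoint 0 1) (fun z => (chart_map a (p (mobius A z))).1) (hpoint 0 1).

Definition right_translation (B : 'M[R]_2) (u w : unit_tangent F) : Prop :=
  exists G p A, [/\ uniformization F G p (leaf F (ut_base u)), \det A = 1,
    frame_at p A u & frame_at p (A * B) w].

(* For \det B = 1 on a lamination with hyperbolic leaves there is exactly one w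
   with right_translation B u w, so the default value u plays no role. *)
Definition psl2_action (u : unit_tangent F) (B : 'M[R]_2) : unit_tangent F :=
  xget u [set w | right_translation B u w].

Definition horocycle_flow (s : R) (u : unit_tangent F) : unit_tangent F :=
  psl2_action u (1 + s *: delta_mx 0 1).

End PSL2Action.

Section CoarselyTame.
Variables (X : topologicalType) (p : plane R -> X).

(* The unit speed geodesic of p @` half_plane with initial vector A: the geodesic
   flow is the right translation by diag(e^(t/2), e^(-t/2)), which maps i to
   e^t i. *)
Definition geodesic (A : 'M[R]_2) (t : R) : X := p (mobius A (hpoint 0 (expR t))).

(* Images of the closed geodesics of length at most b. *)
Definition closed_geodesic (b : R) (C : set X) : Prop :=
  exists A l, [/\ \det A = 1, 0 < l <= b,
    (forall t, geodesic A (t + l) = geodesic A t) & C = range (geodesic A)].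

Definition coarsely_tame : Prop :=
  ~ compact (p @` half_plane) /\
  exists2 b : R, 0 < b & forall A, \det A = 1 ->
    (exists K, [/\ compact K, K `<=` p @` half_plane &
                   forall t, 0 <= t -> K (geodesic A t)]) \/
    infinite_set [set C | closed_geodesic b C /\
                          exists2 t, 0 <= t & C (geodesic A t)].

End CoarselyTame.

Definition coarsely_tame_leaf (M : metricType R) (F : riemannian_lamination M)
    (m : M) : Prop :=
  exists G p, uniformization F G p (leaf F m) /\
    coarsely_tame (p : plane R -> leaf_space F).

Definition minimal_flow (X : topologicalType) (h : R -> X -> X) : Prop :=
  forall x, dense [set h s x | s in [set: R]].

End Laminations.

(* Main.v *)
(** The geodesic flow [a_t], the horocycle flow [h_s] and the opposite horocycle flow
    all come from the right action of [PSL(2,R)] on the unit tangent bundle [X], which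
    is continuous because in a chart the frames along a geodesic solve an ordinary
    differential equation whose coefficients, the first derivatives of the leafwise
    metric, vary continuously with the leaf.

    Coarse tameness gives, for every [u] in [X], arbitrarily large [t] such that the
    stabilizer of [u a_t] contains a hyperbolic element [k] of bounded size with trace
    bounded away from 2: such a [k] comes from the closed geodesics crossed by the ray
    or, if the ray is bounded, from its recurrence.  This has two consequences.

    A nonempty closed set invariant under the upper triangular group is [X].  It meets
    every leaf, as the leaves are dense; conjugated by [a_t], the elements [k] yield
    elements of the stabilizer of [u] which move almost every direction close to the
    forward direction of [u], so that the set contains [u].

    Let [Y] be a minimal closed [h_s]-invariant set.  For [u] in [Y] the elements [k]
    show that points of the horocycle orbit of [u] converge to some [u a_s], [s <> 0],
    so [Y] is invariant under [a_s], hence the translates of [Y] by the [a_t] cover [X].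
    Translating a vector tangent to a closed geodesic into [Y], its whole opposite
    horocycle lies in [Y] by contraction; combined with the Bruhat relations this makes
    [Y] invariant under all [a_t], so [Y = X]. *)

Require Import Defs.
From HB Require Import structures.
From mathcomp Require Import all_boot all_order all_algebra.
From mathcomp Require Import all_classical all_reals all_analysis.
From mathcomp Require Import ring lra.
Import Order.TTheory GRing.Theory Num.Theory.
Import numFieldNormedType.Exports.
Import Defs.
Local Open Scope classical_set_scope.
Local Open Scope ring_scope.

Set Implicit Arguments.
Unset Strict Implicit.
Unset Printing Implicit Defensive.

(** * Calculus in the plane *)

(** The obstacle is that uniformizations are chosen leaf by leaf, with no continuity from one leaf
    to the next: only the charts and the leafwise metric vary continuously. Translation by a matrix
    is therefore at first the relation [right_translation], which quantifies over all
    uniformizations. The equation satisfied by the frames contains the metric alone, so Gronwall's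
    inequality compares translations computed with different uniformizations on different leaves;
    applied to a single vector, the comparison shows that the result does not depend on the
    uniformization. Rotations need no equation, and the Cartan decomposition gives all other
    matrices.

    The dynamical part is abstract: a compact space, an action of SL(2,R) with discrete stabilizers,
    and the elements [k]. Its recurring device is to conjugate [k] by a large diagonal matrix: the
    diagonal of [k] is unchanged and the lower left entry becomes tiny, while discreteness leaves
    finitely many stabilizer elements in any bounded set. The bounds on [k] depend on [u], so each
    argument follows one orbit. *)

Section Calculus.
Context {R : realType}.

Lemma coord_le m n (v : 'M[R]_(m.+1, n.+1)) i j : `|v i j| <= `|v|.
Proof.
rewrite [leRHS]/Num.Def.normr/= mx_normrE.
by under eq_bigr do rewrite /=; exact: (le_bigmax _ _ (i, j)).
Qed.

Lemma norm_mx_le m n (v : 'M[R]_(m.+1, n.+1)) e :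
  (forall i j, `|v i j| <= e) -> `|v| <= e.
Proof.
move=> ve; rewrite [leLHS]/Num.Def.normr/= mx_normrE.
have e0 : 0 <= e by apply: le_trans (ve 0 0).
by rewrite (bigmax_le _ e0)//= => i _.
Qed.

Lemma ord2P (P : 'I_2 -> Prop) : P 0 -> P 1 -> forall i, P i.
Proof.
move=> P0 P1 [[|[|//]] Hi].
- by rewrite (_ : Ordinal _ = 0)//; apply/val_inj.
- by rewrite (_ : Ordinal _ = 1)//; apply/val_inj.
Qed.

Lemma plane_eq (z w : plane R) : z 0 0 = w 0 0 -> z 0 1 = w 0 1 -> z = w.
Proof.
by move=> e0 e1; apply/matrixP => i j; rewrite !ord1; move: j; exact: ord2P.
Qed.

Lemma hpoint0 (x y : R) : hpoint x y 0 0 = x. Proof. by rewrite mxE. Qed.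
Lemma hpoint1 (x y : R) : hpoint x y 0 1 = y. Proof. by rewrite mxE. Qed.
Definition hpointE := (hpoint0, hpoint1).

Lemma differentiable_eps (V W : normedModType R) (f : V -> W) x :
  differentiable f x ->
  forall e : R, 0 < e -> \forall h \near (0 : V),
    `|f (x + h) - f x - 'd f x h| <= e * `|h|.
Proof.
move=> /diff_locally df e e0.
have /eqaddoP /(_ e e0) := df.
apply: filterS => h.
by rewrite (_ : _ h = f (h + x) - (f x + 'd f x h))// [h + x]addrC opprD addrA.
Qed.

Lemma eps_differentiable (V W : normedModType R) (f : V -> W) x
    (L : {linear V -> W}) : continuous L ->
  (forall e : R, 0 < e -> \forall h \near (0 : V),
    `|f (x + h) - f x - L h| <= e * `|h|) -> differentiable f x.
Proof.
move=> cL H.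
have E : f \o shift x = cst (f x) + L +o_ 0 id.
  apply/eqaddoP => e e0; have := H e e0.
  apply: filterS => h.
  by rewrite (_ : (f \o shift x - _) h = f (h + x) - (f x + L h))// [h + x]addrC opprD addrA.
have dE := diff_unique cL E.
apply/diff_locallyP; rewrite dE; split => //.
Qed.

Lemma derive_line (V W : normedModType R) (f : V -> W) (x v : V) (s : R) :
  derivable f (x + s *: v) v ->
  is_derive s 1 (fun s : R => f (x + s *: v)) ('D_v f (x + s *: v)).
Proof.
move=> df.
have E : (fun h : R => h^-1 *: ((f \o shift (x + s *: v)) (h *: v)
            - f (x + s *: v))) =
         (fun h : R => h^-1 *: (((fun s => f (x + s *: v)) \o shift s) (h *: 1)
            - f (x + s *: v))).
  apply/funext => h /=; congr (_ *: (f _ - _)).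
  by rewrite -[h *: 1]/(h * 1) mulr1 scalerDl addrCA.
split; first by rewrite /derivable -E.
by rewrite /derive -E.
Qed.

Lemma MVT_line (V : normedModType R) (f : V -> R) (x v : V) :
  (forall s : R, 0 <= s <= 1 -> derivable f (x + s *: v) v) ->
  exists2 s : R, 0 <= s <= 1 & f (x + v) - f x = 'D_v f (x + s *: v).
Proof.
move=> df.
have d1 (s : R) : s \in `[0, 1] ->
    is_derive s 1 (fun s : R => f (x + s *: v)) ('D_v f (x + s *: v)).
  by rewrite in_itv /= => s01; apply/derive_line/df.
pose g (s : R) := f (x + s *: v); pose dg (s : R) := 'D_v f (x + s *: v).
have dgo (s : R) : s \in `]0, 1[ -> is_derive s 1 g (dg s).
  by move=> /subset_itv_oo_cc; exact: d1.
have cg : {within `[0, 1], continuous g}.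
  by apply: derivable_within_continuous => y /d1 ?; exact: ex_derive.
have [c c01] := MVT_segment ler01 dgo cg.
rewrite /g /dg scale1r scale0r addr0 subr0 mulr1 => ->; by exists c.
Qed.

Definition e_ (i : 'I_2) : plane R := delta_mx 0 i.

Lemma plane_sum (v : plane R) : v = v 0 0 *: e_ 0 + v 0 1 *: e_ 1.
Proof.
apply: plane_eq; rewrite /e_ !mxE /=; ring.
Qed.

Lemma coord_continuous' (i : 'I_2) : continuous (fun v : plane R => v 0 i).
Proof. exact: coord_continuous. Qed.

Lemma norm_e (i : 'I_2) : `|e_ i| <= 1.
Proof.
apply: norm_mx_le => k j; rewrite /e_ mxE.
by case: (_ && _); rewrite ?normr1// normr0.
Qed.

(** [smooth_on] speaks of partial derivatives only. Full differentiability follows by going from [z]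
    to [z + h] along two axis-parallel segments, with the mean value theorem on each and the
    continuity of the partial derivatives at [z]. *)
Lemma C1_differentiable_scalar (f : plane R -> R) (z : plane R) :
  (forall i, \forall w \near z, derivable f w (e_ i)) ->
  (forall i, {for z, continuous ('D_(e_ i) f)}) ->
  differentiable f z.
Proof.
move=> df cf.
pose l (h : plane R) := h 0 0 * 'D_(e_ 0) f z + h 0 1 * 'D_(e_ 1) f z.
have ll : linear l.
  by move=> a u v; rewrite /l !mxE -[a *: _]/(a * _); ring.
pose LM := GRing.isLinear.Build _ _ _ _ l ll.
pose L : {linear plane R -> R} := HB.pack l LM.
apply: (@eps_differentiable _ _ f z L).
  have cl i (c : R) : continuous (fun v : plane R => v 0 i * c).
    by move=> v; apply: (cvgM (@coord_continuous' i v) (cvg_cst c)).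
  by move=> v; apply: (cvgD (cl 0 _ v) (cl 1 _ v)).
move=> e e0.
have e20 : 0 < e / 2 by rewrite divr_gt0.
have /nbhs_ballP[r /= r0 Hr] : \forall w \near z, forall i, derivable f w (e_ i) /\
    `|'D_(e_ i) f w - 'D_(e_ i) f z| <= e / 2.
  have H i : \forall w \near z, derivable f w (e_ i) /\
      `|'D_(e_ i) f w - 'D_(e_ i) f z| <= e / 2.
    apply: filterI; first exact: df.
    have /cvgrPdist_le/(_ _ e20) := cf i.
    by apply: filterS => w; rewrite distrC.
  by apply: filterS (filterI (H 0) (H 1)) => w [H0 H1]; exact: ord2P.
near=> h.
have hr : `|h| < r.
  by near: h; apply/nbhs_ballP; exists r => //= y; rewrite -ball_normE /= sub0r normrN.
have inb (s t : R) : 0 <= s <= 1 -> 0 <= t <= 1 ->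
    ball z r (z + (s * h 0 0) *: e_ 0 + (t * h 0 1) *: e_ 1).
  move=> s01 t01; rewrite -ball_normE /= -addrA opprD addNKr normrN.
  apply: le_lt_trans hr; apply: norm_mx_le => i; rewrite ord1.
  have bd (u x : R) : 0 <= u <= 1 -> `|u * x| <= `|x|.
    by move=> /andP[u0 u1]; rewrite normrM (ger0_norm u0) ler_piMl.
  apply: ord2P; rewrite !mxE /= !(mulr1, mulr0, addr0, add0r).
    exact: le_trans (bd _ _ s01) (coord_le _ _ _).
  exact: le_trans (bd _ _ t01) (coord_le _ _ _).
(* Homogeneity along one axis comes from rescaling the limit, since differentiability is not yet
   known. *)
have dZ (k : R) (i : 'I_2) w : derivable f w (e_ i) ->
  derivable f w (k *: e_ i) /\ 'D_(k *: e_ i) f w = k * 'D_(e_ i) f w.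
  move=> dw; have [->|k0] := eqVneq k 0.
    rewrite scale0r derive0 mul0r; split; [exact: derivable0|reflexivity].
  suff : (fun s : R => s^-1 *: ((f \o shift w) (s *: (k *: e_ i)) - f w)) @ 0^' -->
    k * 'D_(e_ i) f w.
    by move=> C; split; [apply/cvg_ex; eexists; exact: C|exact/cvg_lim].
  have /= C := dw.
  rewrite (_ : (fun s : R => _) = (fun s : R => k * ((k * s)^-1 *:
     ((f \o shift w) ((k * s) *: e_ i) - f w)))); last first.
    apply/funext => s /=; rewrite !scalerA [s * k]mulrC -[RHS]/(k *: _) scalerA.
    by rewrite invfM mulrA divff// mul1r.
  apply: cvgM; first exact: cvg_cst.
  rewrite /derive.
  apply: (@cvg_comp _ _ _ (fun s => k * s) (fun s => s^-1 *:
     ((f \o shift w) (s *: e_ i) - f w)) _ (0^') _ _ C).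
  move=> A /= /nbhs_ballP[d /= d0 dA].
  apply/nbhs_ballP; exists (d / `|k|) => /=; first by rewrite divr_gt0 ?normr_gt0.
  move=> s; rewrite /ball /= sub0r normrN => sd s0; apply: dA.
    by rewrite /ball /= sub0r normrN normrM mulrC -ltr_pdivlMr ?normr_gt0.
  by rewrite mulf_neq0.
have I0 : ((0 : R) <= (0 : R) <= (1 : R)) by rewrite lexx ler01.
have I1 : ((0 : R) <= (1 : R) <= (1 : R)) by rewrite lexx ler01.
have [s s01 E0] : exists2 s : R, 0 <= s <= 1 & f (z + h 0 0 *: e_ 0) - f z =
    'D_(h 0 0 *: e_ 0) f (z + s *: (h 0 0 *: e_ 0)).
  apply: MVT_line => s s01; apply: (dZ _ _ _ _).1.
  have /Hr/(_ 0)[+ _] := inb s 0 s01 I0.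
  by rewrite mul0r scale0r addr0 scalerA.
have [t t01 E1] : exists2 t : R, 0 <= t <= 1 &
    f (z + h 0 0 *: e_ 0 + h 0 1 *: e_ 1) - f (z + h 0 0 *: e_ 0) =
    'D_(h 0 1 *: e_ 1) f (z + h 0 0 *: e_ 0 + t *: (h 0 1 *: e_ 1)).
  apply: MVT_line => t t01; apply: (dZ _ _ _ _).1.
  have /Hr/(_ 1)[+ _] := inb 1 t I1 t01.
  by rewrite mul1r scalerA.
have [d0 b0] : derivable f (z + s *: (h 0 0 *: e_ 0)) (e_ 0) /\
  `|'D_(e_ 0) f (z + s *: (h 0 0 *: e_ 0)) - 'D_(e_ 0) f z| <= e / 2.
  have /Hr/(_ 0) := inb s 0 s01 I0.
  by rewrite mul0r scale0r addr0 scalerA.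
have [d1 b1] : derivable f (z + h 0 0 *: e_ 0 + t *: (h 0 1 *: e_ 1)) (e_ 1) /\
  `|'D_(e_ 1) f (z + h 0 0 *: e_ 0 + t *: (h 0 1 *: e_ 1)) - 'D_(e_ 1) f z| <= e / 2.
  have /Hr/(_ 1) := inb 1 t I1 t01.
  by rewrite mul1r scalerA.
rewrite [X in f (z + X)](plane_sum h) addrA.
rewrite (dZ _ _ _ d0).2 in E0; rewrite (dZ _ _ _ d1).2 in E1.
rewrite /= /l.
set D0 := 'D_(e_ 0) f (z + s *: _) in E0 b0.
set D1 := 'D_(e_ 1) f (_ + t *: _) in E1 b1.
rewrite (_ : _ - _ = h 0 0 * (D0 - 'D_(e_ 0) f z) +
                     h 0 1 * (D1 - 'D_(e_ 1) f z)); last first.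
  by rewrite !mulrBr -E0 -E1; ring.
apply: le_trans (ler_normD _ _) _; rewrite !normrM.
rewrite [e]splitr mulrDl [e / 2 * _]mulrC.
by apply: lerD; apply: ler_pM => //; exact: coord_le.
Unshelve. all: by end_near. Qed.

End Calculus.

(** * Matrix-valued maps and symmetry of second derivatives *)

Section Calculus2.
Context {R : realType}.

Lemma differentiable_mx (V : normedModType R) m n (f : V -> 'M[R]_(m.+1, n.+1)) x :
  (forall i j, differentiable (fun y => f y i j) x) -> differentiable f x.
Proof.
move=> df.
have -> : f = \sum_i \sum_j (fun y => f y i j *: delta_mx i j).
  apply/funext => y; rewrite [LHS]matrix_sum_delta fct_sumE.
  by apply: eq_bigr => i _; rewrite fct_sumE.
apply: differentiable_sum => i; apply: differentiable_sum => j.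
exact: differentiableZl.
Qed.

Lemma differentiable_entry (V : normedModType R) m n (f : V -> 'M[R]_(m.+1, n.+1)) x i j :
  differentiable f x -> differentiable (fun y => f y i j) x.
Proof.
move=> df.
have := @differentiable_comp _ _ _ _ f (fun M : 'M[R]_(m.+1, n.+1) => M i j) x df.
apply.
pose l (M : 'M[R]_(m.+1, n.+1)) := M i j.
have ll : linear l by move=> a u v; rewrite /l !mxE.
pose LM := GRing.isLinear.Build _ _ _ _ l ll.
pose L : {linear 'M[R]_(m.+1, n.+1) -> R} := HB.pack l LM.
apply: (@linear_differentiable _ _ _ L); exact: coord_continuous.
Qed.

Lemma derive_entry (V : normedModType R) m n (f : V -> 'M[R]_(m.+1, n.+1)) x v i j :
  derivable f x v -> 'D_v (fun y => f y i j) x = 'D_v f x i j.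
Proof. by move=> df; rewrite (derive_mx df) mxE. Qed.

Lemma C1_differentiable m n (f : plane R -> 'M[R]_(m.+1, n.+1)) (z : plane R) :
  (forall i, \forall w \near z, derivable f w (e_ i)) ->
  (forall i, {for z, continuous ('D_(e_ i) f)}) ->
  differentiable f z.
Proof.
move=> df cf; apply: differentiable_mx => k j.
apply: C1_differentiable_scalar => i.
  by apply: filterS (df i) => w /derivable_mxP.
rewrite /prop_for /continuous_at.
have dz := nbhs_singleton (df i).
rewrite (derive_entry k j dz).
apply: (@cvg_trans _ (('D_(e_ i) f w) k j @[w --> z])).
  apply: (@near_eq_cvg _ _ (nbhs z)); near=> w.
  have dw : derivable f w (e_ i) by near: w; exact: df.
  by rewrite (derive_entry k j dw).
apply: (@continuous_comp _ _ _ ('D_(e_ i) f) (fun M => M k j)); first exact: cf.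
exact: coord_continuous.
Unshelve. all: by end_near. Qed.

Lemma derive_plane (W : normedModType R) (f : plane R -> W) z v :
  differentiable f z ->
  'D_v f z = v 0 0 *: 'D_(e_ 0) f z + v 0 1 *: 'D_(e_ 1) f z.
Proof.
by move=> df; rewrite !deriveE// [in LHS](plane_sum v) linearD !linearZ.
Qed.

Lemma deriveZv (V W : normedModType R) (f : V -> W) z v k :
  differentiable f z -> 'D_(k *: v) f z = k *: 'D_v f z.
Proof. by move=> df; rewrite !deriveE// linearZ. Qed.

Lemma derive_comp (U V W : normedModType R) (f : U -> V) (g : V -> W) x v :
  differentiable f x -> differentiable g (f x) ->
  'D_v (g \o f) x = 'D_('D_v f x) g (f x).
Proof.
move=> df dg; rewrite (deriveE _ (differentiable_comp df dg)).
by rewrite (deriveE _ df) (deriveE _ dg) diff_comp.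
Qed.

(** The mean value theorem for [phi w = f (w + h *: e_ j) - f w] along [h *: e_ i] leaves a
    difference of two values of the [i]-th partial derivative. Each is expanded at [z] with an error
    of at most [e * (h + h)]; two errors and the factor [h] give [4 * e * h ^+ 2]. *)
Lemma second_difference (f : plane R -> R) (z : plane R) (i j : 'I_2) (e : R) :
  (\forall w \near z, differentiable f w) ->
  differentiable ('D_(e_ i) f) z -> 0 < e ->
  \forall h \near (0 : R)^'+,
    `|f (z + h *: e_ i + h *: e_ j) - f (z + h *: e_ i) - f (z + h *: e_ j) + f z
      - h ^+ 2 * 'D_(e_ j) ('D_(e_ i) f) z| <= 4 * e * h ^+ 2.
Proof.
move=> df ddf e0.
have /nbhs_ballP[r /= r0 Hr] := df.
have /nbhs_ballP[q /= q0 Hq] := differentiable_eps ddf e0.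
near=> h.
have h0 : 0 < h by [].
have hr : h + h < r.
  have : h < r / 2.
    by near: h; apply: nbhs_right_lt; rewrite divr_gt0.
  by rewrite ltr_pdivlMr// mulr2n mulrDr mulr1.
have hq : h + h < q.
  have : h < q / 2.
    by near: h; apply: nbhs_right_lt; rewrite divr_gt0.
  by rewrite ltr_pdivlMr// mulr2n mulrDr mulr1.
have nb (s t : R) : 0 <= s <= 1 -> 0 <= t <= 1 ->
    `|(s * h) *: e_ i + (t * h) *: e_ j| <= h + h.
  move=> /andP[s0 s1] /andP[t0 t1]; apply: le_trans (ler_normD _ _) _.
  have le1 (u : R) (k : 'I_2) : 0 <= u -> u <= 1 -> `|(u * h) *: e_ k| <= h.
    move=> u0 u1; have h0' := ltW h0.
    rewrite normrZ ger0_norm; last exact: mulr_ge0.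
    by rewrite mulrAC ler_piMl// mulr_ile1// norm_e.
  by apply: lerD; exact: le1.
have dfw (s t : R) : 0 <= s <= 1 -> 0 <= t <= 1 ->
    differentiable f (z + (s * h) *: e_ i + (t * h) *: e_ j).
  move=> s01 t01; apply: Hr; rewrite -ball_normE /= -addrA opprD addNKr normrN.
  exact: le_lt_trans (nb _ _ s01 t01) hr.
have I0 : ((0 : R) <= (0 : R) <= (1 : R)) by rewrite lexx ler01.
have I1 : ((0 : R) <= (1 : R) <= (1 : R)) by rewrite lexx ler01.
pose phi w := f (w + h *: e_ j) - f w.
have dphi (s : R) : 0 <= s <= 1 -> is_derive (z + s *: (h *: e_ i)) (h *: e_ i) phi
   (h * ('D_(e_ i) f (z + (s * h) *: e_ i + h *: e_ j)
        - 'D_(e_ i) f (z + (s * h) *: e_ i))).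
  move=> s01.
  have D1 := dfw s 1 s01 I1; have D0 := dfw s 0 s01 I0.
  rewrite mul0r scale0r addr0 in D0; rewrite mul1r in D1.
  rewrite scalerA mulrBr -!/(_ *: 'D__ _ _) -!deriveZv//.
  apply: is_deriveB; last exact/derivableP/diff_derivable.
  have sE : (fun w => f (w + h *: e_ j)) = f \o shift (h *: e_ j) by [].
  rewrite sE.
  have E w : (fun x : R => x^-1 *: (((f \o shift (h *: e_ j)) \o shift w) (x *: (h *: e_ i))
      - (f \o shift (h *: e_ j)) w)) = (fun x : R => x^-1 *: ((f \o shift (w + h *: e_ j)) (x *: (h *: e_ i))
      - f (w + h *: e_ j))).
    by apply/funext => x /=; rewrite addrA.
  by split; [rewrite /derivable E|rewrite /derive E//]; exact: diff_derivable.
have [s s01 Es] := @MVT_line _ _ phi z (h *: e_ i) (fun s s01 => (@ex_derive _ _ _ _ _ _ _ (dphi s s01))).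
rewrite (@derive_val _ _ _ _ _ _ _ (dphi s s01)) in Es.
have -> : f (z + h *: e_ i + h *: e_ j) - f (z + h *: e_ i) - f (z + h *: e_ j) + f z =
   phi (z + h *: e_ i) - phi z by rewrite /phi; ring.
rewrite Es.
have H1 : `|'D_(e_ i) f (z + ((s * h) *: e_ i + h *: e_ j)) - 'D_(e_ i) f z -
    'd ('D_(e_ i) f) z ((s * h) *: e_ i + h *: e_ j)| <= e * (h + h).
  apply: le_trans (Hq _ _) _.
    rewrite -ball_normE /= sub0r normrN; apply: le_lt_trans hq.
    by have := nb s 1 s01 I1; rewrite mul1r.
  apply: ler_wpM2l; first exact: ltW.
  by have := nb s 1 s01 I1; rewrite mul1r.
have H0 : `|'D_(e_ i) f (z + (s * h) *: e_ i) - 'D_(e_ i) f z -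
    'd ('D_(e_ i) f) z ((s * h) *: e_ i)| <= e * (h + h).
  apply: le_trans (Hq _ _) _.
    rewrite -ball_normE /= sub0r normrN; apply: le_lt_trans hq.
    by have := nb s 0 s01 I0; rewrite mul0r scale0r addr0.
  apply: ler_wpM2l; first exact: ltW.
  by have := nb s 0 s01 I0; rewrite mul0r scale0r addr0.
rewrite addrA in H1; rewrite linearD/= in H1.
rewrite [X in h ^+ 2 * X]deriveE//.
have Ed : 'd ('D_(e_ i) f) z (h *: e_ j) = h * 'd ('D_(e_ i) f) z (e_ j).
  by rewrite linearZ.
rewrite Ed in H1.
set a := 'D_(e_ i) f (z + _ + _) in H1 *.
set b := 'D_(e_ i) f (z + (s * h) *: _) in H0 *.
set c := 'D_(e_ i) f z in H0 H1 *.
set d := 'd _ z (_ *: _) in H0 H1.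
set k := 'd _ z (e_ j) in H1 *.
have -> : h * (a - b) - h ^+ 2 * k = h * ((a - c - (d + h * k)) - (b - c - d)) by ring.
rewrite normrM (gtr0_norm h0).
have -> : 4 * e * h ^+ 2 = h * (e * (h + h) + e * (h + h)) by ring.
apply: ler_wpM2l; first exact: ltW.
by apply: le_trans (ler_normB _ _) _; apply: lerD.
Unshelve. all: by end_near. Qed.

Lemma young_arith (D D' k x y a : R) : 0 < k -> 0 < a ->
  `|D - k * x| <= 4 * (a / 16) * k -> `|D' - k * y| <= 4 * (a / 16) * k ->
  D = D' -> a = `|x - y| -> False.
Proof.
move=> k0 a0 H1 H2 DE aE; rewrite -DE in H2.
have : k * a <= k * (a / 2).
  rewrite -[X in X * a](gtr0_norm k0) aE -normrM -aE mulrBr.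
  have -> : k * x - k * y = (D - k * y) - (D - k * x) by ring.
  by apply: le_trans (ler_normB _ _) _; lra.
by rewrite ler_pM2l// => ?; lra.
Qed.

(** The second difference is symmetric in the two directions, so both mixed derivatives approximate
    the same number. If they differed by [a], the tolerance [a / 16] would make each error at most a
    quarter of [a * h ^+ 2], which is too small to account for the gap. *)
Lemma Young (f : plane R -> R) (z : plane R) :
  (\forall w \near z, differentiable f w) ->
  (forall i, differentiable ('D_(e_ i) f) z) ->
  'D_(e_ 1) ('D_(e_ 0) f) z = 'D_(e_ 0) ('D_(e_ 1) f) z.
Proof.
move=> df ddf; apply/eqP; rewrite -subr_eq0 -normr_eq0 -[_ == 0]negbK.
apply/negP => n0; set a := `|_| in n0.
have a0 : 0 < a by rewrite lt0r n0 /a normr_ge0.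
have e0 : 0 < a / 16 by rewrite divr_gt0.
have E1 := second_difference 1 df (ddf 0) e0.
have E2 := second_difference 0 df (ddf 1) e0.
suff /(@filter_ex _ (0 : R)^'+ _) [//] : \forall h \near (0 : R)^'+, False.
apply: filterS3 E1 E2 (nbhs_right_gt (0 : R)) => h H1 H2 h0.
have hh : 0 < h ^+ 2 by rewrite exprn_gt0.
apply: (young_arith hh a0 H1 H2 _ (erefl a)).
by rewrite (addrAC z); ring.
Qed.

End Calculus2.

(** * Closed balls, bounded Lipschitz functions, Gronwall's inequality *)

Section Calculus3.
Context {R : realType}.

Definition cball (c : plane R) (r : R) : set (plane R) := [set x | `|x - c| <= r].

Lemma compact_cball c r : compact (cball c r).
Proof.
have -> : cball c r = closed_ball_ (fun x : plane R => `|x|) c r.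
  by apply/seteqP; split => x /=; rewrite /cball /closed_ball_ /= distrC.
apply: bounded_closed_compact; last exact: closed_closed_ball_.
exists (`|c| + r); split; first exact: num_real.
move=> M HM x; rewrite /closed_ball_ /= => xr.
have -> : x = c - (c - x) by rewrite opprB addrCA subrr addr0.
by apply: le_trans (ler_normB _ _) _; apply: le_trans (ltW HM); rewrite lerD2l.
Qed.

Lemma cball_convex c r x y (s : R) : 0 <= s <= 1 -> cball c r x ->
  cball c r (x + y) -> cball c r (x + s *: y).
Proof.
move=> /andP[s0 s1]; rewrite /cball /= => H1 H2.
have -> : x + s *: y - c = (1 - s) *: (x - c) + s *: (x + y - c).
  by apply: plane_eq; rewrite !mxE; ring.
apply: le_trans (ler_normD _ _) _; rewrite !normrZ (ger0_norm s0).
rewrite ger0_norm ?subr_ge0//.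
have -> : r = (1 - s) * r + s * r by ring.
by apply: lerD; apply: ler_wpM2l => //; rewrite subr_ge0.
Qed.

Lemma cball_center c r : 0 <= r -> cball c r c.
Proof. by move=> r0; rewrite /cball /= subrr normr0. Qed.

Lemma nbhs_cball c r : 0 < r -> nbhs c (cball c r).
Proof.
move=> r0; apply/nbhs_ballP; exists r => //= y.
by rewrite -ball_normE /= /cball /= distrC => /ltW.
Qed.

Lemma bounded_cball (f : plane R -> R) c r :
  (forall x, cball c r x -> {for x, continuous f}) ->
  exists2 C, 0 <= C & forall x, cball c r x -> `|f x| <= C.
Proof.
move=> cf.
have /compact_bounded[N [_ HN]] : compact (f @` cball c r).
  apply: continuous_compact; last exact: compact_cball.
  apply: continuous_in_subspaceT => x; rewrite inE => xc; exact: cf.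
exists (`|N| + 1) => // x xc.
apply: HN; last by exists x.
by apply: le_lt_trans (ler_norm N) _; rewrite ltrDl.
Qed.

(** Boundedness is carried along so that the class is closed under products; polynomial vector
    fields are then treated coordinate by coordinate. *)
Definition bounded_lipschitz (V : normedModType R) (S : set V) (f : V -> R) :=
  exists2 C, 0 <= C & (forall s, S s -> `|f s| <= C) /\
    (forall s s', S s -> S s' -> `|f s - f s'| <= C * `|s - s'|).

Section BoundedLipschitz.
Variables (V : normedModType R) (S : set V).

Lemma bl_cst c : bounded_lipschitz S (fun=> c).
Proof.
exists `|c| => //; split=> // s s' _ _.
by rewrite subrr normr0 mulr_ge0.
Qed.

Lemma blN f : bounded_lipschitz S f -> bounded_lipschitz S (fun s => - f s).
Proof.
move=> [C C0 [H1 H2]]; exists C => //; split => [s /H1|s s' Ss Ss'].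
  by rewrite normrN.
by rewrite -opprD normrN; exact: H2.
Qed.

Lemma blD f g : bounded_lipschitz S f -> bounded_lipschitz S g ->
  bounded_lipschitz S (fun s => f s + g s).
Proof.
move=> [C C0 [H1 H2]] [D D0 [H3 H4]]; exists (C + D); first exact: addr_ge0.
split => [s Ss|s s' Ss Ss'].
  by apply: le_trans (ler_normD _ _) _; apply: lerD; [exact: H1|exact: H3].
have -> : f s + g s - (f s' + g s') = (f s - f s') + (g s - g s') by ring.
apply: le_trans (ler_normD _ _) _; rewrite mulrDl.
by apply: lerD; [exact: H2|exact: H4].
Qed.

Lemma blM f g : bounded_lipschitz S f -> bounded_lipschitz S g ->
  bounded_lipschitz S (fun s => f s * g s).
Proof.
move=> [C C0 [H1 H2]] [D D0 [H3 H4]].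
have CD := mulr_ge0 C0 D0.
exists (2 * (C * D)); first by rewrite mulr_ge0.
split => [s Ss|s s' Ss Ss'].
  rewrite normrM; apply: le_trans (ler_pM _ _ (H1 _ Ss) (H3 _ Ss)) _ => //.
  by lra.
have -> : f s * g s - f s' * g s' = f s * (g s - g s') + (f s - f s') * g s'.
  by ring.
apply: le_trans (ler_normD _ _) _; rewrite !normrM.
have -> : 2 * (C * D) * `|s - s'| = C * (D * `|s - s'|) + (C * `|s - s'|) * D.
  by ring.
by apply: lerD; apply: ler_pM => //; [exact: H1|exact: H4|exact: H2|exact: H3].
Qed.

End BoundedLipschitz.

Lemma bl_C1 (f : plane R -> R) c r :
  (forall x, cball c r x -> differentiable f x) ->
  (forall i x, cball c r x -> {for x, continuous ('D_(e_ i) f)}) ->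
  bounded_lipschitz (cball c r) f.
Proof.
move=> df cf.
have [C C0 HC] := bounded_cball (fun x xc => differentiable_continuous (df x xc)).
have [C1 C10 HC1] := bounded_cball (cf 0).
have [C2 C20 HC2] := bounded_cball (cf 1).
exists (C + C1 + C2); first by rewrite !addr_ge0.
split=> [s Ss|s s' Ss Ss'].
  by apply: le_trans (HC _ Ss) _; rewrite -addrA lerDl addr_ge0.
have [t t01] : exists2 t : R, 0 <= t <= 1 & f (s' + (s - s')) - f s' =
    'D_(s - s') f (s' + t *: (s - s')).
  apply: MVT_line => t t01; apply: diff_derivable; apply: df.
  by apply: cball_convex => //; rewrite addrCA subrr addr0.
rewrite [s' + (s - s')]addrCA subrr addr0 => ->.
have St : cball c r (s' + t *: (s - s')).
  by apply: cball_convex => //; rewrite addrCA subrr addr0.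
rewrite derive_plane; last exact: df.
apply: le_trans (ler_normD _ _) _; rewrite !normrM -addrA mulrDl -[leLHS]add0r.
apply: lerD; first exact: mulr_ge0.
rewrite mulrDl [C1 * _]mulrC [C2 * _]mulrC.
apply: lerD.
  exact: (ler_pM (normr_ge0 _) (normr_ge0 _) (coord_le _ _ _) (HC1 _ St)).
exact: (ler_pM (normr_ge0 _) (normr_ge0 _) (coord_le _ _ _) (HC2 _ St)).
Qed.

(** The function [E t * expR (- K * t) - eta * t] has nonpositive derivative, because
    [expR (- K * t) <= 1] for [t >= 0]. *)
Lemma gronwall (E dE : R -> R) (T K eta : R) : 0 <= K -> 0 <= eta ->
  (forall s : R, 0 <= s <= T -> is_derive s 1 E (dE s)) ->
  (forall s : R, 0 <= s <= T -> dE s <= K * E s + eta) ->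
  forall s : R, 0 <= s <= T -> E s <= expR (K * s) * (E 0 + eta * s).
Proof.
move=> K0 eta0 dEs bE s /andP[s0 sT].
pose g t := E t * expR (- K * t) - eta * t.
pose dg t := (dE t - K * E t) * expR (- K * t) - eta.
have dgs (t : R) : 0 <= t <= T -> is_derive t 1 g (dg t).
  move=> tT; have := dEs t tT => dEt.
  have e1 : is_derive t 1 (fun t => expR (- K * t)) (- K * expR (- K * t)).
    have Hl : is_derive t 1 (fun t : R => - K * t) (- K).
      by apply: is_derive_eq; rewrite -[_ *: _]/(_ * _) mulr1.
    apply: is_derive_eq.
    by rewrite mulrC.
  rewrite /g; apply: is_derive_eq.
  by rewrite /dg -![_ *: _]/(_ * _); ring.
have [->|sn0] := eqVneq s 0; first by rewrite !mulr0 expR0 addr0 mul1r.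
have sgt0 : 0 < s by rewrite lt0r sn0.
have [c cs gE] : exists2 c, c \in `]0, s[ & g s - g 0 = dg c * (s - 0).
  apply: MVT => //.
    move=> x; rewrite in_itv /= => /andP[x0 xs]; apply: dgs.
    by rewrite (ltW x0) (le_trans (ltW xs)).
  apply: derivable_within_continuous => x; rewrite in_itv /= => /andP[x0 xs].
  have /dgs ? : 0 <= x <= T by rewrite x0 (le_trans xs).
  exact: ex_derive.
have {cs} /andP[c0 cs] : 0 < c < s by move: cs; rewrite in_itv.
have dgc : dg c <= 0.
  have cT : 0 <= c <= T by rewrite (ltW c0) (le_trans (ltW cs)).
  have H1 := bE c cT.
  have H2 : expR (- K * c) <= 1 by rewrite -expR0 ler_expR mulNr oppr_le0 mulr_ge0// ltW.
  have H3 : 0 <= expR (- K * c) by exact: expR_ge0.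
  rewrite /dg subr_le0; apply: le_trans (_ : eta * expR (- K * c) <= _).
    by apply: ler_wpM2r => //; rewrite lerBlDl.
  by rewrite ler_piMr.
have : g s <= g 0 by rewrite -subr_le0 gE subr0 mulr_le0_ge0// ltW.
rewrite /g !mulr0 expR0 mulr1 subr0 => H.
have ep : 0 < expR (K * s) by exact: expR_gt0.
have ee : expR (- K * s) * expR (K * s) = 1 by rewrite mulNr -expRD addNr expR0.
have -> : E s = expR (K * s) * (E s * expR (- K * s)).
  by rewrite mulrCA mulrA -mulrA [expR (K * s) * _]mulrC ee mulr1.
rewrite ler_pM2l//; rewrite lerBlDr in H; apply: le_trans H _; lra.
Qed.

End Calculus3.

(** * Comparison of curves of matrices; local surjectivity *)

Section Calculus4.
Context {R : realType}.

(** [C] depends only on [T], [L] and the size of the matrices, so that one constant serves for all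
    pairs of curves. The maximum norm is not differentiable; the scalar inequality is applied to the
    sum [E] of the squares of the entries, which dominates the square of the norm. *)
Lemma gronwall_mx m n (T L : R) : 0 <= T -> 0 <= L -> exists2 C, 0 <= C &
  forall (s1 s2 d1 d2 : R -> 'M[R]_(m.+1, n.+1)) (e : R), 0 <= e ->
  (forall t : R, 0 <= t <= T -> is_derive t 1 s1 (d1 t)) ->
  (forall t : R, 0 <= t <= T -> is_derive t 1 s2 (d2 t)) ->
  (forall t : R, 0 <= t <= T -> `|d1 t - d2 t| <= L * `|s1 t - s2 t| + e) ->
  `|s1 0 - s2 0| <= e ->
  forall t : R, 0 <= t <= T -> `|s1 t - s2 t| <= C * e.
Proof.
move=> T0 L0.
(* The number of entries, which is the cost of replacing the norm by the sum of squares. *)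
pose N : R := \sum_(i < m.+1) \sum_(j < n.+1) 1.
have N0 : 0 <= N by do 2! apply: sumr_ge0 => ? _.
pose K := L + L * N + 1.
have LN : 0 <= L * N by exact: mulr_ge0.
have K0 : 0 <= K by rewrite /K !addr_ge0.
pose D := expR (K * T) * (N + N * T).
have D0 : 0 <= D by rewrite mulr_ge0 ?expR_ge0// addr_ge0// mulr_ge0.
exists (Num.sqrt D) => // s1 s2 d1 d2 e e0 ds1 ds2 Hd H0 t tT.
pose d t := s1 t - s2 t; pose dd t := d1 t - d2 t.
pose E t := \sum_i \sum_j (d t i j) ^+ 2.
pose dE t := \sum_i \sum_j (2 * d t i j * dd t i j).
have le_E t' i j : (d t' i j) ^+ 2 <= E t'.
  rewrite /E (bigD1 i)//= (bigD1 j)//= -addrA lerDl addr_ge0//.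
    by apply: sumr_ge0 => ? _; exact: sqr_ge0.
  by apply: sumr_ge0 => ? _; apply: sumr_ge0 => ? _; exact: sqr_ge0.
have E0 t' : 0 <= E t'.
  by apply: sumr_ge0 => ? _; apply: sumr_ge0 => ? _; exact: sqr_ge0.
have nE t' : `|d t'| ^+ 2 <= E t'.
  rewrite -[leRHS]sqr_sqrtr// ler_sqr ?nnegrE ?sqrtr_ge0//.
  apply: norm_mx_le => i j; rewrite -sqrtr_sqr ler_wsqrtr//; exact: le_E.
have dEs t' : 0 <= t' <= T -> is_derive t' 1 E (dE t').
  move=> t'T; rewrite /E /dE.
  have H i j : is_derive t' 1 (fun t => (d t i j) ^+ 2) (2 * d t' i j * dd t' i j).
    have [D1 V1] := ds1 t' t'T; have [D2 V2] := ds2 t' t'T.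
    have Hij : is_derive t' 1 (fun t => d t i j) (dd t' i j).
      have -> : (fun t => d t i j) = (fun t => s1 t i j) - (fun t => s2 t i j).
        by apply/funext => x; rewrite /d !mxE.
      rewrite /dd !mxE; apply: is_deriveB.
        rewrite -V1 -(derive_entry i j D1); apply: derivableP.
        by have /derivable_mxP := D1; apply.
      rewrite -V2 -(derive_entry i j D2); apply: derivableP.
      by have /derivable_mxP := D2; apply.
    apply: is_derive_eq.
    by rewrite -![_ *: _]/(_ * _); ring.
  have -> : (fun t0 => \sum_i \sum_j d t0 i j ^+ 2) =
      \sum_i \sum_j (fun t0 => d t0 i j ^+ 2).
    by apply/funext => x; rewrite fct_sumE; apply: eq_bigr => i _; rewrite fct_sumE.
  by apply: is_derive_sum => i; apply: is_derive_sum => j; exact: H.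
have bE t' : 0 <= t' <= T -> dE t' <= K * E t' + N * e ^+ 2.
  move=> t'T.
  have -> : K * E t' + N * e ^+ 2 =
      \sum_i \sum_j ((L + 1) * d t' i j ^+ 2 + L * E t' + e ^+ 2).
    under eq_bigr do rewrite !big_split/= -mulr_sumr.
    rewrite !big_split/= -mulr_sumr -/(E t').
    have ct c : \sum_(i < m.+1) \sum_(j < n.+1) c = N * c :> R.
      rewrite /N mulr_suml; apply: eq_bigr => i _.
      by rewrite mulr_suml; apply: eq_bigr => j _; rewrite mul1r.
    by rewrite !ct /K; ring.
  apply: ler_sum => i _; apply: ler_sum => j _.
  have h1 : `|dd t' i j| <= L * `|d t'| + e.
    exact: le_trans (coord_le _ _ _) (Hd _ t'T).
  have h2 : 2 * d t' i j * dd t' i j <= 2 * `|d t' i j| * `|dd t' i j|.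
    by rewrite -!mulrA ler_pM2l// -normrM ler_norm.
  apply: le_trans h2 _; rewrite -[d t' i j ^+ 2]real_normK ?num_real//.
  have h3 := nE t'.
  have h4 : `|d t' i j| * `|dd t' i j| <= `|d t' i j| * (L * `|d t'| + e).
    exact: ler_wpM2l.
  move: h4 h3; move: (`|d t' i j|) (`|dd t' i j|) (`|d t'|) (E t') => a b c f.
  move=> h4 h3.
  (* Both cross terms are split by [2 * x * y <= x ^+ 2 + y ^+ 2]. *)
  have h5 : L * (2 * (a * c)) <= L * (a ^+ 2 + f).
    apply: ler_wpM2l => //; have := sqr_ge0 (a - c); rewrite sqrrB; lra.
  have := sqr_ge0 (a - e); rewrite sqrrB; lra.
have ET := @gronwall _ E dE T K (N * e ^+ 2) K0 (mulr_ge0 N0 (sqr_ge0 e)) dEs bE t tT.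
have E00 : E 0 <= N * e ^+ 2.
  rewrite /N mulr_suml; apply: ler_sum => i _.
  rewrite mulr_suml; apply: ler_sum => j _; rewrite mul1r.
  rewrite -[leLHS]real_normK ?num_real// ler_sqr ?nnegrE//.
  exact: le_trans (coord_le _ _ _) H0.
have {}ET : E t <= D * e ^+ 2.
  move/andP: tT => [t0 tT].
  apply: le_trans ET _; rewrite /D -[X in _ <= X]mulrA; apply: ler_pM.
  - exact: expR_ge0.
  - by rewrite addr_ge0// mulr_ge0// mulr_ge0// sqr_ge0.
  - rewrite ler_expR; exact: ler_wpM2l.
  - rewrite mulrDl; apply: lerD => //.
    by rewrite mulrAC; apply: ler_wpM2r; [exact: sqr_ge0|exact: ler_wpM2l].
rewrite -[Num.sqrt D * e]ger0_norm; last by rewrite mulr_ge0.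
rewrite -[`|s1 t - s2 t|]ger0_norm// -[leLHS]sqrtr_sqr -[leRHS]sqrtr_sqr.
by apply: ler_wsqrtr; rewrite exprMn sqr_sqrtr//; apply: le_trans (nE t) ET.
Qed.

Lemma norm_mulmx2 (u : plane R) (A : 'M[R]_2) : `|u *m A| <= 2 * `|A| * `|u|.
Proof.
apply: norm_mx_le => i j; rewrite mxE big_ord_recl big_ord1.
apply: le_trans (ler_normD _ _) _; rewrite !normrM.
have -> : 2 * `|A| * `|u| = `|u| * `|A| + `|u| * `|A| by ring.
by apply: lerD; apply: ler_pM => //; apply: coord_le.
Qed.

Lemma derive_at_min (f : plane R -> R) (z v : plane R) :
  differentiable f z -> (\forall w \near z, f z <= f w) -> 'D_v f z = 0.
Proof.
move=> df fmin.
have nn u : 0 <= 'D_u f z.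
  rewrite leNgt; apply/negP => D0.
  have D : derivable f z u by exact: diff_derivable.
  have /= H := D.
  have e0 : 0 < - 'D_u f z by rewrite oppr_gt0.
  have /cvgrPdist_lt/(_ _ e0) HH := H.
  have Hmin : \forall h \near (0 : R), f z <= f (h *: u + z).
    have cv : (h *: u + z) @[h --> (0 : R)] --> (0 : R) *: u + z.
      by apply: cvgD; [exact: scalel_continuous|exact: cvg_cst].
    by rewrite scale0r add0r in cv; exact: (cv _ fmin).
  suff /(@filter_ex _ (0 : R)^'+ _) [//] : \forall h \near (0 : R)^'+, False.
  have F1 : \forall h \near (0 : R)^'+, f z <= f (h *: u + z) by apply: cvg_within; exact: Hmin.
  have F2 : \forall h \near (0 : R)^'+, `|'D_u f z - h^-1 *: ((f \o shift z) (h *: u) - f z)| < - 'D_u f z.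
    move: HH; rewrite /dnbhs !near_withinE; apply: filterS => h Hh h0; apply: Hh.
    by rewrite gt_eqF.
  apply: filterS3 F2 F1 (nbhs_right_gt (0 : R)) => h /= h1 h2 h3.
  have : 0 <= h^-1 *: (f (h *: u + z) - f z).
    by rewrite -[_ *: _]/(_ * _); apply: mulr_ge0; [rewrite invr_ge0; exact: ltW|rewrite subr_ge0].
  move: h1; set q := _ *: _; rewrite ltr_norml => /andP[q1 q2] q3; lra.
apply/eqP; rewrite eq_le nn andbT.
have := nn (- v); rewrite -scaleN1r deriveZv// scaleN1r oppr_ge0.
by [].
Qed.

(** A point [y] close to [f z] is attained where the squared distance [Q] from [f w] to [y] is least
    on a small closed ball around [z]: the minimum is not on the boundary, because [f] expands
    distances to [z], and at an interior critical point the invertible Jacobian forces [f w = y]. *)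
Lemma local_surj (f : plane R -> plane R) (z : plane R) (O : set (plane R)) :
  nbhs z O -> (forall w, O w -> differentiable f w) ->
  (forall w, O w -> jacobian f w \in unitmx) ->
  forall V, nbhs z V -> nbhs (f z) (f @` V).
Proof.
move=> zO df Ju V zV.
have Oz := nbhs_singleton zO.
pose J := jacobian f z.
pose k := 2 * `|invmx J| + 1.
have k0 : 0 < k by rewrite ltr_wpDl// mulr_ge0.
have Jb v : `|v| <= k * `|'D_v f z|.
  rewrite deriveEjacobian; last exact: df.
  rewrite -[v in leLHS](mulmxK (Ju _ Oz)).
  apply: le_trans (norm_mulmx2 _ _) _.
  by apply: ler_wpM2r => //; rewrite lerDl.
have c0 : 0 < (2 * k)^-1 by rewrite invr_gt0 mulr_gt0.
have /nbhs_ballP[r1 /= r10 H1] := differentiable_eps (df z Oz) c0.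
have zOV : nbhs z (O `&` V) by exact: filterI.
have /nbhs_ballP[r2 /= r20 H2] := zOV.
pose r := Num.min r1 r2 / 2.
have r0 : 0 < r by rewrite divr_gt0// lt_min r10 r20.
have rr1 : r < r1 by rewrite /r ltr_pdivrMr// mulr_natr mulr2n ltr_pwDl// ge_min lexx.
have rr2 : r < r2 by rewrite /r ltr_pdivrMr// mulr_natr mulr2n ltr_pwDl// ge_min lexx orbT.
have cb w : cball z r w -> O w /\ V w.
  move=> wr; apply: H2; rewrite -ball_normE /= distrC.
  exact: le_lt_trans wr rr2.
have far w : cball z r w -> `|w - z| <= 2 * k * `|f w - f z|.
  move=> wr; have := H1 (w - z).
  rewrite -ball_normE /= sub0r normrN => /(_ (le_lt_trans wr rr1)).
  rewrite addrCA subrr addr0 -deriveE; last exact: df.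
  have := Jb (w - z).
  set a := `|w - z|; set D := 'D_(w - z) f z => h1 h2.
  have h3 : `|D| <= `|f w - f z| + (2 * k)^-1 * a.
    rewrite -lerBlDl; apply: le_trans _ h2.
    have := ler_distD (f w - f z) D 0; rewrite !subr0 [`|D - _|]distrC.
    by rewrite addrC -lerBlDl addrC.
  have h4 : k * `|D| <= k * (`|f w - f z| + (2 * k)^-1 * a) by rewrite ler_pM2l.
  have h5 : k * ((2 * k)^-1 * a) = a / 2.
    by rewrite invfM; field; rewrite gt_eqF.
  rewrite mulrDr h5 in h4; lra.
(* On the boundary [far] gives [|f w - f z| >= r / (2 * k) = 8 * eta], hence a distance of at least
   [7 * eta] to [y], whereas [Q z <= 2 * eta ^+ 2]. *)
pose eta := r / (16 * k).
have eta0 : 0 < eta by rewrite divr_gt0// mulr_gt0.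
apply/nbhs_ballP; exists eta => //= y; rewrite -ball_normE /= => yb.
pose Q w := (f w 0 0 - y 0 0) ^+ 2 + (f w 0 1 - y 0 1) ^+ 2.
have dfi w i : O w -> differentiable (fun w => f w 0 i) w.
  by move=> /df; exact: differentiable_entry.
have dQi w i : O w -> differentiable (fun w => (f w 0 i - y 0 i) ^+ 2) w.
  move=> Ow; have d1 : differentiable (fun w => f w 0 i - y 0 i) w.
    by apply: differentiableB; [exact: dfi|exact: differentiable_cst].
  exact: (differentiableM d1 d1).
have dQ w : O w -> differentiable Q w.
  by move=> Ow; apply: differentiableD; apply: dQi.
have [w wcb wmin] : exists2 w, w \in cball z r & forall t, t \in cball z r -> Q w <= Q t.
  apply: compact_EVT_min; [|exact: compact_cball|].
    by exists z; apply: cball_center; exact: ltW.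
  apply: continuous_in_subspaceT => x; rewrite inE => xc.
  by apply: differentiable_continuous; apply: dQ; exact: (cb _ xc).1.
rewrite inE in wcb.
have Qn w' : `|f w' - y| ^+ 2 <= Q w'.
  have Q0 : 0 <= Q w' by rewrite addr_ge0// sqr_ge0.
  rewrite -[leRHS]sqr_sqrtr// ler_sqr ?nnegrE ?sqrtr_ge0//.
  apply: norm_mx_le => i j; rewrite ord1 -sqrtr_sqr ler_wsqrtr// /Q !mxE.
  move: j; apply: ord2P; rewrite ?lerDl ?lerDr; exact: sqr_ge0.
have Qz : Q z <= 2 * eta ^+ 2.
  rewrite /Q mulr2n mulrDl !mul1r; apply: lerD;
  rewrite -[leLHS]real_normK ?num_real// ler_sqr ?nnegrE ?(ltW eta0)//;
  have := coord_le (f z - y) 0; [move/(_ 0)|move/(_ 1)]; rewrite !mxE => h;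
  by apply: le_trans h _; exact: ltW.
have wz : `|w - z| < r.
  rewrite lt_neqAle; apply/andP; split => //; apply/eqP => wr.
  have h1 := far _ wcb; rewrite wr in h1.
  have h2 : `|f w - f z| <= `|f w - y| + eta.
    by apply: le_trans (ler_distD y _ _) _; rewrite lerD2l distrC ltW.
  have h3 : `|f w - y| ^+ 2 <= 2 * eta ^+ 2.
    apply: le_trans (Qn _) _; apply: le_trans Qz; apply: wmin.
    by rewrite inE; apply: cball_center; exact: ltW.
  have rE : r = eta * (16 * k) by rewrite /eta divfK// gt_eqF// mulr_gt0.
  have h4 : 16 * eta <= 2 * (`|f w - y| + eta).
    rewrite -(ler_pM2l k0).
    have := ler_wpM2l (ltW (mulr_gt0 (ltr0n _ 2) k0)) h2; rewrite {1}rE in h1.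
    by move=> h5; lra.
  have h6 : 7 * eta <= `|f w - y| by lra.
  have : (7 * eta) ^+ 2 <= 2 * eta ^+ 2.
    by apply: le_trans h3; rewrite ler_sqr ?nnegrE// mulr_ge0// ltW.
  have e2 : 0 < eta ^+ 2 by rewrite exprn_gt0.
  by rewrite exprMn; lra.
have [Ow Vw] := cb _ wcb.
have near_min : \forall w' \near w, Q w <= Q w'.
  apply/nbhs_ballP; exists (r - `|w - z|); first by rewrite /= subr_gt0.
  move=> w'; rewrite -ball_normE /= => h; apply: wmin; rewrite inE /cball /=.
  apply: le_trans (ler_distD w _ _) _; rewrite distrC.
  by rewrite ltrBrDr in h; exact: ltW.
(* The direction that moves [f] along [f w - y]: there the derivative of [Q] is [2 * Q w], and it
   vanishes at a minimum. *)
pose v := (f w - y) *m invmx (jacobian f w).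
have Dv : 'D_v f w = f w - y.
  by rewrite deriveEjacobian ?mulmxKV//; [exact: Ju|exact: df].
have := derive_at_min v (dQ _ Ow) near_min.
have di i : is_derive w v (fun w => f w 0 i) ((f w - y) 0 i).
  rewrite -Dv -derive_entry; last by apply: diff_derivable; exact: df.
  by apply/derivableP/diff_derivable/dfi.
have dX i : is_derive w v (fun w => (f w 0 i - y 0 i) ^+ 2) (2 * (f w 0 i - y 0 i) ^+ 2).
  have := di i => ?.
  apply: is_derive_eq; rewrite -[_ *: _]/(_ * _) subr0 !mxE; ring.
have /@derive_val -> : is_derive w v Q (2 * (f w 0 0 - y 0 0) ^+ 2 + 2 * (f w 0 1 - y 0 1) ^+ 2).
  by apply: is_deriveD; exact: dX.
move=> Q0; exists w => //; apply/eqP; rewrite -subr_eq0 -normr_le0.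
have : Q w = 0 by rewrite /Q; lra.
have := Qn w => + QE; rewrite QE.
by rewrite -[leRHS](expr0n _ 2%N) ler_sqr ?nnegrE.
Qed.

End Calculus4.

(** * Moebius transformations *)

Section Mobius.
Context {R : realType}.

Lemma mx2_eq (A B : 'M[R]_2) : A 0 0 = B 0 0 -> A 0 1 = B 0 1 ->
  A 1 0 = B 1 0 -> A 1 1 = B 1 1 -> A = B.
Proof.
move=> h1 h2 h3 h4; apply/matrixP; apply: ord2P; apply: ord2P => //.
Qed.

Definition mx2 (a b c d : R) : 'M[R]_2 :=
  \matrix_(i, j) (if i == 0 then (if j == 0 then a else b)
                  else (if j == 0 then c else d)).

Lemma mx2E a b c d : (mx2 a b c d 0 0 = a) * (mx2 a b c d 0 1 = b) *
  (mx2 a b c d 1 0 = c) * (mx2 a b c d 1 1 = d).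
Proof. by rewrite !mxE. Qed.

Lemma mul2E (A B : 'M[R]_2) i j : (A * B) i j = A i 0 * B 0 j + A i 1 * B 1 j.
Proof. by rewrite mxE big_ord_recl big_ord1; congr (_ + A i _ * B _ j); apply/val_inj. Qed.

Lemma mulv2E (v : plane R) (B : 'M[R]_2) j :
  (v *m B) 0 j = v 0 0 * B 0 j + v 0 1 * B 1 j.
Proof. by rewrite mxE big_ord_recl big_ord1; congr (_ + v 0 _ * B _ j); apply/val_inj. Qed.

Lemma det2E (A : 'M[R]_2) : \det A = A 0 0 * A 1 1 - A 0 1 * A 1 0.
Proof.
rewrite (expand_det_row _ 0) big_ord_recl big_ord1 /cofactor !det_mx11 !mxE /=.
rewrite expr0 expr1 mul1r mulN1r mulrN.
by congr (A _ _ * A _ _ - A _ _ * A _ _); apply/val_inj.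
Qed.

Lemma one2E : ((1 : 'M[R]_2) 0 0 = 1) * ((1 : 'M[R]_2) 0 1 = 0) *
  ((1 : 'M[R]_2) 1 0 = 0) * ((1 : 'M[R]_2) 1 1 = 1).
Proof. by rewrite !mxE. Qed.

Lemma opp2E (A : 'M[R]_2) i j : (- A) i j = - A i j. Proof. by rewrite mxE. Qed.

Lemma detM2 (A B : 'M[R]_2) : \det (A * B) = \det A * \det B.
Proof. exact: det_mulmx. Qed.

Definition adj2 (A : 'M[R]_2) := mx2 (A 1 1) (- A 0 1) (- A 1 0) (A 0 0).

Lemma adj2K (A : 'M[R]_2) : \det A = 1 -> A * adj2 A = 1.
Proof.
rewrite det2E => h; apply: mx2_eq; rewrite mul2E !mx2E !one2E; lra.
Qed.

Lemma adj2Kl (A : 'M[R]_2) : \det A = 1 -> adj2 A * A = 1.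
Proof.
rewrite det2E => h; apply: mx2_eq; rewrite mul2E !mx2E !one2E; lra.
Qed.

Lemma det_adj2 (A : 'M[R]_2) : \det (adj2 A) = \det A.
Proof. by rewrite !det2E !mx2E; ring. Qed.

Lemma invmx_adj2 (A : 'M[R]_2) : \det A = 1 -> invmx A = adj2 A.
Proof.
move=> dA; have Au : A \in unitmx by rewrite unitmxE dA unitr1.
by rewrite -[RHS](mulKmx Au) [A *m _]adj2K// mulmx1.
Qed.

Lemma half_planeE (z : plane R) : half_plane z = (0 < z 0 1) :> Prop.
Proof. by []. Qed.

(** The squared modulus of the complex number [c z + d]. *)
Definition mden (A : 'M[R]_2) (z : plane R) :=
  (A 1 0 * z 0 0 + A 1 1) ^+ 2 + (A 1 0 * z 0 1) ^+ 2.

Lemma mden_gt0 (A : 'M[R]_2) z : \det A = 1 -> half_plane z -> 0 < mden A z.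
Proof.
rewrite det2E half_planeE /mden => dA y0.
have [c0|c0] := eqVneq (A 1 0) 0.
  have d0 : A 1 1 != 0.
    by apply: contra_eq_neq dA => ->; rewrite c0 !mulr0 subr0 eq_sym oner_eq0.
  by rewrite c0 !mul0r add0r expr0n addr0 exprn_even_gt0.
rewrite ltr_wpDl ?sqr_ge0// exprn_even_gt0//= mulf_neq0//.
by rewrite gt_eqF.
Qed.

Lemma mobius0 (A : 'M[R]_2) z : mobius A z 0 0 =
  ((A 0 0 * z 0 0 + A 0 1) * (A 1 0 * z 0 0 + A 1 1)
     + A 0 0 * A 1 0 * z 0 1 ^+ 2) / mden A z.
Proof. by rewrite /mobius hpoint0. Qed.

Lemma mobius1 (A : 'M[R]_2) z : mobius A z 0 1 = \det A * z 0 1 / mden A z.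
Proof. by rewrite /mobius hpoint1. Qed.

Lemma mobius_half (A : 'M[R]_2) z : \det A = 1 -> half_plane z ->
  half_plane (mobius A z).
Proof.
move=> dA Hz; rewrite half_planeE mobius1 dA mul1r divr_gt0//.
exact: mden_gt0.
Qed.

Lemma mobius_id (z : plane R) : mobius 1 z = z.
Proof.
by apply: plane_eq; rewrite ?mobius0 ?mobius1 /mden ?det1 !one2E
  !(mul0r, mulr0, mul1r, mulr1, add0r, addr0, expr1n, expr0n) /= ?addr0 divr1.
Qed.

Lemma mobius_opp (A : 'M[R]_2) z : mobius (- A) z = mobius A z.
Proof.
apply: plane_eq; rewrite ?mobius0 ?mobius1.
  by rewrite /mden !opp2E; congr (_ / _); ring.
by rewrite /mden !det2E !opp2E; congr (_ / _); ring.
Qed.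

Lemma mden_mul (A B : 'M[R]_2) z : \det B = 1 -> half_plane z ->
  mden (A * B) z = mden A (mobius B z) * mden B z.
Proof.
move=> dB Hz; have := mden_gt0 dB Hz; rewrite /mden mobius0 mobius1 det2E.
rewrite /mden !mul2E => N0; field.
by rewrite gt_eqF.
Qed.

Lemma mobius_comp (A B : 'M[R]_2) z : \det A = 1 -> \det B = 1 -> half_plane z ->
  mobius (A * B) z = mobius A (mobius B z).
Proof.
move=> dA dB Hz.
have N0 := mden_gt0 dB Hz.
have M0 := mden_gt0 dA (mobius_half dB Hz).
apply: plane_eq; rewrite ?(mobius0 (A * B)) ?(mobius1 (A * B)) ?(mobius0 A) ?(mobius1 A) mden_mul//;
  move: M0; set M := mden A _ => M0.
  rewrite (mobius0 B) (mobius1 B) det2E !mul2E /mden; rewrite /mden in N0.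
  field; by rewrite !gt_eqF.
rewrite detM2 (mobius1 B).
by field; rewrite !gt_eqF.
Qed.

Definition ii : plane R := hpoint 0 1.

Lemma ii_half : half_plane ii. Proof. by rewrite half_planeE hpoint1. Qed.

(* Derivative of [mobius A]: multiplication by the complex number
   [(c z + d)^-2 = mre + i mim]. *)
Definition mre (A : 'M[R]_2) (z : plane R) :=
  ((A 1 0 * z 0 0 + A 1 1) ^+ 2 - (A 1 0 * z 0 1) ^+ 2) / mden A z ^+ 2.
Definition mim (A : 'M[R]_2) (z : plane R) :=
  - (2 * (A 1 0 * z 0 0 + A 1 1) * (A 1 0 * z 0 1)) / mden A z ^+ 2.
Definition mder (A : 'M[R]_2) (z v : plane R) :=
  hpoint (mre A z * v 0 0 - mim A z * v 0 1) (mim A z * v 0 0 + mre A z * v 0 1).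

Lemma diff_x (i : 'I_2) (z : plane R) : differentiable (fun z : plane R => z 0 i) z.
Proof. exact: differentiable_coord. Qed.

Lemma der_x (i : 'I_2) (z v : plane R) : is_derive z v (fun z : plane R => z 0 i) (v 0 i).
Proof.
split; first exact/diff_derivable/diff_x.
by rewrite derive_entry ?derive_id//; exact: derivable_id.
Qed.

Lemma diff_aff (a b : R) (i : 'I_2) (z : plane R) :
  differentiable (fun z : plane R => a * z 0 i + b) z.
Proof.
apply: differentiableD; last exact: differentiable_cst.
by apply: differentiableM; [exact: differentiable_cst|exact: diff_x].
Qed.

Lemma der_aff (a b : R) (i : 'I_2) (z v : plane R) :
  is_derive z v (fun z : plane R => a * z 0 i + b) (a * v 0 i).
Proof.
have := der_x i z v => ?; apply: is_derive_eq.
by rewrite -![_ *: _]/(_ * _) ; ring.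
Qed.

Lemma diff_sq (f : plane R -> R) (z : plane R) : differentiable f z ->
  differentiable (fun z => f z ^+ 2) z.
Proof. move=> df; exact: (differentiableM df df). Qed.

Lemma diff_mden A (z : plane R) : differentiable (mden A) z.
Proof.
apply: differentiableD; apply: diff_sq; first exact: diff_aff.
by apply: differentiableM; [exact: differentiable_cst|exact: diff_x].
Qed.

Lemma diff_inv_mden A (z : plane R) : \det A = 1 -> half_plane z ->
  differentiable (fun z => (mden A z)^-1) z.
Proof.
move=> dA Hz; apply: differentiableV; first exact: diff_mden.
by rewrite gt_eqF// mden_gt0.
Qed.

Lemma der_quot (P N : plane R -> R) (z v : plane R) dP dN : N z != 0 ->
  differentiable P z -> differentiable N z ->
  is_derive z v P dP -> is_derive z v N dN ->
  is_derive z v (fun z => P z / N z) ((dP * N z - P z * dN) / N z ^+ 2).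
Proof.
move=> N0 dfP dfN hP hN.
have dV : is_derive z v (fun z => (N z)^-1) (- (N z) ^- 2 * dN).
  have dd : derivable N z v by exact: diff_derivable.
  split; first exact: derivableV.
  by rewrite (deriveV N0 dd) (@derive_val _ _ _ _ _ _ _ hN).
apply: is_derive_eq; rewrite -![_ *: _]/(_ * _); field.
by [].
Qed.

Lemma mobius_der A (z v : plane R) : \det A = 1 -> half_plane z ->
  differentiable (mobius A) z /\ 'D_v (mobius A) z = mder A z v.
Proof.
move=> dA Hz; have N0 : mden A z != 0 by rewrite gt_eqF// mden_gt0.
have dN := diff_mden A z.
have hN : is_derive z v (mden A)
  (2 * (A 1 0 * z 0 0 + A 1 1) * (A 1 0 * v 0 0) + 2 * (A 1 0 * z 0 1) * (A 1 0 * v 0 1)).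
  have h1 := der_aff (A 1 0) (A 1 1) 0 z v; have h2 := der_x 1 z v.
  apply: is_derive_eq; rewrite -![_ *: _]/(_ * _); ring.
pose P0 (z : plane R) := (A 0 0 * z 0 0 + A 0 1) * (A 1 0 * z 0 0 + A 1 1)
     + A 0 0 * A 1 0 * z 0 1 ^+ 2.
pose P1 (z : plane R) := \det A * z 0 1.
have dP0 : differentiable P0 z.
  apply: differentiableD.
    by apply: differentiableM; exact: diff_aff.
  apply: differentiableM; first exact: differentiable_cst.
  by apply: diff_sq; exact: diff_x.
have dP1 : differentiable P1 z.
  by apply: differentiableM; [exact: differentiable_cst|exact: diff_x].
have hP0 : is_derive z v P0 (A 0 0 * v 0 0 * (A 1 0 * z 0 0 + A 1 1) +
   (A 0 0 * z 0 0 + A 0 1) * (A 1 0 * v 0 0) + A 0 0 * A 1 0 * (2 * z 0 1 * v 0 1)).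
  have h1 := der_aff (A 1 0) (A 1 1) 0 z v; have h2 := der_x 1 z v.
  have h3 := der_aff (A 0 0) (A 0 1) 0 z v.
  apply: is_derive_eq; rewrite -![_ *: _]/(_ * _); ring.
have hP1 : is_derive z v P1 (\det A * v 0 1).
  have h2 := der_x 1 z v.
  apply: is_derive_eq; rewrite -![_ *: _]/(_ * _); ring.
have q0 := der_quot N0 dP0 dN hP0 hN.
have q1 := der_quot N0 dP1 dN hP1 hN.
have e0 : (fun z => mobius A z 0 0) = (fun z => P0 z / mden A z).
  by apply/funext => w; rewrite mobius0.
have e1 : (fun z => mobius A z 0 1) = (fun z => P1 z / mden A z).
  by apply/funext => w; rewrite mobius1.
have dm : differentiable (mobius A) z.
  apply: differentiable_mx => i j; rewrite ord1; move: j; apply: ord2P.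
    by rewrite e0; apply: differentiableM => //; exact: diff_inv_mden.
  by rewrite e1; apply: differentiableM => //; exact: diff_inv_mden.
split=> //; apply: plane_eq; rewrite -derive_entry ?hpointE; try exact: diff_derivable.
  rewrite e0 (@derive_val _ _ _ _ _ _ _ q0) /P0 /mre /mim.
  move: N0 dA; rewrite det2E /mden => N0 dA.
  apply: etrans (_ : (A 0 0 * A 1 1 - A 0 1 * A 1 0) * _ = _); last first.
    by rewrite dA mul1r.
  by field.
rewrite e1 (@derive_val _ _ _ _ _ _ _ q1) /P1 /mre /mim dA.
move: N0; rewrite /mden => N0; field.
by [].
Qed.

Lemma mder_sqn A (z v : plane R) : \det A = 1 -> half_plane z ->
  ((mder A z v) 0 0 ^+ 2 + (mder A z v) 0 1 ^+ 2) / (mobius A z) 0 1 ^+ 2 =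
  (v 0 0 ^+ 2 + v 0 1 ^+ 2) / z 0 1 ^+ 2.
Proof.
move=> dA Hz; have := mden_gt0 dA Hz; rewrite mobius1 dA mul1r /mder !hpointE /mre /mim.
rewrite half_planeE in Hz; rewrite /mden => N0; field.
by rewrite !gt_eqF.
Qed.

Lemma near_half (z : plane R) : half_plane z -> \forall w \near z, half_plane w.
Proof.
move=> Hz; have := @coord_continuous' R 1 z => /(_ [set y | 0 < y]); apply.
exact: lt_nbhsr.
Qed.

Lemma near_eq_diff (W : normedModType R) (f g : plane R -> W) z :
  (\forall w \near z, f w = g w) -> differentiable g z -> differentiable f z.
Proof.
move=> fg dg; apply: (@eps_differentiable _ _ _ f z ('d g z)).
  exact: diff_continuous.
move=> e e0; have H := differentiable_eps dg e0.
have sh : \forall h \near (0 : plane R), f (z + h) = g (z + h).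
  have /nbhs_ballP[r /= r0 Hr] := fg.
  apply/nbhs_ballP; exists r => //= h; rewrite -ball_normE /= sub0r normrN => hr.
  by apply: Hr; rewrite -ball_normE /= opprD addNKr normrN.
move: H; apply: filterS2 sh => h hh; by rewrite hh (nbhs_singleton fg).
Qed.

(** The regularity required by [Young]: differentiability near [z], and differentiability of the
    first partial derivatives at [z]. It is stable under composition. *)
Definition diff2 (f : plane R -> plane R) (z : plane R) :=
  (\forall w \near z, differentiable f w) /\
  forall i, differentiable ('D_(e_ i) f) z.

Lemma differentiable_scale (f : plane R -> R) (g : plane R -> plane R) z :
  differentiable f z -> differentiable g z ->
  differentiable (fun z => f z *: g z) z.
Proof.
move=> df dg; apply: differentiable_mx => i j.
have -> : (fun y => (f y *: g y) i j) = (fun y => f y * g y i j).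
  by apply/funext => y; rewrite mxE.
by apply: differentiableM => //; exact: differentiable_entry.
Qed.

Lemma diff2_comp (f g : plane R -> plane R) z :
  diff2 g z -> diff2 f (g z) -> diff2 (f \o g) z.
Proof.
move=> [dg ddg] [df ddf].
have cg : {for z, continuous g}.
  exact: differentiable_continuous (nbhs_singleton dg).
have dfg : \forall w \near z, differentiable f (g w) by exact: (cg _ df).
split.
  apply: filterS2 dg dfg => w; exact: differentiable_comp.
move=> i.
apply: (@near_eq_diff _ _ (fun w => ('D_(e_ i) g w) 0 0 *: 'D_(e_ 0) f (g w) +
   ('D_(e_ i) g w) 0 1 *: 'D_(e_ 1) f (g w))).
  apply: filterS2 dg dfg => w dgw dfw.
  by rewrite derive_comp// derive_plane.
by apply: differentiableD; apply: differentiable_scale;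
  [exact: differentiable_entry|exact: (differentiable_comp (nbhs_singleton dg) (ddf _))
  |exact: differentiable_entry|exact: (differentiable_comp (nbhs_singleton dg) (ddf _))].
Qed.

Lemma diff2_mobius A z : \det A = 1 -> half_plane z -> diff2 (mobius A) z.
Proof.
move=> dA Hz; have nH := near_half Hz; split.
  by apply: filterS nH => w /(mobius_der 0 dA)[].
move=> i; apply: (@near_eq_diff _ _ (fun w => mder A w (e_ i))).
  by apply: filterS nH => w Hw; rewrite (mobius_der _ dA Hw).2.
have dV := diff_inv_mden dA Hz.
have dV2 : differentiable (fun z => (mden A z ^+ 2)^-1) z.
  by under eq_fun do rewrite -exprVn; exact: diff_sq.
have dl : differentiable (fun z : plane R => A 1 0 * z 0 1) z.
  by apply: differentiableM; [exact: differentiable_cst|exact: diff_x].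
have d1 : differentiable (mre A) z.
  apply: differentiableM => //; apply: differentiableB; apply: diff_sq => //.
  exact: diff_aff.
have d2 : differentiable (mim A) z.
  apply: differentiableM => //; apply: differentiableN; apply: differentiableM => //.
  by apply: differentiableM; [exact: differentiable_cst|exact: diff_aff].
have dc (c : R) (f : plane R -> R) : differentiable f z -> differentiable (fun z => f z * c) z.
  by move=> df; apply: differentiableM => //; exact: differentiable_cst.
apply: differentiable_mx => k j; rewrite ord1; move: j; apply: ord2P.
  under eq_fun do rewrite hpoint0.
  by apply: differentiableB; exact: dc.
under eq_fun do rewrite hpoint1.
by apply: differentiableD; exact: dc.
Qed.

End Mobius.

(** * The structure equations of an isometric immersion of the half-plane *)

Section FrameODE.
Context {R : realType}.

Lemma bilinearE (G : 'M[R]_2) (v w : plane R) : bilinear_form G v w =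
  v 0 0 * G 0 0 * w 0 0 + v 0 0 * G 0 1 * w 0 1
  + (v 0 1 * G 1 0 * w 0 0 + v 0 1 * G 1 1 * w 0 1).
Proof.
rewrite /bilinear_form mxE big_ord_recl big_ord1 !mulv2E !mxE.
rewrite (_ : lift ord0 ord0 = 1); last exact/val_inj.
ring.
Qed.

Lemma bilinear_sym (G : 'M[R]_2) v w : G^T = G ->
  bilinear_form G v w = bilinear_form G w v.
Proof.
move=> GT; have G10 : G 1 0 = G 0 1 by rewrite -[in LHS]GT mxE.
by rewrite !bilinearE G10; ring.
Qed.

Lemma bilinearDl (G : 'M[R]_2) u v w :
  bilinear_form G (u + v) w = bilinear_form G u w + bilinear_form G v w.
Proof. by rewrite !bilinearE !mxE; ring. Qed.

Lemma bilinearDr (G : 'M[R]_2) u v w :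
  bilinear_form G w (u + v) = bilinear_form G w u + bilinear_form G w v.
Proof. by rewrite !bilinearE !mxE; ring. Qed.

Lemma bilinearZr (G : 'M[R]_2) a v w :
  bilinear_form G w (a *: v) = a * bilinear_form G w v.
Proof. by rewrite !bilinearE !mxE; ring. Qed.

Lemma bilinear_polar (G : 'M[R]_2) v w : G^T = G -> bilinear_form G v w =
  (bilinear_form G (v + w) (v + w) - bilinear_form G v v - bilinear_form G w w) / 2.
Proof.
by move=> GT; rewrite bilinearDl !bilinearDr (bilinear_sym w v GT); lra.
Qed.

(** Orthonormality says [P * Q = 1], where the rows of [P] are [u *m G] and [v *m G] and the columns
    of [Q] are [u] and [v]. For square matrices [Q * P = 1] follows, and this is the expansion. *)
Lemma orthonormal_expand (G : 'M[R]_2) (u v w : plane R) : G^T = G ->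
  bilinear_form G u u = 1 -> bilinear_form G v v = 1 -> bilinear_form G u v = 0 ->
  w = bilinear_form G w u *: u + bilinear_form G w v *: v.
Proof.
move=> GT huu hvv huv.
have hvu : bilinear_form G v u = 0 by rewrite bilinear_sym.
have G10 : G 1 0 = G 0 1 by rewrite -[in LHS]GT mxE.
pose P := mx2 (u 0 0 * G 0 0 + u 0 1 * G 1 0) (u 0 0 * G 0 1 + u 0 1 * G 1 1)
              (v 0 0 * G 0 0 + v 0 1 * G 1 0) (v 0 0 * G 0 1 + v 0 1 * G 1 1).
pose Q := mx2 (u 0 0) (v 0 0) (u 0 1) (v 0 1).
have PQ : P * Q = 1.
  rewrite !bilinearE in huu hvv huv hvu.
  by apply: mx2_eq; rewrite mul2E !mx2E !one2E; lra.
have QP : Q * P = 1 by exact: (mulmx1C PQ).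
have q i j : Q i 0 * P 0 j + Q i 1 * P 1 j = (1 : 'M[R]_2) i j.
  by rewrite -QP mul2E.
have q00 := q 0 0; have q01 := q 0 1; have q10 := q 1 0; have q11 := q 1 1.
rewrite !mx2E !one2E ?G10 in q00; rewrite !mx2E !one2E ?G10 in q01.
rewrite !mx2E !one2E ?G10 in q10; rewrite !mx2E !one2E ?G10 in q11.
apply: plane_eq; rewrite !mxE !bilinearE G10.
  have h0 := congr1 (fun x => w 0 0 * x) q00.
  have h1 := congr1 (fun x => w 0 1 * x) q01.
  by rewrite /= in h0 h1; lra.
have h0 := congr1 (fun x => w 0 0 * x) q10.
have h1 := congr1 (fun x => w 0 1 * x) q11.
by rewrite /= in h0 h1; lra.
Qed.

Lemma bilinear_derive (G : plane R -> 'M[R]_2) (P Q : plane R -> plane R) z v :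
  differentiable G z -> differentiable P z -> differentiable Q z ->
  'D_v (fun z => bilinear_form (G z) (P z) (Q z)) z =
  bilinear_form ('D_v G z) (P z) (Q z) + bilinear_form (G z) ('D_v P z) (Q z)
  + bilinear_form (G z) (P z) ('D_v Q z).
Proof.
move=> dG dP dQ.
have hG i j : is_derive z v (fun z => G z i j) ('D_v G z i j).
  rewrite -derive_entry; last exact: diff_derivable.
  exact/derivableP/diff_derivable/differentiable_entry.
have hP i : is_derive z v (fun z => P z 0 i) ('D_v P z 0 i).
  rewrite -derive_entry; last exact: diff_derivable.
  exact/derivableP/diff_derivable/differentiable_entry.
have hQ i : is_derive z v (fun z => Q z 0 i) ('D_v Q z 0 i).
  rewrite -derive_entry; last exact: diff_derivable.
  exact/derivableP/diff_derivable/differentiable_entry.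
under eq_fun do rewrite bilinearE.
rewrite !bilinearE; apply: derive_val.
have h3 i j k l : is_derive z v (fun z => P z 0 i * G z j k * Q z 0 l)
  ('D_v P z 0 i * G z j k * Q z 0 l + P z 0 i * 'D_v G z j k * Q z 0 l
   + P z 0 i * G z j k * 'D_v Q z 0 l).
  have := hP i; have := hQ l; have := hG j k => ? ? ?.
  by apply: is_derive_eq; rewrite -![_ *: _]/(_ * _); ring.
have a1 := h3 0 0 0 0; have a2 := h3 0 0 1 1; have a3 := h3 1 1 0 0; have a4 := h3 1 1 1 1.
apply: is_derive_eq; ring.
Qed.

Lemma derive_near_eq (W : normedModType R) (f g : plane R -> W) z v :
  (\forall w \near z, f w = g w) -> 'D_v f z = 'D_v g z.
Proof.
move=> fg.
have [->|v0] := eqVneq v 0; first by rewrite !derive0.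
by apply: near_eq_derive.
Qed.

Lemma D_y_inv2 (v : plane R) : 'D_v (fun z : plane R => (z 0 1 ^+ 2)^-1) ii = - 2 * v 0 1.
Proof.
apply: derive_val.
have h := der_x 1 ii v.
have h2 : is_derive ii v (fun z : plane R => z 0 1 ^+ 2) (2 * v 0 1).
  by apply: is_derive_eq; rewrite -![_ *: _]/(_ * _) hpoint1; ring.
have h1 : is_derive ii v (fun=> 1 : R) 0 by exact: is_derive_cst.
have n0 : (fun z : plane R => z 0 1 ^+ 2) ii != 0 by rewrite hpoint1 expr1n oner_eq0.
have d1 : differentiable (fun=> 1 : R) ii by exact: differentiable_cst.
have d2 : differentiable (fun z : plane R => z 0 1 ^+ 2) ii by apply: diff_sq; exact: diff_x.
have := der_quot n0 d1 d2 h1 h2.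
under [fun z => _ / _]eq_fun do rewrite mul1r.
by move=> q; apply: is_derive_eq; rewrite hpoint1; field.
Qed.

Lemma koszul_arith1 (a p : R) : a + p + p = - 2 -> p = - 1 - a / 2.
Proof. by lra. Qed.

Lemma koszul_arith2 (a p : R) : a + p + p = 0 -> p = - (a / 2).
Proof. by lra. Qed.

Lemma koszul_arith3 (a b p q : R) : a + p + q = 0 -> b + p + p = 0 ->
  q = b / 2 - a.
Proof. by lra. Qed.

Lemma koszul_vec1 (u v : plane R) (a b : R) :
  v + (a *: u + (- 1 - b) *: v) = a *: u - b *: v.
Proof. by apply: plane_eq; rewrite !mxE; ring. Qed.

Lemma koszul_vec2 (u v : plane R) (a b : R) :
  u + ((- 1 - a) *: u + (- b) *: v) = - a *: u - b *: v.
Proof. by apply: plane_eq; rewrite !mxE; ring. Qed.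

Lemma e_E : ((e_ 0 : plane R) 0 0 = 1) * ((e_ 0 : plane R) 0 1 = 0) *
            ((e_ 1 : plane R) 0 0 = 0) * ((e_ 1 : plane R) 0 1 = 1).
Proof. by rewrite !mxE. Qed.

(* Differentiating [g(F_i, F_j) = delta_ij / y^2] at [i] expresses the second
   derivatives of an isometric [F] through its first ones (Koszul's formula). *)
Lemma frame_ode (g : plane R -> 'M[R]_2) (F : plane R -> plane R) :
  diff2 F ii -> differentiable g (F ii) ->
  (\forall z \near ii, (g (F z))^T = g (F z)) ->
  (\forall z \near ii, forall v, bilinear_form (g (F z)) ('D_v F z) ('D_v F z) =
      (v 0 0 ^+ 2 + v 0 1 ^+ 2) / z 0 1 ^+ 2) ->
  let u := 'D_(e_ 0) F ii in let v := 'D_(e_ 1) F ii in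
  let dg c := bilinear_form ('D_c g (F ii)) in
  v + 'D_(e_ 1) ('D_(e_ 1) F) ii =
    (dg u v v / 2 - dg v v u) *: u - (dg v v v / 2) *: v /\
  u + 'D_(e_ 1) ('D_(e_ 0) F) ii =
    - (dg v u u / 2) *: u - (dg u v v / 2) *: v.
Proof.
move=> [dF ddF] dg sg iso u v dgf.
have dF0 := nbhs_singleton dF.
have dgF : differentiable (g \o F) ii by exact: differentiable_comp.
have DgF w : 'D_w (g \o F) ii = 'D_('D_w F ii) g (F ii) by exact: derive_comp.
pose B (P Q : plane R -> plane R) z := bilinear_form (g (F z)) (P z) (Q z).
have isoF : \forall z \near ii, forall a b,
    B ('D_a F) ('D_b F) z = (a 0 0 * b 0 0 + a 0 1 * b 0 1) / z 0 1 ^+ 2.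
  apply: filterS3 dF sg iso => z dz sz iz a b; rewrite /B.
  have Dab : 'D_(a + b) F z = 'D_a F z + 'D_b F z.
    by rewrite (deriveE _ dz) linearD -(deriveE _ dz) -(deriveE _ dz).
  rewrite (bilinear_polar _ _ sz) -Dab (iz (a + b)) (iz a) (iz b) !mxE.
  move: (_ ^+ 2)^-1 (a 0 0) (a 0 1) (b 0 0) (b 0 1).
  by move=> y a0 a1 b0 b1; lra.
have ort a b : bilinear_form (g (F ii)) ('D_a F ii) ('D_b F ii) =
    a 0 0 * b 0 0 + a 0 1 * b 0 1.
  by have := nbhs_singleton isoF a b; rewrite /B hpoint1 expr1n divr1.
have huu : bilinear_form (g (F ii)) u u = 1 by rewrite ort !e_E; ring.
have hvv : bilinear_form (g (F ii)) v v = 1 by rewrite ort !e_E; ring.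
have huv : bilinear_form (g (F ii)) u v = 0 by rewrite ort !e_E; ring.
have sg0 := nbhs_singleton sg.
have D a b c : dgf ('D_c F ii) ('D_(e_ a) F ii) ('D_(e_ b) F ii)
   + bilinear_form (g (F ii)) ('D_c ('D_(e_ a) F) ii) ('D_(e_ b) F ii)
   + bilinear_form (g (F ii)) ('D_(e_ a) F ii) ('D_c ('D_(e_ b) F) ii)
   = ((e_ a) 0 0 * (e_ b) 0 0 + (e_ a) 0 1 * (e_ b) 0 1) * (- 2 * c 0 1).
  rewrite /dgf -DgF -(bilinear_derive _ dgF (ddF a) (ddF b)).
  rewrite (@derive_near_eq _ _ (fun z => ((e_ a) 0 0 * (e_ b) 0 0 + (e_ a) 0 1 * (e_ b) 0 1) *
     (z 0 1 ^+ 2)^-1)); last first.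
    by move: isoF; apply: filterS => z; exact.
  rewrite deriveMl ?D_y_inv2//.
  apply: diff_derivable; apply: differentiableV; last by rewrite hpoint1 expr1n oner_eq0.
  by apply: diff_sq; exact: diff_x.
pose m := 'D_(e_ 1) ('D_(e_ 0) F) ii; pose n := 'D_(e_ 1) ('D_(e_ 1) F) ii.
(* Equality of the mixed derivatives leaves only two unknown vectors, [m] and [n]. *)
have mE : 'D_(e_ 0) ('D_(e_ 1) F) ii = m.
  have dent i (j : 'I_2) : \forall w \near ii, 'D_(e_ i) F w 0 j = 'D_(e_ i) (fun z => F z 0 j) w.
    by apply: filterS dF => w dw; rewrite derive_entry//; exact: diff_derivable.
  have dd i j k : 'D_(e_ k) ('D_(e_ i) F) ii 0 j = 'D_(e_ k) ('D_(e_ i) (fun z => F z 0 j)) ii.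
    rewrite -derive_entry; last exact: diff_derivable.
    exact: derive_near_eq (dent i j).
  have Y j : 'D_(e_ 0) ('D_(e_ 1) F) ii 0 j = m 0 j.
    transitivity ('D_(e_ 0) ('D_(e_ 1) (fun z => F z 0 j)) ii).
      exact: (dd 1 j 0).
    transitivity ('D_(e_ 1) ('D_(e_ 0) (fun z => F z 0 j)) ii); last first.
      exact: (esym (dd 0 j 1)).
    apply: esym; apply: Young.
      by apply: filterS dF => w; exact: differentiable_entry.
    move=> i; apply: (near_eq_diff (g := fun w => 'D_(e_ i) F w 0 j)).
      by apply: filterS (dent i j) => w ->.
    by apply: differentiable_entry; exact: ddF.
  by apply: plane_eq; exact: Y.
pose G := g (F ii); pose bG := bilinear_form G.
have sG x y : bG x y = bG y x by exact: bilinear_sym.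
(* These four equations determine [m] and [n] in the basis [u], [v]. The values [- 2] are the
   derivative of [1 / y ^+ 2] at [ii]; the summands [v] and [u] added in the conclusion cancel their
   contribution. *)
have E1 : dgf v v v + bG n v + bG v n = - 2.
  by apply: etrans (D 1 1 (e_ 1)) _; rewrite !e_E; clear; ring.
have E2 : dgf v u v + bG m v + bG u n = 0.
  by apply: etrans (D 0 1 (e_ 1)) _; rewrite !e_E; clear; ring.
have E3 : dgf u v v + bG m v + bG v m = 0.
  by rewrite -mE; apply: etrans (D 1 1 (e_ 0)) _; rewrite !e_E; clear; ring.
have E4 : dgf v u u + bG m u + bG u m = - 2.
  by apply: etrans (D 0 0 (e_ 1)) _; rewrite !e_E; clear; ring.
have sdg a b : dgf v a b = dgf v b a.
  apply: bilinear_sym; rewrite /v -DgF; apply/matrixP => i j.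
  have dv : derivable (g \o F) ii (e_ 1) by exact: diff_derivable.
  rewrite mxE -(derive_entry j i dv) -(derive_entry i j dv).
  apply: derive_near_eq; apply: filterS sg => w /= sw.
  by rewrite -[in RHS]sw mxE.
rewrite (sG v n) in E1; rewrite (sdg u v) (sG u n) in E2.
rewrite (sG v m) in E3; rewrite (sG u m) in E4.
have nu := koszul_arith3 E2 E3; have nv := koszul_arith1 E1.
have mu := koszul_arith1 E4; have mv := koszul_arith2 E3.
have ex w : w = bG w u *: u + bG w v *: v 
  by exact: (orthonormal_expand w sg0 huu hvv huv).
split.
  change (v + n = (dgf u v v / 2 - dgf v v u) *: u - (dgf v v v / 2) *: v).
  by rewrite [in LHS](ex n) nu nv koszul_vec1.
change (u + m = - (dgf v u u / 2) *: u - (dgf u v v / 2) *: v).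
by rewrite [in LHS](ex m) mu mv koszul_vec2.
Qed.

End FrameODE.

(** * Matrices of determinant 1 *)

Section SL2.
Context {R : realType}.

(** The geodesic flow in multiplicative time: [gd p] is the flow at time [2 * ln p], so that matrix
    identities involve field operations only. [hs] and [nr] are the horocycle flow and the opposite
    one; [w0] represents the nontrivial element of the Weyl group. *)
Definition gd (p : R) : 'M[R]_2 := mx2 p 0 0 p^-1.
Definition hs (s : R) : 'M[R]_2 := mx2 1 s 0 1.
Definition nr (r : R) : 'M[R]_2 := mx2 1 0 r 1.
Definition w0 : 'M[R]_2 := mx2 0 (- 1) 1 0.

Lemma det_gd p : 0 < p -> \det (gd p) = 1.
Proof. by move=> p0; rewrite det2E !mx2E mulr0 subr0 mulfV// gt_eqF. Qed.
Lemma det_hs s : \det (hs s) = 1. Proof. by rewrite det2E !mx2E; ring. Qed.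
Lemma det_nr s : \det (nr s) = 1. Proof. by rewrite det2E !mx2E; ring. Qed.
Lemma det_w0 : \det w0 = 1. Proof. by rewrite det2E !mx2E; ring. Qed.
Lemma det_mul1 (A B : 'M[R]_2) : \det A = 1 -> \det B = 1 -> \det (A * B) = 1.
Proof. by move=> dA dB; rewrite detM2 dA dB mulr1. Qed.

Lemma gdM p q : gd p * gd q = gd (p * q).
Proof. by apply: mx2_eq; rewrite mul2E !mx2E ?invfM; ring. Qed.
Lemma gd1 : gd 1 = 1.
Proof. by apply: mx2_eq; rewrite !mx2E !one2E ?invr1. Qed.
Lemma gdV p : 0 < p -> gd p * gd p^-1 = 1.
Proof. by move=> p0; rewrite gdM mulfV ?gd1// gt_eqF. Qed.
Lemma gdVl p : 0 < p -> gd p^-1 * gd p = 1.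
Proof. by move=> p0; rewrite gdM mulVf ?gd1// gt_eqF. Qed.
Lemma hsD s t : hs s * hs t = hs (s + t).
Proof. by apply: mx2_eq; rewrite mul2E !mx2E; ring. Qed.
Lemma hs0 : hs 0 = 1. Proof. by apply: mx2_eq; rewrite !mx2E !one2E. Qed.
Lemma nrD s t : nr s * nr t = nr (s + t).
Proof. by apply: mx2_eq; rewrite mul2E !mx2E; ring. Qed.
Lemma nr0 : nr 0 = 1. Proof. by apply: mx2_eq; rewrite !mx2E !one2E. Qed.
Lemma hs_gd s p : 0 < p -> hs s * gd p = gd p * hs (s / p ^+ 2).
Proof.
by move=> p0; have pn := lt0r_neq0 p0; apply: mx2_eq; rewrite !mul2E !mx2E; field.
Qed.
Lemma nr_gd r p : 0 < p -> nr r * gd p = gd p * nr (r * p ^+ 2).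
Proof.
by move=> p0; have pn := lt0r_neq0 p0; apply: mx2_eq; rewrite !mul2E !mx2E; field.
Qed.
Lemma w0_gd p : 0 < p -> w0 * gd p^-1 = gd p * w0.
Proof.
by move=> p0; apply: mx2_eq; rewrite !mul2E !mx2E ?invrK; ring.
Qed.

Lemma adj2M (A B : 'M[R]_2) : adj2 (A * B) = adj2 B * adj2 A.
Proof. by apply: mx2_eq; rewrite mul2E !mx2E !mul2E; ring. Qed.

(** Two terms close to a cluster point of the sequence, the second one chosen after the first with a
    gap of at least [N]. *)
Lemma bounded_near_pair (k : nat -> 'M[R]_2) (C : R) : (forall n, `|k n| <= C) ->
  forall e : R, 0 < e -> forall N, exists i j, (N + i <= j)%N /\ `|k i - k j| < e.
Proof.
move=> kC e e0 N.
(* The matrix is flattened row by row, entry [(a, b)] at place [2 * a + b], to use compactness of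
   closed balls of row vectors. *)
pose f n : 'rV[R]_4 := \row_j (k n (inord (j %/ 2)) (inord (j %% 2))).
have cK : compact [set x : 'rV[R]_4 | `|x| <= C].
  apply: bounded_closed_compact.
    exists C; split; first exact: num_real.
    by move=> M CM x /= xC; apply: le_trans xC (ltW CM).
  have -> : [set x : 'rV[R]_4 | `|x| <= C] = closed_ball_ (fun x : 'rV[R]_4 => `|x|) 0 C.
    by apply/seteqP; split => x; rewrite /closed_ball_ /= sub0r normrN.
  exact: closed_closed_ball_.
have fC n : `|f n| <= C.
  by apply: norm_mx_le => i j; rewrite mxE; apply: le_trans (kC n); exact: coord_le.
have FK : (f @ \oo) [set x : 'rV[R]_4 | `|x| <= C].
  by exists 0%N => // n _; exact: fC.
have FN n0 : (f @ \oo) [set f n | n in [set n | (n0 <= n)%N]].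
  by exists n0 => // n /= ?; exists n.
have [c [_ cc]] := cK (f @ \oo) _ FK.
have e2 : 0 < e / 2 by rewrite divr_gt0.
have [_ [[i _ <-] ic]] := cc _ _ (FN 0%N) (nbhsx_ballx c _ e2).
have [_ [[j ij <-] jc]] := cc _ _ (FN (N + i)%N) (nbhsx_ballx c _ e2).
exists i, j; split => //.
have : `|f i - f j| < e.
  rewrite (splitr e); apply: le_lt_trans (ler_distD c _ _) _.
  by apply: ltrD; [rewrite distrC|]; rewrite -ball_normE in ic jc.
apply: le_lt_trans; apply: norm_mx_le => a b.
have -> : (k i - k j) a b = (f i - f j) 0 (inord (2 * a + b)).
  rewrite !mxE.
  have ab : (2 * a + b < 4)%N by case: a => [[|[|//]] ?]; case: b => [[|[|//]] ?].
  have -> : inord ((inord (2 * a + b) : 'I_4) %/ 2) = a.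
    apply: val_inj; rewrite /= inordK inordK//; by case: a ab => [[|[|//]] ?]; case: b => [[|[|//]] ?].
  have -> // : inord ((inord (2 * a + b) : 'I_4) %% 2) = b.
  by apply: val_inj; rewrite /= inordK inordK//; case: a ab => [[|[|//]] ?]; case: b => [[|[|//]] ?].
exact: coord_le.
Qed.

Lemma infinite_seq (T : Type) (A : set T) : infinite_set A ->
  exists f : nat -> T, (forall n, A (f n)) /\ injective f.
Proof.
move=> /infiniteP; case: (pselect (exists x : T, True)) => [[x0 _]|no].
  move=> /card_leP[f]; exists (fun n => val (f (SigSub (mem_set (I : [set: nat] n))))).
  split=> [n|i j]; first exact: set_valP.
  by move/val_inj/(@inj _ _ _ f) => /(_ (mem_setT _) (mem_setT _)) /(congr1 val).
by move=> /card_leP[f]; exfalso; apply: no; exists (val (f (SigSub (mem_set (I : [set: nat] 0%N))))).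
Qed.

Lemma finite_pos_lb (T : Type) (A : set T) (f : T -> R) : finite_set A ->
  (forall x, A x -> 0 < f x) -> exists2 d, 0 < d & forall x, A x -> d <= f x.
Proof.
move=> fA f0.
have : finite_set (f @` A) by exact: finite_image.
move=> /finite_seqP[s sE].
have : forall x, x \in s -> 0 < x.
  move=> x xs; have : [set` s] x by [].
  by rewrite -sE => -[y Ay <-]; exact: f0.
have : forall x, A x -> f x \in s.
  by move=> x Ax; have : (f @` A) (f x) by [exists x]; rewrite sE.
move=> As {sE} s0.
have [d d0 ds] : exists2 d : R, 0 < d & forall x, x \in s -> d <= x.
  elim: s s0 {As} => [|a s IH] s0; first by exists 1.
  have [|d d0 ds] := IH; first by move=> x xs; apply: s0; rewrite inE xs orbT.
  exists (Num.min d a); first by rewrite lt_min d0 s0// mem_head.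
  by move=> x; rewrite inE => /orP[/eqP->|/ds dx]; rewrite ge_min ?lexx ?orbT// dx.
by exists d => // x /As /ds.
Qed.

(** Two terms at distance less than [e / (2 * C + 1)] have a quotient at distance less than [e] from
    1, hence equal to 1. *)
Lemma discrete_pair (S : set 'M[R]_2) (e C : R) (k : nat -> 'M[R]_2) : 0 < e ->
  (forall A, S A -> \det A = 1) ->
  (forall A B, S A -> S B -> S (adj2 A * B)) ->
  (forall A, S A -> `|A - 1| < e -> A = 1) ->
  (forall n, S (k n) /\ `|k n| <= C) -> exists i j, (i < j)%N /\ k i = k j.
Proof.
move=> e0 S1 SM Se kS.
have C0 : 0 <= C by apply: le_trans (kS 0%N).2.
have d0 : 0 < e / (2 * C + 1) by rewrite divr_gt0// ltr_wpDl// mulr_ge0.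
have [i [j [ij kij]]] := bounded_near_pair (fun n => (kS n).2) d0 1.
exists i, j; split; first exact: ij.
have : adj2 (k i) * k j = 1.
  apply: Se; first by apply: SM; exact: (kS _).1.
  have di := S1 _ (kS i).1.
  have -> : adj2 (k i) * k j - 1 = adj2 (k i) * (k j - k i).
    by rewrite mulrBr adj2Kl.
  apply: le_lt_trans (_ : 2 * C * `|k j - k i| < e).
    apply: norm_mx_le => a b; rewrite mul2E.
    have ad x y : `|adj2 (k i) x y| <= C.
      apply: le_trans (kS i).2; rewrite mxE; case: ifP => _; case: ifP => _;
      by rewrite ?normrN coord_le.
    apply: le_trans (ler_normD _ _) _; rewrite !normrM.
    have -> : 2 * C * `|k j - k i| = C * `|k j - k i| + C * `|k j - k i| by ring.
    by apply: lerD; apply: ler_pM => //; exact: coord_le.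
  rewrite distrC.
  have c0 : 0 < 2 * C + 1 by rewrite ltr_wpDl// mulr_ge0.
  apply: le_lt_trans (_ : (2 * C + 1) * `|k i - k j| < e).
    by apply: ler_wpM2r => //; rewrite lerDl.
  by rewrite mulrC -ltr_pdivlMr.
move=> E; have : k i * (adj2 (k i) * k j) = k i by rewrite E mulr1.
rewrite mulrA adj2K ?mul1r; last exact: S1 (kS i).1.
by move->.
Qed.

Lemma discrete_finite (S : set 'M[R]_2) (e C : R) : 0 < e ->
  (forall A, S A -> \det A = 1) ->
  (forall A B, S A -> S B -> S (adj2 A * B)) ->
  (forall A, S A -> `|A - 1| < e -> A = 1) ->
  finite_set [set A | S A /\ `|A| <= C].
Proof.
move=> e0 S1 SM Se; apply: contrapT => /infinite_seq[k [kS kinj]].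
have [i [j [ij /kinj E]]] := discrete_pair e0 S1 SM Se kS.
by rewrite E ltnn in ij.
Qed.

(** The columns of [M] are eigenvectors for [l] and [l^-1], scaled to determinant 1; their formula
    requires a nonzero lower left entry. This is arranged by conjugating with [nr r] for one of
    [r = 0, 1, -1]: if all three failed, [k] would be scalar of determinant 1, with trace at most
    2. *)
Lemma diagonalize (k : 'M[R]_2) : \det k = 1 -> 2 < k 0 0 + k 1 1 ->
  exists M l, [/\ \det M = 1, 1 < l & k * M = M * gd l].
Proof.
move=> dk tk.
suff H (k' : 'M[R]_2) : \det k' = 1 -> 2 < k' 0 0 + k' 1 1 -> k' 1 0 != 0 ->
    exists M l, [/\ \det M = 1, 1 < l & k' * M = M * gd l].
  have key r : (nr (- r) * k * nr r) 1 0 != 0 ->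
      exists M l, [/\ \det M = 1, 1 < l & k * M = M * gd l].
    move=> c0; have [||M [l [dM l1 kM]]] := H _ _ _ c0.
    - by rewrite !detM2 !det_nr dk !mulr1.
    - by rewrite !mul2E !mx2E; lra.
    exists (nr r * M), l; split => //; first by rewrite detM2 det_nr dM mulr1.
    by rewrite -mulrA -kM !mulrA nrD subrr nr0 mul1r.
  have E r : (nr (- r) * k * nr r) 1 0 = k 1 0 + r * (k 1 1 - k 0 0) - r ^+ 2 * k 0 1.
    by rewrite !mul2E !mx2E; ring.
  have [c0|c0] := eqVneq ((nr (- 0) * k * nr 0) 1 0) 0; last exact: key c0.
  have [c1|c1] := eqVneq ((nr (- 1) * k * nr 1) 1 0) 0; last exact: key c1.
  have [c2|c2] := eqVneq ((nr (- - 1) * k * nr (- 1)) 1 0) 0; last exact: key c2.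
  exfalso; rewrite !E in c0 c1 c2; rewrite det2E in dk.
  have b0 : k 0 1 = 0 by lra.
  have ad : k 1 1 = k 0 0 by lra.
  rewrite b0 ad mul0r subr0 in dk; rewrite ad in tk.
  by have : (k 0 0 - 1) * (k 0 0 + 1) = 0 by [rewrite mulrDr mulrBl; lra]; nra.
move=> {k dk tk} dk tk c0.
pose t := k' 0 0 + k' 1 1.
pose D := Num.sqrt (t ^+ 2 - 4).
have D2 : D ^+ 2 = t ^+ 2 - 4.
  by rewrite sqr_sqrtr// subr_ge0; rewrite /t; nra.
have D0 : 0 < D by rewrite sqrtr_gt0 subr_gt0 /t; nra.
pose l := (t + D) / 2; pose m := (t - D) / 2.
have lm : l * m = 1.
  have -> : l * m = (t ^+ 2 - D ^+ 2) / 4 by rewrite /l /m; field.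
  by rewrite D2; field.
have l1 : 1 < l by rewrite /l /t; lra.
have l0 : l != 0 by rewrite gt_eqF// (lt_trans _ l1).
have mE : m = l^-1 by apply: (mulfI l0); rewrite lm mulfV.
have lt : l + m = t by rewrite /l /m; field.
rewrite det2E in dk.
have q x : (x = l \/ x = m) -> x ^+ 2 - t * x + 1 = 0.
  by case=> ->; rewrite -lt -lm; ring.
have ql := q l (or_introl erefl); have qm := q m (or_intror erefl).
have cd : k' 1 0 * (l - m) != 0.
  by rewrite mulf_neq0// subr_eq0 gt_eqF// /l /m; lra.
pose c := k' 1 0 * (l - m).
exists (mx2 ((l - k' 1 1) / c) (m - k' 1 1) (k' 1 0 / c) (k' 1 0)), l; split => //.
  have lm0 : l - m != 0 by move: cd; rewrite mulf_eq0 negb_or => /andP[].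
  rewrite det2E !mx2E /c; move: c0 lm0; clear.
  by move: (k' 1 0) (k' 1 1) l m => C d l m c0 lm0; field; rewrite c0 lm0.
rewrite /t in ql qm.
have h1 := congr1 (fun x => x * c^-1) ql; have h2 := congr1 (fun x => x * c^-1) dk.
rewrite /= in h1 h2.
apply: mx2_eq; rewrite !mul2E !mx2E -?mE;
  move: h1 h2 ql qm dk; clear; move: c^-1; clear c; clearbody l m;
  move: (k' 0 0) (k' 0 1) (k' 1 0) (k' 1 1) => *; lra.
Qed.

End SL2.

(** * Dense horocycle orbits for an abstract action *)

Lemma pow_unbounded {R : realType} (h c : R) : 1 < h -> exists n, c < h ^+ n.
Proof.
move=> h1; have d0 : 0 < h - 1 by rewrite subr_gt0.
have bern n : 1 + n%:R * (h - 1) <= h ^+ n.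
  elim: n => [|n IH]; first by rewrite mul0r addr0 expr0.
  have nd : 0 <= n%:R * (h - 1) ^+ 2 by rewrite mulr_ge0// sqr_ge0.
  apply: le_trans (_ : h * (1 + n%:R * (h - 1)) <= _).
    by rewrite -natr1; lra.
  by rewrite exprS ler_pM2l//; lra.
have c0 : 0 <= `|c| / (h - 1) by rewrite divr_ge0// ltW.
have := archi_boundP c0; set n := Num.bound _ => nb; exists n.
apply: lt_le_trans (bern n).
rewrite ltr_pdivrMr// in nb; apply: le_lt_trans (ler_norm c) _; lra.
Qed.

Lemma sub2E {R : realType} (A B : 'M[R]_2) i j : (A - B) i j = A i j - B i j.
Proof. by rewrite !mxE. Qed.

Lemma lower_decomp {R : realType} (g : 'M[R]_2) : \det g = 1 -> g 0 0 != 0 ->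
  nr (g 1 0 / g 0 0) * gd (g 0 0) = g * hs (- (g 0 1 / g 0 0)).
Proof.
rewrite det2E => dg g0; apply: mx2_eq; rewrite !mul2E !mx2E; try by field.
apply: (mulfI g0); transitivity (1 : R); first by field.
by apply/esym; apply: etrans dg; field.
Qed.

Section Dynamics.
Context {R : realType} (X : topologicalType) (act : X -> 'M[R]_2 -> X).
Hypothesis cX : compact [set: X].
Hypothesis act1 : forall x, act x 1 = x.
Hypothesis actN : forall x, act x (- 1) = x.
Hypothesis actM : forall x A B, \det A = 1 -> \det B = 1 ->
  act (act x A) B = act x (A * B).
Hypothesis act_cont : forall B, \det B = 1 -> continuous (act ^~ B).
(** Continuity in the matrix along a fixed orbit. Continuity in both variables is asked only for
    diagonal matrices near 1, in [act_diag]; it makes a union of translates over a compact range of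
    times closed. *)
Hypothesis act_orbit : forall (x : X) A V, \det A = 1 -> nbhs (act x A) V ->
  exists2 e : R, 0 < e & forall B, \det B = 1 -> `|B - A| < e -> V (act x B).
Hypothesis act_diag : forall (x : X) V, nbhs x V ->
  exists2 e : R, 0 < e & exists2 W, nbhs x W &
    forall y p, W y -> 0 < p -> `|p - 1| < e -> V (act y (gd p)).
Hypothesis disc : forall x, exists2 e : R, 0 < e &
  forall k, \det k = 1 -> act x k = x -> `|k - 1| < e -> k = 1.
(** The bounds [e] and [C] are chosen before the time. Carried back to [x], the element
    [gd p * k * adj2 (gd p)] has the diagonal of [k], its lower left entry divided by [p ^+ 2] and
    its upper right entry multiplied by [p ^+ 2]. *)
Hypothesis tame : forall x, exists2 e : R, 0 < e & exists C : R, forall T : R,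
  exists p k, [/\ T <= p /\ 1 <= p, \det k = 1, `|k| <= C, 2 + e <= k 0 0 + k 1 1 &
    act (act x (gd p)) k = act x (gd p)].

Definition upper_inv (Z : set X) :=
  forall x B, Z x -> \det B = 1 -> B 1 0 = 0 -> Z (act x B).

(** Abstract form of the density of the leaves: orbits of [act] stand for the unit tangent bundles
    of the leaves. *)
Hypothesis leafd : forall Z : set X, closed Z -> Z !=set0 -> upper_inv Z ->
  forall x, exists2 C, \det C = 1 & Z (act x C).

Definition hs_inv (Z : set X) := forall x s, Z x -> Z (act x (hs s)).

Let stab x : set 'M[R]_2 := [set k | \det k = 1 /\ act x k = x].

Let stabM x A B : stab x A -> stab x B -> stab x (A * B).
Proof.
move=> [dA xA] [dB xB]; split; first exact: det_mul1.
by rewrite -actM// xA.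
Qed.

Let stabV x A : stab x A -> stab x (adj2 A).
Proof.
move=> [dA xA]; split; first by rewrite det_adj2.
by rewrite -{1}xA actM ?det_adj2// adj2K.
Qed.

Let stab_fin x C : finite_set [set A | stab x A /\ `|A| <= C].
Proof.
have [e e0 He] := disc x.
apply: (@discrete_finite _ (stab x) e C e0).
- by move=> A [].
- by move=> A B xA xB; apply: stabM => //; exact: stabV.
- by move=> A [dA xA]; exact: He.
Qed.

Let stab_conj x k g : \det g = 1 -> \det k = 1 -> act (act x g) k = act x g ->
  stab x (g * k * adj2 g).
Proof.
move=> dg dk H; have dg' : \det (adj2 g) = 1 by rewrite det_adj2.
split; first by rewrite !det_mul1.
rewrite -!actM ?det_mul1// H actM// adj2K//.
Qed.

Let act_opp x A : \det A = 1 -> act x (- A) = act x A.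
Proof.
move=> dA; rewrite -[in RHS](actN (act x A)) actM//; first by rewrite mulrN1.
by rewrite det2E !opp2E !one2E; ring.
Qed.

Let limit_orbit (Z : set X) x A : closed Z -> \det A = 1 ->
  (forall e : R, 0 < e -> exists B, [/\ \det B = 1, `|B - A| < e & Z (act x B)]) ->
  Z (act x A).
Proof.
move=> cZ dA H; apply: cZ => V /(act_orbit dA)[e e0 He].
by have [B [dB BA ZB]] := H e e0; exists (act x B); split => //; exact: He.
Qed.

Let norm_nr (r : R) (A : 'M[R]_2) e : A = nr r -> `|r| < e -> 0 < e -> `|A - 1| < e.
Proof.
move=> -> re e0; apply: le_lt_trans re; apply: norm_mx_le.
by apply: ord2P; apply: ord2P; rewrite !mxE /= ?subrr ?normr0 ?subr0 ?normr_ge0 //.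
Qed.

(* If the [stab x]-orbit of the direction of [g0] does not accumulate at the forward
   direction of [x], that direction is fixed by a hyperbolic element of [stab x]. *)
Let slope_dichotomy Z x g0 : closed Z -> upper_inv Z -> \det g0 = 1 ->
  Z (act x g0) -> Z x \/ exists2 k, stab x k & [/\ k 1 0 = 0, 1 < k 0 0 &
     g0 0 0 * (k 1 1 - k 0 0) = k 0 1 * g0 1 0].
Proof.
move=> cZ uZ dg0 Zg0.
have Zk k : stab x k -> Z (act x (k * g0)).
  by move=> [dk xk]; rewrite -actM// xk.
(* Modulo upper triangular matrices on the right only the direction of the first column of [M]
   matters, so [M] can be replaced by the [nr] of its slope. *)
have ZM M : \det M = 1 -> Z (act x M) -> M 0 0 != 0 -> Z (act x (nr (M 1 0 / M 0 0))).
  move=> dM ZMx M0; set r := _ / _.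
  have dr := det_nr r.
  have -> : nr r = M * adj2 (nr (- r) * M).
    by rewrite adj2M mulrA adj2K// mul1r; apply: mx2_eq; rewrite !mx2E ?opprK ?oppr0.
  have dN : \det (nr (- r) * M) = 1 by rewrite detM2 dM det_nr mulr1.
  rewrite -actM ?det_adj2//; apply: uZ => //; first by rewrite det_adj2.
  by rewrite mx2E mul2E !mx2E /r; field.
have [acc|nacc] := pselect (forall d : R, 0 < d -> exists2 k, stab x k &
    `|(k * g0) 1 0| < d * `|(k * g0) 0 0|).
  left; rewrite -[x]act1; apply: limit_orbit => //; first exact: det1.
  move=> e e0; have [k sk kd] := acc e e0.
  have M0 : (k * g0) 0 0 != 0.
    apply/eqP => M0; rewrite M0 normr0 mulr0 in kd.
    by have := normr_ge0 ((k * g0) 1 0); rewrite leNgt kd.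
  exists (nr ((k * g0) 1 0 / (k * g0) 0 0)); split; first exact: det_nr.
    apply: norm_nr (erefl _) _ e0.
    by rewrite normrM normfV ltr_pdivrMr ?normr_gt0.
  by apply: ZM => //; [apply: det_mul1 => //; exact: sk.1|exact: Zk].
right.
have [d [d0 Hd]] : exists d : R, 0 < d /\ forall k, stab x k ->
    d * `|(k * g0) 0 0| <= `|(k * g0) 1 0|.
  move/existsNP: nacc => [d /not_implyP[d0 nd]]; exists d; split => // k sk.
  by rewrite leNgt; apply/negP => H; apply: nd; exists k.
have [e e0 [C HT]] := tame x.
have C0 : 0 <= C by have [p [k [_ _ kC _ _]]] := HT 0; apply: le_trans kC.
(* [D] bounds the conjugates [g] below whatever the time [p]: their upper right entry, which could
   grow like [p ^+ 2], is controlled because the first column of [g * g0] stays away from the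
   forward direction. *)
pose D := C + (C / d + C / d + C / d / d) + 1.
have DC : 0 <= C / d by rewrite divr_ge0// ltW.
have DC2 : 0 <= C / d / d by rewrite divr_ge0// ltW.
have D0 : 0 < D by rewrite /D; lra.
have fin := stab_fin x D.
have [m m0 Hm] : exists2 m, 0 < m & forall k : 'M[R]_2,
    [set k | (stab x k /\ `|k| <= D) /\ k 1 0 != 0] k -> m <= `|k 1 0|.
  apply: finite_pos_lb.
    by apply: sub_finite_set fin => k [].
  by move=> k [_ k0]; rewrite normr_gt0.
(* At this time the lower left entry of [g] is at most [C / p ^+ 2 < m], where [m] is the least
   nonzero value among the finitely many candidates; hence it is zero. *)
have [p [k [[pT p1] dk kC tk hk]]] := HT (1 + C / m).
have p0 : 0 < p by exact: lt_le_trans ltr01 p1.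
have pn := lt0r_neq0 p0.
have dp := det_gd p0.
have sk := stab_conj dp dk hk.
set g := gd p * k * adj2 (gd p) in sk.
have gE : (g 0 0 = k 0 0) * (g 0 1 = p ^+ 2 * k 0 1) * (g 1 0 = k 1 0 / p ^+ 2) * (g 1 1 = k 1 1).
  by rewrite /g !mul2E !mx2E; do !split; field.
have p2 : 1 <= p ^+ 2 by rewrite expr_ge1// ltW.
have p2' : 0 < p ^+ 2 by exact: lt_le_trans ltr01 p2.
have g10C : `|g 1 0| <= C / p ^+ 2.
  rewrite gE normrM normfV (gtr0_norm p2') ler_pM2r ?invr_gt0//.
  exact: le_trans (coord_le _ _ _) kC.
have g10C' : `|g 1 0| <= C.
  by apply: le_trans g10C _; rewrite ler_pdivrMr// ler_peMr.
have g00C : `|g 0 0| <= C by rewrite gE; exact: le_trans (coord_le _ _ _) kC.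
have g11C : `|g 1 1| <= C by rewrite gE; exact: le_trans (coord_le _ _ _) kC.
pose a := g0 0 0; pose b := g0 1 0.
have ab : d * `|a| <= `|b| by have := Hd 1 (conj (det1 _ _) (act1 x)); rewrite mul1r.
have b0 : 0 < `|b|.
  rewrite normr_gt0; apply/eqP => b0; rewrite b0 normr0 in ab.
  have a0 : a = 0.
    by apply/eqP; rewrite -normr_le0 -(pmulr_rle0 _ d0).
  by move: dg0; rewrite det2E -/a -/b a0 b0 mul0r mulr0 subr0 => /eqP; rewrite eq_sym oner_eq0.
have aB : `|a| <= `|b| / d by rewrite ler_pdivlMr// mulrC.
have g01D : `|g 0 1| <= C / d + C / d + C / d / d.
  have := Hd g sk; rewrite (mul2E g g0 0 0) (mul2E g g0 1 0) -/a -/b => H.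
  have H1 : `|g 1 0 * a + g 1 1 * b| <= C * (`|b| / d) + C * `|b|.
    apply: le_trans (ler_normD _ _) _; rewrite !normrM.
    by apply: lerD; apply: ler_pM.
  have H2 : `|g 0 1| * `|b| <= `|g 0 0 * a + g 0 1 * b| + C * (`|b| / d).
    rewrite -normrM.
    have E : g 0 1 * b = (g 0 0 * a + g 0 1 * b) - g 0 0 * a by ring.
    rewrite [X in `|X| <= _]E.
    apply: le_trans (ler_normB _ _) _; rewrite lerD2l normrM.
    by apply: ler_pM.
  have H3 : `|g 0 0 * a + g 0 1 * b| <= (C * (`|b| / d) + C * `|b|) / d.
    by rewrite ler_pdivlMr// [_ * d]mulrC; exact: le_trans H H1.
  have H4 : `|g 0 1| * `|b| <= (C / d + C / d + C / d / d) * `|b|.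
    apply: le_trans H2 _; apply: le_trans (lerD H3 (lexx _)) _.
    by rewrite le_eqVlt; apply/orP; left; apply/eqP; field; rewrite gt_eqF.
  by rewrite ler_pM2r in H4.
have gD : `|g| <= D.
  apply: norm_mx_le; apply: ord2P; apply: ord2P; rewrite /D; lra.
have g10 : g 1 0 = 0.
  apply/eqP; apply: contraT => n0; have := Hm g (conj (conj sk gD) n0).
  move=> mg; have : m <= C / p ^+ 2 by exact: le_trans mg g10C.
  rewrite ler_pdivlMr//.
  have : C < m * p.
    have : m * (1 + C / m) <= m * p by rewrite ler_pM2l.
    by rewrite mulrDr mulrCA mulfV ?gt_eqF// !mulr1 => ?; lra.
  have : m * p <= m * p ^+ 2 by rewrite ler_pM2l// expr2 ler_peMr// ltW.
  lra.
have tg : 2 < g 0 0 + g 1 1 by rewrite !gE; lra.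
(* One of [g] and its inverse expands the forward direction. *)
have [h [sh h10 h00]] : exists h, [/\ stab x h, h 1 0 = 0 & 1 < h 0 0].
  have dg := sk.1; rewrite det2E g10 mulr0 subr0 in dg.
  have [|le1] := ltP 1 (g 0 0); first by exists g.
  exists (adj2 g); rewrite !mx2E g10 oppr0; split => //; first exact: stabV.
  lra.
have dh : h 0 0 * h 1 1 = 1 by have := sh.1; rewrite det2E h10 mulr0 subr0.
have h0 : 0 < h 0 0 by lra.
have h11 : h 1 1 < 1.
  by rewrite -(ltr_pM2l h0) dh mulr1.
have h11p : 0 < h 1 1 by rewrite -(pmulr_rgt0 _ h0) dh.
exists h => //; split => //.
apply/eqP; rewrite -subr_eq0; apply: contraT => q0; exfalso.
(* [q] vanishes exactly when the first column of [g0] is in the contracted eigenline of [h].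
   Otherwise the powers of [h] turn this column towards the forward direction: its first entry grows
   like [h 0 0 ^+ n * q] while the second stays bounded, against [Hd]. *)
set q := (g0 0 0 * (h 1 1 - h 0 0) - h 0 1 * g0 1 0) in q0.
have hn n : exists2 k, stab x k & [/\ (k * g0) 1 0 = h 1 1 ^+ n * b &
    (k * g0) 0 0 * (h 1 1 - h 0 0) = h 0 0 ^+ n * q + h 1 1 ^+ n * (h 0 1 * b)].
  elim: n => [|n [k' sk' [k1 k2]]].
    exists 1; first by split; [exact: det1|exact: act1].
    by rewrite mul1r !expr0 !mul1r /q /b; split => //; ring.
  exists (h * k'); first exact: stabM.
  rewrite -mulrA !(mul2E h) h10 mul0r add0r k1 !exprS mulrA; split => //.
  transitivity (h 0 0 * ((k' * g0) 0 0 * (h 1 1 - h 0 0)) +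
     h 0 1 * (h 1 1 ^+ n * b) * (h 1 1 - h 0 0)); first by ring.
  by rewrite k2; ring.
have [n nl] : exists n, (`|h 0 1 * b| + (h 0 0) * `|b| / d + 1) / `|q| < h 0 0 ^+ n.
  exact: pow_unbounded.
have [k' sk' [k1 k2]] := hn n.
have := Hd k' sk'; rewrite k1.
have hh : 0 <= h 1 1 ^+ n <= 1 by rewrite exprn_ge0 ?exprn_ile1// ltW.
move: nl; rewrite ltr_pdivrMr ?normr_gt0// => nl.
have k2n : `|(k' * g0) 0 0| * (h 0 0 - h 1 1) >= h 0 0 ^+ n * `|q| - `|h 0 1 * b|.
  have -> : `|(k' * g0) 0 0| * (h 0 0 - h 1 1) = `|(k' * g0) 0 0 * (h 1 1 - h 0 0)|.
    by rewrite normrM [`|h 1 1 - _|]ltr0_norm ?opprB//; lra.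
  rewrite k2; move/andP: hh => [hh0 hh1].
  have := ler_normB (h 0 0 ^+ n * q + h 1 1 ^+ n * (h 0 1 * b)) (h 1 1 ^+ n * (h 0 1 * b)).
  rewrite addrK normrM (ger0_norm (exprn_ge0 _ (ltW h0))).
  rewrite [`|h 1 1 ^+ n * _|]normrM (ger0_norm hh0) => H.
  have : h 1 1 ^+ n * `|h 0 1 * b| <= `|h 0 1 * b| by rewrite ler_piMl.
  lra.
rewrite normrM (ger0_norm (andP hh).1) => H.
have H5 : h 1 1 ^+ n * `|b| <= `|b| by rewrite ler_piMl// (andP hh).2.
have H6 : `|(k' * g0) 0 0| <= `|b| / d.
  by rewrite ler_pdivlMr// mulrC; apply: le_trans H5.
have H7 : `|(k' * g0) 0 0| * (h 0 0 - h 1 1) <= `|b| / d * h 0 0.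
  by apply: ler_pM => //; lra.
have : h 0 0 * `|b| / d = `|b| / d * h 0 0 by ring.
lra.
Qed.

Let stab_gdX y a n : 0 < a -> stab y (gd a) -> stab y (gd (a ^+ n)).
Proof.
move=> a0 sa; elim: n => [|n IH].
  by rewrite expr0 gd1; split; [exact: det1|exact: act1].
by rewrite exprS -gdM; exact: stabM.
Qed.

(** If the dichotomy does not put [x] in [Z] at once, then after a shift along the horocycle to [y],
    the stabilizer of [y] contains some [gd a] with [a > 1] and the direction recorded by [Z] is the
    backward one. For [r != 0] the dichotomy at [act y (nr r)] must put this vector in [Z]:
    otherwise the stabilizer of [y] would contain a second hyperbolic element having exactly one
    fixed point in common with [gd a], which a discrete group does not allow. Letting [r] tend to 0
    gives [Z y]. *)
Let upper_minimal Z : closed Z -> Z !=set0 -> upper_inv Z -> forall x, Z x.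
Proof.
move=> cZ nZ uZ x.
have [C dC ZC] := leafd cZ nZ uZ x.
have [//|[k [dk xk] [k10 k00 kC]]] := slope_dichotomy cZ uZ dC ZC.
pose a := k 0 0.
have a0 : 0 < a by exact: lt_trans ltr01 k00.
have an := lt0r_neq0 a0.
have kk : a * k 1 1 = 1 by move: dk; rewrite det2E k10 mulr0 subr0.
have k11 : k 1 1 = a^-1 by apply: (mulfI an); rewrite kk mulfV.
have ka : k 1 1 - a != 0.
  rewrite k11 subr_eq0; apply/eqP => E; have : a * a = 1 by rewrite -{1}E mulVf.
  by move: k00; rewrite -/a => ? ?; nra.
pose f := k 0 1 / (k 1 1 - a).
have fE : f * (k 1 1 - a) = k 0 1 by rewrite divfK.
pose y := act x (hs f).
have sy : stab y (gd a).
  split; first exact: det_gd.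
  rewrite /y actM ?det_hs ?det_gd//.
  have -> : hs f * gd a = k * hs f.
    by apply: mx2_eq; rewrite !mul2E !mx2E -?/a ?k10 -?fE ?k11; ring.
  by rewrite -actM ?det_hs// xk.
pose g1 := hs (- f) * C.
have dg1 : \det g1 = 1 by rewrite detM2 det_hs dC mulr1.
have yg1 : act y g1 = act x C.
  by rewrite /y actM ?det_hs// /g1 mulrA hsD subrr hs0 mul1r.
have g100 : g1 0 0 = 0.
  rewrite /g1 mul2E !mx2E; apply: (mulfI ka).
  rewrite mulr0 mulrDr mul1r mulrC kC -fE; ring.
have g110 : g1 1 0 != 0.
  apply/eqP => E; move: dg1; rewrite det2E g100 E mul0r mulr0 subr0 => /eqP.
  by rewrite eq_sym oner_eq0.
suff Zy : Z y.
  have := uZ _ (hs (- f)) Zy (det_hs _); rewrite mx2E /y actM ?det_hs//.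
  by rewrite hsD subrr hs0 act1; apply.
suff Zr r : r != 0 -> Z (act y (nr r)).
  rewrite -[y]act1; apply: limit_orbit => //; first exact: det1.
  move=> e e0; exists (nr (e / 2)); split; first exact: det_nr.
    by apply: (@norm_nr (e / 2) _ e erefl _ e0); rewrite gtr0_norm ?divr_gt0//; lra.
  by apply: Zr; rewrite gt_eqF// divr_gt0.
move=> r0.
have dg2 : \det (nr (- r) * g1) = 1 by rewrite detM2 det_nr dg1 mulr1.
have Zg2 : Z (act (act y (nr r)) (nr (- r) * g1)).
  by rewrite actM ?det_nr// mulrA nrD subrr nr0 mul1r yg1.
have [//|[h [dh yh] [h10 h00 hg]]] := slope_dichotomy cZ uZ dg2 Zg2.
exfalso.
have h01 : h 0 1 = 0.
  move/eqP: hg; rewrite (mul2E (nr (- r)) g1 0 0) (mul2E (nr (- r)) g1 1 0) !mx2E g100 mulr0 mul0r add0r mul0r mul1r eq_sym.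
  by rewrite mulr0 add0r mulf_eq0 (negbTE g110) orbF => /eqP.
pose b := h 0 0.
have b0 : 0 < b by exact: lt_trans ltr01 h00.
have bn := lt0r_neq0 b0.
have hE : h = gd b.
  have hh : b * h 1 1 = 1 by move: dh; rewrite det2E h10 mulr0 subr0.
  apply: mx2_eq; rewrite !mx2E// -/b; apply: (mulfI bn); rewrite hh mulfV//.
pose c := r * (b - b^-1).
have c0 : c != 0.
  rewrite mulf_neq0// subr_eq0; apply/eqP => E; have : b * b = 1 by rewrite {2}E mulfV.
  by move: h00; rewrite -/b => ? ?; nra.
have dr := det_nr r; have dh' : \det h = 1 by [].
have sh := stab_conj dr dh' yh.
set H := nr r * h * adj2 (nr r) in sh.
have HE : (H 0 0 = b) * (H 0 1 = 0) * (H 1 0 = c) * (H 1 1 = b^-1).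
  by rewrite /H hE !mul2E !mx2E /c; do !split; ring.
(* Stabilizer elements of bounded size whose lower left entry tends to 0 without vanishing, contrary
   to discreteness. *)
pose K n := gd (a ^+ n) * H * adj2 (gd (a ^+ n)).
have sK n : stab y (K n).
  have sn := stab_gdX n a0 sy.
  by apply: stabM; [apply: stabM|exact: stabV].
have KE n : (K n 0 0 = b) * (K n 0 1 = 0) * (K n 1 0 = c / (a ^+ n) ^+ 2) * (K n 1 1 = b^-1).
  have ann : a ^+ n != 0 by rewrite expf_neq0.
  rewrite /K !(mul2E (gd _ * H)) !(mul2E (gd _)) !HE !mx2E.
  by move: (a ^+ n) ann => q qn; do !split; field; rewrite ?qn ?bn.
have aan n : 1 <= (a ^+ n) ^+ 2 by rewrite -exprM exprn_ege1// ltW.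
have KD n : `|K n| <= b + 1 + `|c|.
  have bi : b^-1 <= 1 by rewrite invf_le1// ltW.
  have bi0 : 0 < b^-1 by rewrite invr_gt0.
  have c0' := normr_ge0 c.
  apply: norm_mx_le; apply: ord2P; apply: ord2P; rewrite KE ?normr0 ?(gtr0_norm b0) ?(gtr0_norm bi0); try lra.
  rewrite normrM normfV [`|_ ^+ 2|]ger0_norm ?sqr_ge0//.
  have : `|c| / (a ^+ n) ^+ 2 <= `|c|.
    by rewrite ler_pdivrMr ?(lt_le_trans ltr01)// ler_peMr.
  lra.
have [m m0 Hm] : exists2 m, 0 < m & forall k : 'M[R]_2,
    [set k | (stab y k /\ `|k| <= b + 1 + `|c|) /\ k 1 0 != 0] k -> m <= `|k 1 0|.
  apply: finite_pos_lb.
    by apply: sub_finite_set (stab_fin y (b + 1 + `|c|)) => ? [].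
  by move=> ? [_ ?]; rewrite normr_gt0.
have [n nl] := @pow_unbounded _ a (`|c| / m) k00.
have an0 : 0 < a ^+ n by rewrite exprn_gt0.
have : m <= `|K n 1 0|.
  apply: Hm; split; first by split; [exact: sK|exact: KD].
  by rewrite KE mulf_neq0// invr_neq0// expf_neq0// gt_eqF.
rewrite KE normrM normfV [`|_ ^+ 2|]ger0_norm ?sqr_ge0//.
rewrite ler_pdivlMr ?exprn_gt0//; apply/negP; rewrite -ltNge.
rewrite ltr_pdivrMr// mulrC in nl; apply: lt_le_trans nl _.
by rewrite ler_pM2l// expr2 ler_peMr// ?exprn_ege1// ltW.
Qed.

Let upper_decomp (B : 'M[R]_2) : \det B = 1 -> B 1 0 = 0 ->
  exists p s, 0 < p /\ (B = gd p * hs s \/ B = - (gd p * hs s)).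
Proof.
rewrite det2E => dB B10; rewrite B10 mulr0 subr0 in dB.
have b0 : B 0 0 != 0 by apply: contra_eq_neq dB => ->; rewrite mul0r eq_sym oner_eq0.
have B11 : B 1 1 = (B 0 0)^-1 by apply: (mulfI b0); rewrite dB mulfV.
have [bp|bn] := ltP 0 (B 0 0).
  exists (B 0 0), (B 0 1 / B 0 0); split => //; left.
  by apply: mx2_eq; rewrite ?mul2E !mx2E ?B10 ?B11; field.
exists (- B 0 0), (B 0 1 / B 0 0); split; first by rewrite oppr_gt0 lt_neqAle b0.
by right; apply: mx2_eq; rewrite ?opp2E ?mul2E !mx2E ?B10 ?B11; field.
Qed.

Let act_hs_cont s : continuous (act ^~ (hs s)).
Proof. by apply: act_cont; exact: det_hs. Qed.

Let closed_preim (Z : set X) B : \det B = 1 -> closed Z ->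
  closed [set x | Z (act x B)].
Proof.
move=> dB cZ; apply: (closed_comp (f := act ^~ B) (D := Z)) => //.
by move=> x _; exact: act_cont.
Qed.

(** Zorn's lemma is applied to the open complements of the closed invariant sets that meet [Z]. If
    the union of a chain covers the compact set [Z], a single member does; compactness is used as a
    near-covering property along the filter [G] of tails of the chain. *)
Let exists_minimal (Z : set X) : closed Z -> Z !=set0 -> hs_inv Z ->
  exists Y, [/\ closed Y, Y !=set0, hs_inv Y, Y `<=` Z &
    forall Y', closed Y' -> Y' !=set0 -> hs_inv Y' -> Y' `<=` Y -> Y `<=` Y'].
Proof.
move=> cZ nZ iZ.
pose P (U : set X) := [/\ open U, hs_inv (~` U) & ~ (Z `<=` U)].
have compZ : compact Z by apply: (subclosed_compact cZ cX).
have [U [[oO iO ZO] Omax]] : exists U, P U /\ forall B, U `<` B -> ~ P B.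
  apply: Zorn_bigcup => F FP Ftot; split.
  - by apply: bigcup_open => U /FP[].
  - move=> x s nx [U FO] Ox; have [_ iO _] := FP U FO.
    apply: iO Ox => xO; apply: nx; exists U => //.
  - move=> ZF.
    have [U0 FO0] : exists U, F U.
      by have [z /ZF[U FO _]] := nZ; exists U.
    pose G := filter_from F (fun U => [set U' | F U' /\ U `<=` U']).
    have FG : Filter G.
      apply: filter_from_filter; first by exists U0.
      move=> A B FA FB; have [AB|BA] := Ftot _ _ FA FB.
        by exists B => // U [FO BO]; split; split => //; apply: subset_trans BO.
      by exists A => // U [FO AO]; split; split => //; apply: subset_trans AO.
    have nc : near_covering Z by exact/compact_near_coveringP.
    have [U FO HO] : G [set U | Z `<=` U].
      apply: (nc _ G (fun U x => U x)) => x Zx.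
      have [U1 FO1 O1x] := ZF _ Zx.
      exists (U1, [set U' | F U' /\ U1 `<=` U']) => /=.
        split; last by exists U1.
        by apply: open_nbhs_nbhs; split => //; have [] := FP U1 FO1.
      by move=> [x' U'] /= [h1x' [_]]; apply.
    by have [_ _ nZU] := FP U FO; apply: nZU; apply: HO; split.
exists (Z `&` ~` U); split.
- by apply: closedI => //; rewrite closedC.
- by move/existsNP: ZO => [z /not_implyP[Zz nOz]]; exists z.
- by move=> x s [Zx nOx]; split; [exact: iZ|exact: iO].
- by move=> x [].
move=> Y' cY' [y' Yy'] iY' Y'Y x [Zx nOx].
have PY' : P (~` Y').
  split; [by rewrite openC|by rewrite setCK|].
  by move=> /(_ y' (Y'Y _ Yy').1).
apply: contrapT => nY'x; apply: (Omax _ _ PY').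
split; first by move=> z Oz Y'z; have [] := Y'Y _ Y'z.
by move=> H; have := H x nY'x.
Qed.

(** * Minimal sets of the horocycle flow *)

Section MinimalSet.
Variable Y : set X.
Hypotheses (cY : closed Y) (nY : Y !=set0) (iY : hs_inv Y).
Hypothesis Ymin : forall Y', closed Y' -> Y' !=set0 -> hs_inv Y' ->
  Y' `<=` Y -> Y `<=` Y'.

Let inv p := forall y, Y y -> Y (act y (gd p)).

(** The diagonal group normalizes the horocycle group, so the points of [Y] sent into [Y] by [gd p]
    form a closed invariant set; by minimality one such point is enough. *)
Let inv_all y p : 0 < p -> Y y -> Y (act y (gd p)) -> inv p.
Proof.
move=> p0 Yy Yp y' Yy'; have dp := det_gd p0.
suff : (Y `&` [set z | Y (act z (gd p))]) y' by case.
apply: Ymin Yy'.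
- by apply: closedI => //; exact: closed_preim.
- by exists y.
- move=> z s [Yz Yzp]; split; first exact: iY.
  rewrite /= actM ?det_hs// hs_gd// -actM ?det_hs//; exact: iY.
- by move=> z [].
Qed.

Let inv_inv p : 0 < p -> inv p -> inv p^-1.
Proof.
move=> p0 ip; have [y Yy] := nY.
apply: (@inv_all (act y (gd p))); rewrite ?invr_gt0//; first exact: ip.
by rewrite actM ?det_gd ?invr_gt0// gdV// act1.
Qed.

Let invM p q : 0 < p -> 0 < q -> inv p -> inv q -> inv (p * q).
Proof.
move=> p0 q0 ip iq y Yy; rewrite -gdM -actM ?det_gd//.
by apply: iq; exact: ip.
Qed.

Let invX p n : 0 < p -> inv p -> inv (p ^+ n).
Proof.
move=> p0 ip; elim: n => [|n IH]; first by rewrite expr0 => y Yy; rewrite gd1 act1.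
by rewrite exprS; apply: invM => //; rewrite exprn_gt0.
Qed.

(** A stabilizer element followed by a suitable [hs] is [nr r * gd p] with [p] the upper left entry
    of [k]. At late times [r] tends to 0 while [p] stays in [[1 + e / 2, C]]; a cluster value [q] of
    [p] sends [u] into [Y]. *)
Let inv_gt1 : exists2 p, 1 < p & inv p.
Proof.
have [u Yu] := nY; have [e e0 [C HT]] := tame u.
have key (n : nat) : exists z : R * R, [/\ 1 + e / 2 <= z.1 <= C, `|z.2| <= C / n.+1%:R &
    Y (act u (nr z.2 * gd z.1))].
  have [p [k [[pT p1] dk kC tk hk]]] := HT n.+1%:R.
  have C0 : 0 <= C by exact: le_trans kC.
  have p0 : 0 < p by exact: lt_le_trans ltr01 p1.
  (* Inversion exchanges the diagonal entries, and one of them is at least [1 + e / 2]. *)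
  wlog k00 : k dk kC tk hk / 1 + e / 2 <= k 0 0.
    move=> W; have [|lt] := leP (1 + e / 2) (k 0 0); first exact: W.
    apply: (W (adj2 k)); rewrite ?det_adj2//.
    - apply: norm_mx_le; apply: ord2P; apply: ord2P; rewrite !mx2E ?normrN;
      by apply: le_trans kC; exact: coord_le.
    - by rewrite !mx2E [k 1 1 + _]addrC.
    - by rewrite -{1}hk actM ?det_adj2 ?det_gd//  adj2K// act1.
    - by rewrite !mx2E; lra.
  have dp := det_gd p0.
  have [dg xg] := stab_conj dp dk hk.
  set g := _ * _ * _ in dg xg.
  have pn := lt0r_neq0 p0.
  have gE : (g 0 0 = k 0 0) * (g 0 1 = p ^+ 2 * k 0 1) * (g 1 0 = k 1 0 / p ^+ 2) * (g 1 1 = k 1 1).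
    by rewrite /g !mul2E !mx2E; do !split; field.
  have q0 : 0 < k 0 0 by lra.
  have kn := lt0r_neq0 q0.
  exists (k 0 0, g 1 0 / k 0 0); split => /=.
  - by rewrite k00 (le_trans (ler_norm _))// (le_trans (coord_le _ _ _) kC).
  - rewrite gE normrM normfV (gtr0_norm q0) ler_pdivrMr//.
    rewrite normrM normfV [`|_ ^+ 2|]ger0_norm ?sqr_ge0//.
    apply: le_trans (_ : C / n.+1%:R <= _); last first.
      by rewrite ler_peMr ?divr_ge0//; lra.
    apply: ler_pM => //; first by rewrite invr_ge0 sqr_ge0.
      exact: le_trans (coord_le _ _ _) kC.
    rewrite lef_pV2 ?posrE ?exprn_gt0//; apply: le_trans pT _.
    by rewrite expr2 ler_peMr// ltW.
  - have -> : nr (g 1 0 / k 0 0) * gd (k 0 0) = g * hs (- (g 0 1 / k 0 0)).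
      have g00 : g 0 0 = k 0 0 by rewrite gE.
      by rewrite -g00; apply: lower_decomp => //; rewrite g00.
    by rewrite -actM ?det_hs// xg; apply: iY.
have [z Hz] := choice key.
have cI : compact `[1 + e / 2, C]%classic by exact: segment_compact.
have inI : ((fun n => (z n).1) @ \oo) `[1 + e / 2, C]%classic.
  by exists 0%N => // n _ /=; rewrite in_itv /=; have [] := Hz n.
have [q [qI qc]] := cI _ _ inI.
have q1 : 1 < q by move: qI; rewrite /= in_itv /= => /andP[+ _]; lra.
have q0 : 0 < q by exact: lt_trans q1.
exists q => //; apply: (@inv_all u) => //.
apply: limit_orbit => //; first exact: det_gd.
move=> d d0.
(* Chosen so that the lower left entry [r * p] of the approximating matrices is less than
   [C' / n.+1] once [p] is within 1 of [q]. *)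
pose C' := `|C| * (`|q| + 1) + 1.
have C'0 : 0 < C' by rewrite ltr_wpDl// mulr_ge0// addr_ge0.
have [N HN] : exists N : nat, C' / (Num.min d 1) < N%:R.
  exists (Num.bound (C' / Num.min d 1)); apply: archi_boundP.
  by rewrite divr_ge0// ?ltW// lt_min d0 ltr01.
have qd : nbhs q (ball q (Num.min (Num.min d 1) (q - 1))).
  by apply: nbhsx_ballx; rewrite !lt_min d0 ltr01 subr_gt0.
have FN : ((fun n => (z n).1) @ \oo) [set (z n).1 | n in [set n | (N <= n)%N]].
  by exists N => // n /= ?; exists n.
have [_ [[n /= Nn <-]]] := qc _ _ FN qd.
rewrite -ball_normE /= !lt_min => /andP[/andP[nd n1] nq].
have [/andP[h1 h2] h3 h4] := Hz n.
move: h1 h2 h3 h4 nd n1 nq; move: (z n) => [p r] /= h1 h2 h3 h4 nd n1 nq.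
have p1 : 1 < p by lra.
have p0 : 0 < p by lra.
exists (nr r * gd p); split => //; first by rewrite detM2 det_nr det_gd// mulr1.
have pq : `|p| <= `|q| + 1.
  have -> : p = q - (q - p) by ring.
  by apply: le_trans (ler_normB _ _) _; rewrite lerD2l ltW.
have rp : `|r * p| < d.
  rewrite normrM; apply: le_lt_trans (_ : C / n.+1%:R * (`|q| + 1) < d).
    by apply: ler_pM.
  have m0 : 0 < Num.min d 1 by rewrite lt_min d0 ltr01.
  rewrite ltr_pdivrMr// in HN.
  have nN : (N%:R : R) <= n.+1%:R by rewrite ler_nat ltnW.
  have n0 : (0 : R) < n.+1%:R by rewrite ltr0n.
  rewrite mulrAC ltr_pdivrMr//.
  apply: lt_le_trans (_ : C' <= _).
    rewrite /C'; apply: le_lt_trans (_ : `|C| * (`|q| + 1) < _); last by rewrite ltrDl.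
    by apply: ler_wpM2r; [rewrite addr_ge0|exact: ler_norm].
  apply: le_trans (ltW HN) _; rewrite mulrC.
  apply: ler_pM => //; first exact: ltW.
  by rewrite ge_min lexx.
have pV : `|p^-1 - q^-1| <= `|q - p|.
  have -> : p^-1 - q^-1 = (q - p) / (p * q) by field; rewrite !gt_eqF.
  rewrite normrM ler_piMr// normfV invf_le1 ?normr_gt0 ?mulf_neq0 ?gt_eqF//.
  by rewrite ger0_norm ?mulr_ge0 ?ltW//; nra.
apply: le_lt_trans (_ : Num.max `|q - p| `|r * p| < d); last by rewrite gt_max nd.
apply: norm_mx_le; apply: ord2P; apply: ord2P; rewrite sub2E mul2E !mx2E le_max.
- by rewrite mul1r mul0r addr0 distrC lexx.
- by rewrite mulr0 mul0r addr0 subr0 normr0 normr_ge0.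
- by rewrite mul1r addr0 subr0 lexx orbT.
- by rewrite mulr0 add0r mul1r pV.
Qed.

(** A fundamental domain for multiplication by [p] on the positive reals: the least power of [p]
    beyond [q], or beyond [q^-1], brings [q] into [[1, p]]. *)
Let reduce_scale (P : R -> Prop) p q : 1 < p -> 0 < q ->
  (forall t, 0 < t -> P t -> P (t * p) /\ P (t / p)) -> P q ->
  exists2 t, 1 <= t <= p & P t.
Proof.
move=> p1 q0 HP Pq; have p0 : 0 < p by exact: lt_trans p1.
have PX n t : 0 < t -> P t -> P (t * p ^+ n) /\ P (t / p ^+ n).
  move=> t0 Pt; elim: n => [|n [IH1 IH2]]; first by rewrite expr0 divr1 mulr1.
  rewrite exprS invfM; split.
    by rewrite mulrCA mulrC; apply: (HP _ _ IH1).1; rewrite mulr_gt0// exprn_gt0.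
  by rewrite mulrCA mulrC; apply: (HP _ _ IH2).2; rewrite divr_gt0// exprn_gt0.
have ex c : exists n, c < p ^+ n by exact: pow_unbounded.
have [q1|q1] := leP 1 q.
  case: (ex_minnP (ex q)) => [[|n]]; first by rewrite expr0 ltNge q1.
  move=> qn nmin; exists (q / p ^+ n); last exact: (PX n q q0 Pq).2.
  have pn : 0 < p ^+ n by rewrite exprn_gt0.
  rewrite ler_pdivlMr// mul1r ler_pdivrMr// -exprS (ltW qn) andbT leNgt.
  by apply/negP => /nmin; rewrite ltnn.
case: (ex_minnP (ex q^-1)) => [[|n]].
  by rewrite expr0 invf_lt1// ltNge (ltW q1).
move=> qn nmin; exists (q * p ^+ n.+1); last exact: (PX n.+1 q q0 Pq).1.
have pn : 0 < p ^+ n by rewrite exprn_gt0.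
apply/andP; split.
  by rewrite -ler_pdivrMl// mulr1 ltW.
rewrite exprS mulrCA ger_pMr// -ler_pdivlMl// mulr1 leNgt.
by apply/negP => /nmin; rewrite ltnn.
Qed.

(** The union [W] of the translates of [Y] is invariant under the upper triangular group. As [Y] is
    invariant under some [gd p] with [p > 1], the translation can be taken in the compact interval
    [[1, p]], which makes [W] closed, and [upper_minimal] applies. *)
Let cover x : exists2 s, 0 < s & Y (act x (gd s^-1)).
Proof.
have [p p1 ip] := inv_gt1; have p0 : 0 < p by exact: lt_trans p1.
have iv := inv_inv p0 ip.
pose W := [set x | exists2 s : R, 0 < s & Y (act x (gd s^-1))].
have red z : W z -> exists2 s, 1 <= s <= p & Y (act z (gd s^-1)).
  move=> [s s0 Ys]; apply: (reduce_scale p1 s0) Ys => t t0 Yt.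
  have tn : 0 < t^-1 by rewrite invr_gt0.
  have pn : 0 < p^-1 by rewrite invr_gt0.
  split; rewrite invfM ?invrK -gdM -actM ?det_gd//; by [exact: iv|exact: ip].
apply: (upper_minimal (Z := W)).
- move=> z clz; apply: contrapT => nWz.
  have nc : near_covering `[1, p]%classic.
    by apply/compact_near_coveringP; exact: segment_compact.
  have : \forall z' \near z, `[1, p]%classic `<=` [set s | ~ Y (act z' (gd s^-1))].
    apply: (nc _ (nbhs z) (fun z' s => ~ Y (act z' (gd s^-1)))) => s.
    rewrite /= in_itv /= => /andP[s1 _]; have s0 : 0 < s by exact: lt_le_trans s1.
    have sn : 0 < s^-1 by rewrite invr_gt0.
    have nY' : nbhs (act z (gd s^-1)) (~` Y).
      apply: open_nbhs_nbhs; split; first by rewrite openC.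
      by move=> Yz; apply: nWz; exists s.
    have [e e0 [V zV HV]] := act_diag nY'.
    have zV' : nbhs z [set z' | V (act z' (gd s^-1))].
      by have := act_cont (det_gd sn); apply.
    have sV : nbhs s [set s' | 0 < s' /\ `|s / s' - 1| < e].
      have cs : (s / s') @[s' --> s] --> s / s.
        by apply: cvgM; [exact: cvg_cst|apply: cvgV => //; rewrite gt_eqF].
      have h1 : nbhs s [set s' | 0 < s'] by exact: lt_nbhsr.
      have /cvgrPdist_lt/(_ e e0) := cs; rewrite divff ?gt_eqF// => h2.
      by apply: filterS2 h1 h2 => s' ? ?; split; rewrite 1?distrC.
    exists ([set s' | 0 < s' /\ `|s / s' - 1| < e], [set z' | V (act z' (gd s^-1))]) => //.
    move=> [s' z'] /= [[s'0 s'e] Vz'].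
    have := HV _ _ Vz' (divr_gt0 s0 s'0) s'e.
    rewrite actM ?det_gd ?divr_gt0// gdM mulrA mulVf ?gt_eqF// mul1r.
    by [].
  move=> /clz[z' [Wz' Hz']]; have [s sI Ys] := red _ Wz'.
  by apply: (Hz' s).
- have [y Yy] := nY; exists y; exists 1 => //.
  by rewrite invr1 gd1 act1.
- move=> z B [s s0 Ys] dB B10.
  have [q [r [q0 BE]]] := upper_decomp dB B10.
  have W1 : W (act z (gd q * hs r)).
    have sn : 0 < s^-1 by rewrite invr_gt0.
    have sqn : 0 < (s * q)^-1 by rewrite invr_gt0 mulr_gt0.
    exists (s * q); first exact: mulr_gt0.
    rewrite actM ?det_gd ?detM2 ?det_gd ?det_hs ?mulr1//.
    rewrite -mulrA hs_gd// mulrA gdM invfM mulrCA mulfV ?gt_eqF// mulr1.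
    by rewrite -actM ?det_gd ?det_hs//; exact: iY.
  case: BE => -> //.
  by rewrite act_opp// detM2 det_gd// det_hs mulr1.
Qed.

(* A vector fixed by a translation gd l contracts the unstable horocycle through
   it, which therefore lies in the same time slice. *)
Let unstable u l : 1 < l -> Y u -> act u (gd l) = u -> forall r, Y (act u (nr r)).
Proof.
move=> l1 Yu ul r; have l0 : 0 < l by exact: lt_trans l1.
have il : inv l by apply: (@inv_all u) => //; rewrite ul.
have ln : 0 < l^-1 by rewrite invr_gt0.
have iv := inv_inv l0 il.
have [s s0 Ys] := cover (act u (nr r)).
have sn : 0 < s^-1 by rewrite invr_gt0.
have ulV : act u (gd l^-1) = u by rewrite -{1}ul actM ?det_gd// gdV// act1.
have ulX n : act u (gd (l^-1 ^+ n)) = u.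
  elim: n => [|n IH]; first by rewrite expr0 gd1 act1.
  by rewrite exprS -gdM -actM ?det_gd ?exprn_gt0// ulV.
have Yn n : Y (act u (nr (r * (l^-1 ^+ n) ^+ 2) * gd s^-1)).
  have pn : 0 < l^-1 ^+ n by rewrite exprn_gt0.
  have := @invX _ n ln iv _ Ys.
  rewrite actM ?det_gd// actM ?det_nr//; last by rewrite gdM det_gd ?mulr_gt0.
  rewrite gdM [s^-1 * _]mulrC -gdM mulrA (@nr_gd _ r _ pn) -mulrA.
  by rewrite -actM ?ulX ?det_gd// det_mul1 ?det_nr ?det_gd.
have Yus : Y (act u (gd s^-1)).
  apply: limit_orbit => //; first exact: det_gd.
  move=> e e0.
  have rs : 0 <= `|r| / s by rewrite divr_ge0// ltW.
  have [n nl] := @pow_unbounded _ l (`|r| / s / e) l1.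
  have ln0 : 0 < l ^+ n by rewrite exprn_gt0.
  exists (nr (r * (l^-1 ^+ n) ^+ 2) * gd s^-1); split => //.
    by rewrite detM2 det_nr det_gd// mulr1.
  have small : `|r * (l^-1 ^+ n) ^+ 2 * s^-1| < e.
    rewrite exprVn mulrAC normrM normrM [`|s^-1|]gtr0_norm// [`|_ ^+ 2|]ger0_norm ?sqr_ge0//.
    rewrite exprVn ltr_pdivrMr ?exprn_gt0//.
    rewrite ltr_pdivrMr// [_ * e]mulrC in nl; apply: lt_le_trans nl _.
    by rewrite ler_pM2l// expr2 ler_peMr// ?exprn_ege1// ltW.
  apply: le_lt_trans small; apply: norm_mx_le; apply: ord2P; apply: ord2P;
    rewrite sub2E mul2E !mx2E.
  - by rewrite mul1r mul0r addr0 subrr normr0.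
  - by rewrite mulr0 mul0r addr0 subr0 normr0.
  - by rewrite mulr0 addr0 subr0.
  - by rewrite mulr0 add0r mul1r subrr normr0.
(* [u] and [act u (gd s^-1)] both lie in [Y], so [Y] is invariant under [gd s^-1] and hence under
   [gd s], which undoes the translation in [Ys]. *)
have i1 := inv_all sn Yu Yus.
have := inv_inv sn i1; rewrite invrK => /(_ _ Ys).
by rewrite actM ?det_gd// gdVl// act1.
Qed.

Lemma minimal_full x : Y x.
Proof.
have [u1 Yu1] := nY; have [e e0 [C HT]] := tame u1.
have [p [k [[_ p1] dk _ tk hk]]] := HT 1.
have p0 : 0 < p by exact: lt_le_trans p1.
have tk2 : 2 < k 0 0 + k 1 1 by lra.
have [M [l [dM l1 kM]]] := diagonalize dk tk2.
have l0 : 0 < l by exact: lt_trans l1.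
have slice z : act z (gd l) = z -> exists s, [/\ 0 < s, Y (act z (gd s^-1)) &
    act (act z (gd s^-1)) (gd l) = act z (gd s^-1)].
  move=> zl; have [s s0 Ys] := cover z; exists s; split => //.
  by rewrite actM ?det_gd ?invr_gt0// gdM mulrC -gdM -actM ?det_gd ?invr_gt0// zl.
pose u2 := act (act u1 (gd p)) M.
have u2l : act u2 (gd l) = u2.
  by rewrite /u2 actM ?det_gd// -kM -actM// hk.
have [s [s0 Yu ul]] := slice _ u2l; set u := act u2 _ in Yu ul.
have un := unstable l1 Yu ul.
(* Conjugation by [w0] inverts the diagonal group, so the reversed vector is periodic as well and
   has its own translate in [Y]. *)
have wl : act (act u w0) (gd l) = act u w0.
  have lV : 0 < l^-1 by rewrite invr_gt0.
  have E : w0 * gd l = gd l^-1 * w0 by rewrite -[in LHS](invrK l) w0_gd.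
  have ulV : act u (gd l^-1) = u by rewrite -{1}ul actM ?det_gd// gdV// act1.
  by rewrite actM ?det_w0 ?det_gd// E -actM ?det_w0 ?det_gd// ulV.
have [s' [s'0 Yu' ul']] := slice _ wl.
have un' := unstable l1 Yu' ul'.
have sV : 0 < s'^-1 by rewrite invr_gt0.
have invall q : 0 < q -> inv q.
  move=> q0; pose r := q / s'.
  have r0 : 0 < r by rewrite divr_gt0.
  apply: (@inv_all (act u (nr (- (s' ^+ 2 * r)^-1)))) => //.
  rewrite actM ?det_nr ?det_gd//.
  have dws : \det (w0 * gd s'^-1) = 1 by rewrite det_mul1 ?det_w0 ?det_gd.
  have := un' r; rewrite (actM _ det_w0 (det_gd sV)) (actM _ dws (det_nr r)).
  (* The left side sends [u] into [Y] by the opposite horocycle of the reversed vector. On the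
     right, up to sign and a final [hs], stands [nr _ * gd q], and [nr _] alone already sends [u]
     into [Y]. As [r] runs through the positive reals, [q = s' * r] takes every positive value. *)
  have E : w0 * gd s'^-1 * nr r = - (nr (- (s' ^+ 2 * r)^-1) * gd q * hs (s' / q)).
    have sn := lt0r_neq0 s'0; have qn := lt0r_neq0 q0.
    by rewrite /r; apply: mx2_eq; rewrite opp2E !mul2E !mx2E; field; rewrite ?sn ?qn.
  set N := nr _ * gd q in E *.
  have dN : \det N = 1 by rewrite det_mul1 ?det_nr ?det_gd.
  rewrite E (act_opp _ (det_mul1 dN (det_hs _))) => H.
  have := iY (- (s' / q)) H; rewrite (actM _ (det_mul1 dN (det_hs _)) (det_hs _)).
  by rewrite -mulrA hsD subrr hs0 mulr1.
apply: (upper_minimal (Z := Y)) => // z B Yz dB B10.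
have [q [r [q0 BE]]] := upper_decomp dB B10.
have Y1 : Y (act z (gd q * hs r)).
  by rewrite -actM ?det_gd ?det_hs//; apply: iY; exact: invall.
case: BE => -> //.
by rewrite act_opp// detM2 det_gd// det_hs mulr1.
Qed.

End MinimalSet.

Lemma horocycle_orbits_dense x : dense [set act x (hs s) | s in [set: R]].
Proof.
pose Z := closure [set act x (hs s) | s in [set: R]].
have iZ : hs_inv Z.
  move=> z s Zz V /(act_hs_cont) /Zz [_ [[t _ <-] /= Vt]].
  exists (act (act x (hs t)) (hs s)); split => //.
  by exists (t + s) => //; rewrite actM ?det_hs// hsD.
have nZ : Z !=set0.
  by exists (act x (hs 0)); apply: subset_closure; exists 0.
have cZ : closed Z by exact: closed_closure.
have [Y [cY nY iY YZ Ymin]] := exists_minimal cZ nZ iZ.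
move=> O [z Oz] oO.
have /YZ Zz : Y z by exact: minimal_full.
have [y [Hy Oy]] := Zz O (open_nbhs_nbhs (conj oO Oz)).
by exists y.
Qed.

End Dynamics.

(** * Uniformized leaves and their frames *)

#[global] Instance plane_nbhs_filter (R : realType) (z : plane R) :
  ProperFilter (nbhs z) := nbhs_pfilter z.

Section SmoothOn.
Context {R : realType}.

Lemma smooth_on_differentiable m n (O : set (plane R)) (f : plane R -> 'M[R]_(m.+1, n.+1)) :
  open O -> smooth_on O f -> forall w x, O x -> differentiable (iter_partial w f) x.
Proof.
move=> oO sf w x Ox.
have nO : \forall y \near x, O y by exact: open_nbhs_nbhs.
apply: C1_differentiable => i.
  by apply: filterS nO => y Oy; exact: (sf w y Oy).1.
exact: (sf (i :: w) x Ox).2.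
Qed.

Lemma smooth_on_diff2 (O : set (plane R)) (f : plane R -> plane R) x :
  open O -> smooth_on O f -> O x -> diff2 f x.
Proof.
move=> oO sf Ox; split.
  have nO : \forall y \near x, O y by exact: open_nbhs_nbhs.
  by apply: filterS nO => y; exact: (@smooth_on_differentiable _ _ O f oO sf [::]).
by move=> i; exact: (@smooth_on_differentiable _ _ O f oO sf [:: i]).
Qed.

End SmoothOn.

Section Leaves.
Context {R : realType} (M : metricType R) (F : compact_lamination M).

Lemma same_leaf_trans (m n q : M) : same_leaf F m n -> same_leaf F n q -> same_leaf F m q.
Proof.
move=> mn nq; elim: nq mn => // {}n n' q' a t _ IH tn' tq' mn.
by apply: (@same_leaf_step _ _ F m n' q' a t) => //; exact: IH.
Qed.

Lemma same_leaf_sym (m n : M) : same_leaf F m n -> same_leaf F n m.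
Proof.
elim=> [x|x n' q a t _ IH tn tq]; first exact: same_leaf_refl.
apply: same_leaf_trans IH.
by apply: (@same_leaf_step _ _ F q q n' a t) => //; exact: same_leaf_refl.
Qed.

Lemma leaf_eq (m n : M) : leaf F m n -> leaf F n = leaf F m.
Proof.
move=> mn; apply/seteqP; split => q; rewrite /leaf /=.
  exact: same_leaf_trans.
by apply: same_leaf_trans; exact: same_leaf_sym.
Qed.

Lemma chart_inv_cvg (a : chart F) (x : plane R) (t : transversal a) :
  chart_disk a x -> {for (x, t), continuous (@chart_inv _ _ F a)}.
Proof.
move=> Dx.
have oD : open (chart_disk a `*` [set: transversal a]).
  rewrite (_ : _ `*` _ = [set z : plane R * transversal a | chart_disk a z.1]); last first.
    by apply/seteqP; split => z //= [].
  have /continuousP : continuous (@fst (plane R) (transversal a)).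
    by move=> z; exact: cvg_fst.
  by apply; exact: disk_open.
have := @chart_inv_continuous _ _ F a.
by rewrite (continuous_open_subspace _ oD) => /(_ (x, t)); apply; rewrite inE.
Qed.

Lemma chart_map_cvg (a : chart F) (m : M) :
  chart_dom a m -> {for m, continuous (@chart_map _ _ F a)}.
Proof.
move=> am; have := @chart_map_continuous _ _ F a.
rewrite (continuous_open_subspace _ (@chart_dom_open _ _ F a)) => /(_ m).
by apply; rewrite inE.
Qed.

Lemma near_dom (a : chart F) (m : M) : chart_dom a m ->
  \forall n \near m, chart_dom a n.
Proof. by move=> am; apply: open_nbhs_nbhs; split => //; exact: chart_dom_open. Qed.

Lemma near_disk (a : chart F) (x : plane R) : chart_disk a x ->
  \forall y \near x, chart_disk a y.
Proof. by move=> ?; apply: open_nbhs_nbhs; split => //; exact: disk_open. Qed.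

Lemma chart_point (a : chart F) m : chart_dom a m ->
  chart_inv ((chart_map a m).1, (chart_map a m).2) = m.
Proof. by move=> am; rewrite -surjective_pairing chart_mapK. Qed.

End Leaves.

Section Uniformization.
Context {R : realType} (M : metricType R) (F : riemannian_lamination M).
Variables (G : set 'M[R]_2) (p : plane R -> M) (L : set M).
Hypothesis U : uniformization F G p L.

Let Fmap (a : chart F) (w : plane R) := (chart_map a (p w)).1.

Lemma unif_chart z (a : chart F) : half_plane z -> chart_dom a (p z) ->
  \forall w \near z, [/\ half_plane w, chart_dom a (p w),
     (chart_map a (p w)).2 = (chart_map a (p z)).2 &
     p w = chart_inv (Fmap a w, (chart_map a (p z)).2)].
Proof.
move=> Hz az; have [_ _ _ /(_ z a Hz az) [[V [oO Oz] [hP _]] _ _]] := U.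
have nO : \forall w \near z, V w by exact: open_nbhs_nbhs.
apply: filterS2 nO (near_half Hz) => w Ow Hw.
have [aw tw] := hP w Ow; split => //.
by rewrite /Fmap -tw chart_point.
Qed.

Lemma unif_diff2 z (a : chart F) : half_plane z -> chart_dom a (p z) ->
  diff2 (Fmap a) z /\ forall i, {for z, continuous ('D_(e_ i) (Fmap a))}.
Proof.
move=> Hz az; have [_ _ _ /(_ z a Hz az) [[V [oO Oz] [hP sO]] _ _]] := U.
have d2 := smooth_on_diff2 oO sO Oz.
by split => // i; apply: differentiable_continuous; exact: d2.2.
Qed.

Lemma unif_iso z (a : chart F) v : half_plane z -> chart_dom a (p z) ->
  bilinear_form (metric (Fmap a z) (chart_map a (p z)).2)
    ('D_v (Fmap a) z) ('D_v (Fmap a) z) =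
  (v 0 0 ^+ 2 + v 0 1 ^+ 2) / z 0 1 ^+ 2.
Proof. by move=> Hz az; have [_ _ _ /(_ z a Hz az) []] := U. Qed.

Lemma unif_det z (a : chart F) : half_plane z -> chart_dom a (p z) ->
  0 < \det (jacobian (Fmap a) z).
Proof. by move=> Hz az; have [_ _ _ /(_ z a Hz az) []] := U. Qed.

Lemma unif_disk z (a : chart F) : chart_dom a (p z) -> chart_disk a (Fmap a z).
Proof. exact: chart_map_disk. Qed.

Lemma unif_cont z : half_plane z -> {for z, continuous p}.
Proof.
move=> Hz; have [a az] := chart_cover F (p z).
have nc := unif_chart Hz az.
have [d2 _] := unif_diff2 Hz az.
have cF : {for z, continuous (Fmap a)}.
  exact: differentiable_continuous (nbhs_singleton d2.1).
set t := (chart_map a (p z)).2 in nc.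
have Dz := unif_disk az.
have cc : {for z, continuous (fun w => chart_inv (Fmap a w, t))}.
  apply: (@continuous_comp _ _ _ (fun w => (Fmap a w, t)) (@chart_inv _ _ F a)).
    have ct : (fun=> t) @ z --> t by exact: cvg_cst.
    exact: (cvg_pair cF ct).
  exact: chart_inv_cvg.
rewrite /prop_for /continuous_at.
have -> : p z = chart_inv (Fmap a z, t) by have [] := nbhs_singleton nc.
apply: cvg_trans cc; apply: near_eq_cvg.
by apply: filterS nc => w [].
Qed.

End Uniformization.

Section ChartChange.
Context {R : realType} (M : metricType R) (F : compact_lamination M).

Lemma change_slice_open (a b : chart F) (t : transversal b) :
  open [set x | chart_disk b x /\ chart_dom a (chart_inv (x, t))].
Proof.
rewrite openE => x [Dx ax].
have ci : {for x, continuous (fun y : plane R => chart_inv (y, t))}.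
  apply: (@continuous_comp _ _ _ (fun y : plane R => (y, t)) (@chart_inv _ _ F b)).
    have ct : (fun=> t) @ x --> t by exact: cvg_cst.
    exact: (cvg_pair (@cvg_id _ (nbhs x)) ct).
  exact: chart_inv_cvg.
apply: filterI; first exact: near_disk.
by have := ci _ (near_dom ax).
Qed.

Lemma change_smooth (a b : chart F) (t : transversal b) x w :
  chart_disk b x -> chart_dom a (chart_inv (x, t)) ->
  differentiable (iter_partial w (chart_change a t)) x.
Proof.
move=> Dx ax.
have [sf _] := @chart_change_smooth _ _ F a b.
exact: (smooth_on_differentiable (@change_slice_open a b t) (sf t) w (conj Dx ax)).
Qed.

End ChartChange.

Section UnitTangentExt.
Context {R : realType} (M : metricType R) (F : riemannian_lamination M).

Lemma ut_ext (u w : unit_tangent F) : ut_base u = ut_base w ->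
  (forall a, chart_dom a (ut_base u) -> ut_vec u a = ut_vec w a) -> u = w.
Proof.
move=> eb ev.
have evf : ut_vec u = ut_vec w.
  apply/funext => a; have [au|nau] := pselect (chart_dom a (ut_base u)).
    exact: ev.
  by rewrite (ut_vec_out nau) ut_vec_out// -eb.
case: u w eb evf {ev} => [b v h1 h2 h3] [b' v' h1' h2' h3'] /= eb ev.
subst b' v'; congr UnitTangent; exact: Prop_irrelevance.
Qed.

Lemma ut_ext_chart (u w : unit_tangent F) a : chart_dom a (ut_base u) ->
  ut_base u = ut_base w -> ut_vec u a = ut_vec w a -> u = w.
Proof.
move=> au eb ev; apply: ut_ext => // b bu.
have aw : chart_dom a (ut_base w) by rewrite -eb.
have bw : chart_dom b (ut_base w) by rewrite -eb.
by rewrite (ut_vec_change bu au) (ut_vec_change bw aw) ev eb.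
Qed.

End UnitTangentExt.

(** * Frames of a uniformized leaf *)

Section Frames.
Context {R : realType} (M : metricType R) (F : riemannian_lamination M).
Variables (G : set 'M[R]_2) (p : plane R -> M) (L : set M).
Hypothesis U : uniformization F G p L.

(** The uniformization moved so that the frame [A] sits at [ii], read in the chart [a]. Its
    derivative at [ii] along [e_ 1] is the unit vector of the frame; the one along [e_ 0] completes
    it to an oriented orthonormal basis. *)
Definition fr (q : plane R -> M) (A : 'M[R]_2) (a : chart F) (z : plane R) : plane R :=
  (chart_map a (q (mobius A z))).1.

Lemma hpoint01 : hpoint 0 1 = e_ 1 :> plane R.
Proof. by apply: plane_eq; rewrite hpointE e_E. Qed.

Lemma fr_comp A a : fr p A a = (fun w => (chart_map a (p w)).1) \o mobius A.
Proof. by []. Qed.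

Lemma polar_frame (g : 'M[R]_2) (D : plane R -> plane R) (h : plane R -> R) v w :
  g^T = g -> D (v + w) = D v + D w -> (forall v, bilinear_form g (D v) (D v) = h v) ->
  bilinear_form g (D v) (D w) = (h (v + w) - h v - h w) / 2.
Proof. by move=> gT Dvw gD; rewrite (bilinear_polar _ _ gT) -Dvw !gD. Qed.

(** Composition with a Moebius transformation multiplies the Jacobian determinant by [1 / N ^+ 2];
    the expression is the one met in [fr_orient]. *)
Lemma conformal_det (d c x y u v : R) : 0 < x * v - y * u -> forall N, 0 < N ->
  N = d ^+ 2 + c ^+ 2 -> 0 < (((d ^+ 2 - c ^+ 2) / N ^+ 2 * 1 + 2 * d * c / N ^+ 2 * 0) * x +
    (- (2 * d * c / N ^+ 2) * 1 + (d ^+ 2 - c ^+ 2) / N ^+ 2 * 0) * u) *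
   (((d ^+ 2 - c ^+ 2) / N ^+ 2 * 0 + 2 * d * c / N ^+ 2 * 1) * y +
    (- (2 * d * c / N ^+ 2) * 0 + (d ^+ 2 - c ^+ 2) / N ^+ 2 * 1) * v) -
   (((d ^+ 2 - c ^+ 2) / N ^+ 2 * 1 + 2 * d * c / N ^+ 2 * 0) * y +
    (- (2 * d * c / N ^+ 2) * 1 + (d ^+ 2 - c ^+ 2) / N ^+ 2 * 0) * v) *
   (((d ^+ 2 - c ^+ 2) / N ^+ 2 * 0 + 2 * d * c / N ^+ 2 * 1) * x +
    (- (2 * d * c / N ^+ 2) * 0 + (d ^+ 2 - c ^+ 2) / N ^+ 2 * 1) * u).
Proof.
move=> J0 N N0 NE; have nN := lt0r_neq0 N0; rewrite NE in nN.
rewrite (_ : _ - _ = (x * v - y * u) / N ^+ 2); last by rewrite NE; field.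
by rewrite divr_gt0// exprn_gt0.
Qed.

Section OneFrame.
Variables (A : 'M[R]_2) (a : chart F).
Hypotheses (dA : \det A = 1) (aA : chart_dom a (p (mobius A ii))).
Let t := (chart_map a (p (mobius A ii))).2.
Let HA := mobius_half dA ii_half.

Lemma fr_diff2 : diff2 (fr p A a) ii.
Proof.
rewrite fr_comp; apply: diff2_comp; first exact: (diff2_mobius dA ii_half).
exact: (unif_diff2 U HA aA).1.
Qed.

Lemma fr_near : \forall z \near ii, [/\ half_plane z, chart_dom a (p (mobius A z)),
  (chart_map a (p (mobius A z))).2 = t &
  p (mobius A z) = chart_inv (fr p A a z, t)].
Proof.
have cm : {for ii, continuous (mobius A)}.
  exact/differentiable_continuous/(mobius_der 0 dA ii_half).1.
have := cm _ (unif_chart U HA aA).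
by apply: filterS2 (near_half ii_half) => z Hz [_ h1 h2 h3].
Qed.

Lemma fr_der_at z v : half_plane z -> chart_dom a (p (mobius A z)) ->
  'D_v (fr p A a) z =
  'D_(mder A z v) (fun w => (chart_map a (p w)).1) (mobius A z).
Proof.
move=> Hz az; have [dm Dm] := mobius_der v dA Hz.
have df := nbhs_singleton (unif_diff2 U (mobius_half dA Hz) az).1.1.
by rewrite fr_comp (derive_comp _ dm df) Dm.
Qed.

Lemma fr_iso_at z v : half_plane z -> chart_dom a (p (mobius A z)) ->
  bilinear_form (metric (fr p A a z) (chart_map a (p (mobius A z))).2)
    ('D_v (fr p A a) z) ('D_v (fr p A a) z)
  = (v 0 0 ^+ 2 + v 0 1 ^+ 2) / z 0 1 ^+ 2.
Proof.
move=> Hz az; rewrite fr_der_at// (unif_iso U _ (mobius_half dA Hz) az).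
exact: mder_sqn.
Qed.

Lemma fr_iso : \forall z \near ii, forall v,
  bilinear_form (metric (fr p A a z) t) ('D_v (fr p A a) z) ('D_v (fr p A a) z)
  = (v 0 0 ^+ 2 + v 0 1 ^+ 2) / z 0 1 ^+ 2.
Proof. by apply: filterS fr_near => z [Hz az <- _] v; exact: fr_iso_at. Qed.

Lemma fr_disk : chart_disk a (fr p A a ii).
Proof. exact: chart_map_disk. Qed.

Lemma mder_ii v : mder A ii v = hpoint
  ((A 1 1 ^+ 2 - A 1 0 ^+ 2) / (A 1 1 ^+ 2 + A 1 0 ^+ 2) ^+ 2 * v 0 0
    + 2 * A 1 1 * A 1 0 / (A 1 1 ^+ 2 + A 1 0 ^+ 2) ^+ 2 * v 0 1)
  (- (2 * A 1 1 * A 1 0 / (A 1 1 ^+ 2 + A 1 0 ^+ 2) ^+ 2) * v 0 0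
    + (A 1 1 ^+ 2 - A 1 0 ^+ 2) / (A 1 1 ^+ 2 + A 1 0 ^+ 2) ^+ 2 * v 0 1).
Proof.
rewrite /mder /mre /mim /mden !hpointE !mulr0 !add0r !mulr1.
by congr hpoint; rewrite ?mulNr ?opprK.
Qed.

Lemma fr_orient : 0 < 'D_(e_ 0) (fr p A a) ii 0 0 * 'D_(e_ 1) (fr p A a) ii 0 1
                  - 'D_(e_ 0) (fr p A a) ii 0 1 * 'D_(e_ 1) (fr p A a) ii 0 0.
Proof.
rewrite !(fr_der_at _ ii_half aA).
set f := (fun w => _); set z := mobius A ii.
have df : differentiable f z by exact: nbhs_singleton (unif_diff2 U HA aA).1.1.
have JE i j : jacobian f z i j = 'D_(e_ i) f z 0 j.
  by rewrite (deriveEjacobian _ df) /e_ -rowE [RHS]mxE.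
rewrite (derive_plane (mder A ii (e_ 0)) df) (derive_plane (mder A ii (e_ 1)) df).
rewrite !mder_ii !hpointE !e_E.
have sE (x y : R) (v w : plane R) k : (x *: v + y *: w) 0 k = x * v 0 k + y * w 0 k.
  by rewrite !mxE.
rewrite !sE.
have := unif_det U HA aA; rewrite -/f -/z det2E !JE => J0.
have := mden_gt0 dA ii_half; rewrite /mden !hpointE mulr0 add0r mulr1 => N0.
exact: (conformal_det J0 N0 erefl).
Qed.

Lemma metric_tr : (metric (fr p A a ii) t)^T = metric (fr p A a ii) t.
Proof. by apply: metric_sym; exact: fr_disk. Qed.

Lemma fr_orthonormal (i j : 'I_2) :
  bilinear_form (metric (fr p A a ii) t) ('D_(e_ i) (fr p A a) ii) ('D_(e_ j) (fr p A a) ii)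
  = (i == j)%:R.
Proof.
have df := nbhs_singleton fr_diff2.1.
have iso v := nbhs_singleton fr_iso v.
have Dij : 'D_(e_ i + e_ j) (fr p A a) ii = 'D_(e_ i) (fr p A a) ii + 'D_(e_ j) (fr p A a) ii.
  by rewrite (deriveE _ df) linearD -(deriveE _ df) -(deriveE _ df).
rewrite (polar_frame (D := fun v => 'D_v (fr p A a) ii) metric_tr Dij iso).
rewrite !hpoint1 expr1n !divr1 !mxE /=.
move: i j {Dij}; apply: ord2P; apply: ord2P => /=; rewrite ?mulr1n ?mulr0n; by field.
Qed.

End OneFrame.

Lemma frame_exists A : \det A = 1 -> exists u : unit_tangent F, frame_at p A u.
Proof.
move=> dA; pose m := p (mobius A ii).
pose vec (a : chart F) : plane R :=
  if pselect (chart_dom a m) then 'D_(e_ 1) (fr p A a) ii else 0.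
have vecE a : chart_dom a m -> vec a = 'D_(e_ 1) (fr p A a) ii.
  by rewrite /vec; case: pselect.
have h1 a : ~ chart_dom a m -> vec a = 0 by rewrite /vec; case: pselect.
have h2 a b : chart_dom a m -> chart_dom b m ->
    vec a = 'D_(vec b) (chart_change a (chart_map b m).2) (chart_map b m).1.
  move=> am bm; rewrite !vecE//.
  have n1 := fr_near dA am; have n2 := fr_near dA bm.
  set t := (chart_map b m).2.
  transitivity ('D_(e_ 1) (chart_change a t \o fr p A b) ii).
    apply: derive_near_eq; apply: filterS2 n1 n2 => z [_ _ _ _] [_ _ _ e].
    by rewrite /= /chart_change -e.
  have bp : chart_inv ((chart_map b m).1, t) = m by rewrite chart_point.
  have am' : chart_dom a (chart_inv (fr p A b ii, t)) by rewrite bp.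
  have dc := @change_smooth _ _ F a b t (fr p A b ii) [::] (fr_disk bm) am'.
  by rewrite (derive_comp _ (nbhs_singleton (fr_diff2 dA bm).1) dc).
have h3 a : chart_dom a m -> let n := chart_map a m in
    bilinear_form (metric n.1 n.2) (vec a) (vec a) = 1.
  move=> am; rewrite /= vecE//; exact: (fr_orthonormal dA am 1 1).
exists (UnitTangent h1 h2 h3); split; first by [].
move=> a am.
exact (etrans (vecE a am) (congr1 (fun v => 'D_v (fr p A a) ii) (esym hpoint01))).
Qed.

Lemma frame_unique A (u w : unit_tangent F) : frame_at p A u -> frame_at p A w -> u = w.
Proof.
move=> [bu vu] [bw vw]; apply: ut_ext; first by rewrite bu bw.
by move=> a au; rewrite vu// vw// bw -bu.
Qed.

Lemma frame_vec A (u : unit_tangent F) a : frame_at p A u -> chart_dom a (ut_base u) ->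
  ut_vec u a = 'D_(e_ 1) (fr p A a) ii.
Proof.
move=> [_ vu] au.
exact (etrans (vu a au) (congr1 (fun v => 'D_v (fr p A a) ii) hpoint01)).
Qed.

Lemma frame_base A (u : unit_tangent F) : frame_at p A u -> ut_base u = p (mobius A ii).
Proof. by case. Qed.

(** The vector is pulled back to [w] at [z] by the inverse Jacobian. [A] is the upper triangular
    matrix taking [ii] to [z], preceded by the rotation about [ii] that turns the upward vector into
    the direction of [w]. *)
Lemma frame_of_vector z (a : chart F) v : half_plane z -> chart_dom a (p z) ->
  bilinear_form (metric (chart_map a (p z)).1 (chart_map a (p z)).2) v v = 1 ->
  exists A, [/\ \det A = 1, mobius A ii = z & 'D_(e_ 1) (fr p A a) ii = v].
Proof.
move=> Hz az gv.
set f := fun w => (chart_map a (p w)).1.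
have df : differentiable f z by exact: nbhs_singleton (unif_diff2 U Hz az).1.1.
have Ju : jacobian f z \in unitmx.
  by rewrite unitmxE unitfE gt_eqF//; exact: (unif_det U Hz az).
pose w := v *m invmx (jacobian f z).
have Dw : 'D_w f z = v by rewrite deriveEjacobian// mulmxKV.
have := unif_iso U w Hz az; rewrite -/f Dw gv.
pose x := z 0 0; pose y := z 0 1.
have y0 : 0 < y by exact: Hz.
move=> w1; pose o0 := w 0 0 / y; pose o1 := w 0 1 / y.
have o1' : o0 ^+ 2 + o1 ^+ 2 = 1.
  by rewrite w1 /o0 /o1 -/y; field; rewrite gt_eqF.
have o1b : -1 <= o1 <= 1.
  by rewrite -ler_norml -[leRHS]normr1 -ler_sqr ?nnegrE// !real_normK ?num_real// expr1n -o1' lerDr sqr_ge0.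
(* Half-angle formulas: the rotation with entries [d], [c] turns tangent vectors at [ii] by the
   double angle, whose cosine is [o1] and sine [o0]. The sign of [o0] is given to [c]. *)
pose d := Num.sqrt ((1 + o1) / 2).
pose c := (if 0 <= o0 then 1 else -1) * Num.sqrt ((1 - o1) / 2).
have d2 : d ^+ 2 = (1 + o1) / 2 by rewrite sqr_sqrtr//; lra.
have c2 : c ^+ 2 = (1 - o1) / 2.
  rewrite exprMn sqr_sqrtr; last by lra.
  by case: ifP => _; rewrite ?sqrrN expr1n mul1r.
have cd : 2 * d * c = o0.
  have E : Num.sqrt ((1 + o1) / 2) * Num.sqrt ((1 - o1) / 2) = `|o0| / 2.
    rewrite -sqrtrM; last by lra.
    have -> : (1 + o1) / 2 * ((1 - o1) / 2) = (`|o0| / 2) ^+ 2.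
      by rewrite exprMn real_normK ?num_real//; lra.
    by rewrite sqrtr_sqr ger0_norm// divr_ge0.
  rewrite /c -mulrA [d * _]mulrCA /d E; case: ifPn => [op|].
    by rewrite ger0_norm// mul1r; field.
  by rewrite -ltNge => o; rewrite ltr0_norm//; field.
pose s := Num.sqrt y.
have s0 : 0 < s by rewrite sqrtr_gt0.
have s2 : s ^+ 2 = y by rewrite sqr_sqrtr// ltW.
have sn := lt0r_neq0 s0.
pose A := mx2 s (x / s) 0 s^-1 * mx2 d (- c) c d.
have dcd : d ^+ 2 + c ^+ 2 = 1 by rewrite d2 c2; field.
have dA : \det A = 1.
  rewrite detM2 !det2E !mx2E.
  by transitivity (d ^+ 2 + c ^+ 2); [field|].
have A10 : A 1 0 = c / s by rewrite mul2E !mx2E; field.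
have A11 : A 1 1 = d / s by rewrite mul2E !mx2E; field.
have NE : A 1 1 ^+ 2 + A 1 0 ^+ 2 = y^-1.
  transitivity ((d ^+ 2 + c ^+ 2) / s ^+ 2); last by rewrite dcd s2 mul1r.
  by rewrite A11 A10; field.
have mA : mobius A ii = z.
  have dB : \det (mx2 s (x / s) 0 s^-1) = 1 by rewrite det2E !mx2E; field.
  have dC : \det (mx2 d (- c) c d) = 1.
    by rewrite det2E !mx2E; transitivity (d ^+ 2 + c ^+ 2); [ring|].
  rewrite (mobius_comp dB dC ii_half).
  have -> : mobius (mx2 d (- c) c d) ii = ii.
    apply: plane_eq; rewrite ?mobius0 ?mobius1 /mden !hpointE ?dC !mx2E.
      by rewrite !mulr0 !add0r !mulr1 dcd divr1 expr1n mulr1; ring.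
    by rewrite !mulr0 !add0r !mulr1 dcd divr1.
  apply: plane_eq; rewrite ?mobius0 ?mobius1 /mden !hpointE ?dB !mx2E.
    by rewrite -/x; field.
  by rewrite -/y -s2; field.
exists A; split => //.
have aA : chart_dom a (p (mobius A ii)) by rewrite mA.
rewrite (fr_der_at dA _ ii_half aA) mA -[RHS]Dw; congr ('D_ _ _ _).
have yn := lt0r_neq0 y0.
apply: plane_eq; rewrite mder_ii !hpointE !e_E NE A11 A10.
  transitivity (y * (2 * d * c)); last by rewrite cd /o0; field.
  by rewrite -s2; field.
transitivity (y * (d ^+ 2 - c ^+ 2)); last by rewrite d2 c2 /o1; field.
by rewrite -s2; field.
Qed.

Lemma frame_surj (u : unit_tangent F) : L (ut_base u) ->
  exists2 A, \det A = 1 & frame_at p A u.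
Proof.
have [_ pL _ _] := U; rewrite -pL => -[z Hz zu].
have [a au] := chart_cover F (ut_base u).
have az : chart_dom a (p z) by rewrite zu.
have gv := ut_vec_unit au; rewrite /= -zu in gv.
have [A [dA mA DA]] := frame_of_vector Hz az gv.
exists A => //; have [w fw] := frame_exists dA.
suff -> : u = w by [].
apply: (@ut_ext_chart _ _ _ _ _ a) => //; first by rewrite (frame_base fw) mA.
by rewrite (frame_vec fw) ?DA// (frame_base fw) mA.
Qed.

Lemma vector_surj m (a : chart F) v : L m -> chart_dom a m ->
  bilinear_form (metric (chart_map a m).1 (chart_map a m).2) v v = 1 ->
  exists u : unit_tangent F, ut_base u = m /\ ut_vec u a = v.
Proof.
have [_ pL _ _] := U; rewrite -pL => -[z Hz <-] az gv.
have [A [dA mA DA]] := frame_of_vector Hz az gv.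
have [w fw] := frame_exists dA; exists w; split.
  by rewrite (frame_base fw) mA.
by rewrite (frame_vec fw) ?DA// (frame_base fw) mA.
Qed.

End Frames.

(** * The topology of the unit tangent bundle *)

Section JointContinuity.
Context {R : realType}.

(** Uniform convergence of the slices on a compact ball around [x], combined with continuity of the
    single slice at [t]. *)
Lemma joint_smooth (T : topologicalType) (W : normedModType R)
    (S : set (plane R * T)) (f : plane R -> T -> W) w x t :
  smooth_family S f -> (\forall y \near x, S (y, t)) ->
  {for (x, t), continuous (fun xt : plane R * T => iter_partial w (f^~ xt.2) xt.1)}.
Proof.
move=> [sf uf] nS; apply/cvgrPdist_lt => e e0 /=.
have e2 : 0 < e / 2 by rewrite divr_gt0.
have cx : {for x, continuous (iter_partial w (f^~ t))}.
  exact: (sf t w x (nbhs_singleton nS)).2.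
have /nbhs_ballP[r /= r0 Hr] := nS.
have r2 : 0 < r / 2 by rewrite divr_gt0.
have KS : cball x (r / 2) `<=` [set y | S (y, t)].
  move=> y yr; apply: Hr; rewrite -ball_normE /= distrC.
  by apply: le_lt_trans yr _; rewrite ltr_pdivrMr// mulr_natr mulr2n ltrDl.
have H1 := uf t w _ _ (@compact_cball R x (r / 2)) KS e2.
have /cvgrPdist_lt/(_ _ e2) H2 := cx.
have H3 := nbhs_cball x r2.
exists ([set y | `|iter_partial w (f^~ t) x - iter_partial w (f^~ t) y| < e / 2 /\
         cball x (r / 2) y],
   [set s | forall y, cball x (r / 2) y ->
      `|iter_partial w (f^~ s) y - iter_partial w (f^~ t) y| < e / 2]) => /=.
  by split => //; exact: filterI.
move=> [y s] /= [[h1 h2] h3]; rewrite (splitr e).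
apply: le_lt_trans (ler_distD (iter_partial w (f^~ t) y) _ _) _.
by apply: ltrD => //; rewrite distrC; exact: h3.
Qed.

End JointContinuity.

Section MetricBounds.
Context {R : realType}.

(** By Cayley-Hamilton the difference of the two sides is the squared Euclidean length of [G v]. For
    a positive form this bounds unit vectors in terms of trace and determinant. *)
Lemma bilinear_det (G : 'M[R]_2) (v : plane R) : G^T = G ->
  \det G * (v 0 0 ^+ 2 + v 0 1 ^+ 2) <= \tr G * bilinear_form G v v.
Proof.
move=> GT; have G10 : G 1 0 = G 0 1 by rewrite -[in LHS]GT mxE.
have trE : \tr G = G 0 0 + G 1 1.
  by rewrite /mxtrace big_ord_recl big_ord1; congr (_ + G _ _); apply/val_inj.
rewrite -subr_ge0 bilinearE trE det2E G10.
have -> : (G 0 0 + G 1 1) * (v 0 0 * G 0 0 * v 0 0 + v 0 0 * G 0 1 * v 0 1 +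
   (v 0 1 * G 0 1 * v 0 0 + v 0 1 * G 1 1 * v 0 1)) -
   (G 0 0 * G 1 1 - G 0 1 * G 0 1) * (v 0 0 ^+ 2 + v 0 1 ^+ 2) =
  (G 0 0 * v 0 0 + G 0 1 * v 0 1) ^+ 2 + (G 0 1 * v 0 0 + G 1 1 * v 0 1) ^+ 2 by ring.
by rewrite addr_ge0// sqr_ge0.
Qed.

Lemma pos_def_det (G : 'M[R]_2) : G^T = G ->
  (forall v : plane R, v != 0 -> 0 < bilinear_form G v v) -> 0 < \det G.
Proof.
move=> GT pos; have G10 : G 1 0 = G 0 1 by rewrite -[in LHS]GT mxE.
have g00 : 0 < G 0 0.
  have := pos (e_ 0); rewrite bilinearE !e_E => /(_ _).
  have n0 : e_ 0 != 0 :> plane R.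
    by apply/eqP => /(congr1 (fun v : plane R => v 0 0)); rewrite e_E mxE => /eqP; rewrite oner_eq0.
  by move=> /(_ n0); lra.
have n1 : hpoint (- G 0 1) (G 0 0) != 0.
  apply/eqP => /(congr1 (fun v : plane R => v 0 1)); rewrite hpointE mxE => E.
  by rewrite E ltxx in g00.
have := pos _ n1; rewrite bilinearE !hpointE G10 det2E G10.
have -> : - G 0 1 * G 0 0 * - G 0 1 + - G 0 1 * G 0 1 * G 0 0 +
  (G 0 0 * G 0 1 * - G 0 1 + G 0 0 * G 1 1 * G 0 0) =
  G 0 0 * (G 0 0 * G 1 1 - G 0 1 * G 0 1) by ring.
by rewrite pmulr_rgt0.
Qed.

Lemma eq_cont (T U : topologicalType) (f g : T -> U) x :
  (forall y, f y = g y) -> {for x, continuous g} -> {for x, continuous f}.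
Proof. by move=> /funext ->. Qed.

Lemma near_eq_cont (T U : topologicalType) (f g : T -> U) x :
  (\forall y \near x, f y = g y) -> {for x, continuous g} -> {for x, continuous f}.
Proof.
move=> fg cg A; rewrite (nbhs_singleton fg) => nA; have := cg A nA.
by apply: filterS2 fg => y /= ->.
Qed.

Lemma entry_cont (T : topologicalType) (g : T -> 'M[R]_2) x i j :
  {for x, continuous g} -> {for x, continuous (fun y => g y i j)}.
Proof.
move=> cg; apply: (@continuous_comp _ _ _ g (fun N : 'M[R]_2 => N i j)) => //.
exact: coord_continuous.
Qed.

Lemma ventry_cont (T : topologicalType) (g : T -> plane R) x i :
  {for x, continuous g} -> {for x, continuous (fun y => g y 0 i)}.
Proof.
move=> cg; apply: (@continuous_comp _ _ _ g (fun N : plane R => N 0 i)) => //.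
exact: coord_continuous.
Qed.

Lemma contM (T : topologicalType) (f g : T -> R) x :
  {for x, continuous f} -> {for x, continuous g} -> {for x, continuous (fun y => f y * g y)}.
Proof. by move=> cf cg; exact: (cvgM cf cg). Qed.

Lemma contD (T : topologicalType) (f g : T -> R) x :
  {for x, continuous f} -> {for x, continuous g} -> {for x, continuous (fun y => f y + g y)}.
Proof. by move=> cf cg; exact: (cvgD cf cg). Qed.

Lemma contN (T : topologicalType) (f : T -> R) x :
  {for x, continuous f} -> {for x, continuous (fun y => - f y)}.
Proof. by move=> cf; exact: (cvgN cf). Qed.

Lemma det_cont (T : topologicalType) (g : T -> 'M[R]_2) x :
  {for x, continuous g} -> {for x, continuous (fun y => \det (g y))}.
Proof.
move=> cg; apply: (eq_cont (fun y => det2E (g y))).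
by apply: contD; [|apply: contN]; apply: contM; exact: entry_cont.
Qed.

Lemma bilinear_cont (T : topologicalType) (g : T -> 'M[R]_2) (v w : T -> plane R) x :
  {for x, continuous g} -> {for x, continuous v} -> {for x, continuous w} ->
  {for x, continuous (fun y => bilinear_form (g y) (v y) (w y))}.
Proof.
move=> cg cv cw; apply: (eq_cont (fun y => bilinearE (g y) (v y) (w y))).
by apply: contD; apply: contD; apply: contM; try exact: ventry_cont;
  apply: contM; by [exact: ventry_cont|exact: entry_cont].
Qed.

Lemma hpoint_lin (a b : R) (x y : plane R) :
  hpoint (a * x 0 0 + b * y 0 0) (a * x 0 1 + b * y 0 1) = a *: x + b *: y.
Proof. by apply: plane_eq; rewrite hpointE !mxE. Qed.

Lemma vec_cont (T : topologicalType) (f g : T -> R) x :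
  {for x, continuous f} -> {for x, continuous g} ->
  {for x, continuous (fun y => hpoint (f y) (g y))}.
Proof.
move=> cf cg; apply/cvgrPdist_le => e e0 /=.
have /cvgrPdist_le/(_ e e0) h1 := cf; have /cvgrPdist_le/(_ e e0) h2 := cg.
apply: filterS2 h1 h2 => y h1 h2; apply: norm_mx_le => i j; rewrite ord1.
by move: j; apply: ord2P; rewrite !mxE.
Qed.

End MetricBounds.

Section UnitTangentTopology.
Context {R : realType} (M : metricType R) (F : riemannian_lamination M).

Lemma metric_cont (a : chart F) x (t : transversal a) w : chart_disk a x ->
  {for (x, t), continuous (fun xt : plane R * transversal a =>
     iter_partial w ((@metric _ _ F a)^~ xt.2) xt.1)}.
Proof.
move=> Dx; have H := @joint_smooth R _ _ _ _ w x t (metric_smooth a); apply: H.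
by apply: filterS (near_disk Dx) => y.
Qed.

Lemma metric_det_gt0 (a : chart F) x (t : transversal a) : chart_disk a x ->
  0 < \det (metric x t).
Proof.
move=> Dx; apply: pos_def_det; first exact: metric_sym.
by move=> v; exact: metric_pos.
Qed.

(** Near the given point the determinant stays above half its value and the trace below its absolute
    value plus 1, so [bilinear_det] bounds all unit vectors uniformly. *)
Lemma metric_bound (a : chart F) x (t : transversal a) : chart_disk a x ->
  exists2 C, 0 < C & \forall y \near (x, t), forall v : plane R,
    bilinear_form (metric y.1 y.2) v v = 1 -> `|v| <= C.
Proof.
move=> Dx.
have cg := @metric_cont a x t [::] Dx; rewrite /= in cg.
have cd := det_cont cg.
have ct : {for (x, t), continuous (fun y : plane R * transversal a => \tr (metric y.1 y.2))}.
  have trE (y : plane R * transversal a) : \tr (metric y.1 y.2) =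
      metric y.1 y.2 0 0 + metric y.1 y.2 1 1.
    by rewrite /mxtrace big_ord_recl big_ord1; congr (_ + metric _ _ _ _); apply/val_inj.
  by apply: (eq_cont trE); apply: contD; exact: entry_cont.
have d0 := @metric_det_gt0 a x t Dx.
pose d := \det (metric x t); pose T := `|\tr (metric x t)| + 1.
have T0 : 0 < T by rewrite ltr_wpDl.
have d2 : 0 < d / 2 by rewrite divr_gt0.
exists (Num.sqrt (T / (d / 2))); first by rewrite sqrtr_gt0 divr_gt0.
have /cvgrPdist_lt/(_ _ d2) h1 := cd; have /cvgrPdist_lt/(_ _ ltr01) h2 := ct.
have nD : \forall y \near (x, t), chart_disk a y.1.
  have cf : {for (x, t), continuous (@fst (plane R) (transversal a))} by exact: cvg_fst.
  exact: (cf _ (near_disk Dx)).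
apply: filterS3 h1 h2 nD => -[y s] /= h1 h2 Dy v v1.
have sym := metric_sym s Dy.
have := bilinear_det v sym; rewrite v1 mulr1 => H.
have dl : d / 2 < \det (metric y s) by move: h1; rewrite -/d ltr_norml; lra.
have tT : \tr (metric y s) <= T.
  apply: le_trans (ler_norm _) _.
  have -> : \tr (metric y s) = \tr (metric x t) - (\tr (metric x t) - \tr (metric y s)) by ring.
  by apply: le_trans (ler_normB _ _) _; rewrite lerD2l ltW.
have vv i : `|v 0 i| ^+ 2 <= T / (d / 2).
  rewrite ler_pdivlMr//; apply: le_trans tT; apply: le_trans H.
  rewrite real_normK ?num_real// mulrC.
  have h3 : d / 2 * v 0 i ^+ 2 <= \det (metric y s) * v 0 i ^+ 2.
    by apply: ler_wpM2r; [exact: sqr_ge0|exact: ltW].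
  apply: le_trans h3 _; apply: ler_wpM2l; first exact: ltW (lt_trans d2 dl).
  by move: i; apply: ord2P; rewrite ?lerDl ?lerDr sqr_ge0.
apply: norm_mx_le => k i; rewrite ord1 -[leLHS]normr_id -sqrtr_sqr.
by apply: ler_wsqrtr; exact: vv.
Qed.

Lemma nbhs_chart (u : unit_tangent F) V a : nbhs u V -> chart_dom a (ut_base u) ->
  exists2 P : set (M * plane R), nbhs (ut_base u, ut_vec u a) P &
    forall u', chart_dom a (ut_base u') -> P (ut_base u', ut_vec u' a) -> V u'.
Proof.
rewrite nbhsE => -[B [oB Bu] BV] au.
have [P oP PB] := oB a; exists P.
  by apply: open_nbhs_nbhs; split => //; exact/(PB u au).
by move=> u' au' Pu'; apply: BV; exact/(PB u' au').
Qed.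

Lemma change_der_cont (a b : chart F) m v : chart_dom a m -> chart_dom b m ->
  {for (m, v), continuous (fun nv : M * plane R =>
    'D_(nv.2) (chart_change a (chart_map b nv.1).2) (chart_map b nv.1).1)}.
Proof.
move=> am bm.
pose D i (n : M) := 'D_(e_ i) (chart_change a (chart_map b n).2) (chart_map b n).1.
have cD i : {for m, continuous (D i)}.
  apply: (@continuous_comp _ _ _ (@chart_map _ _ F b) (fun xt : plane R * transversal b =>
    iter_partial [:: i] ((fun x (t : transversal b) => chart_change a t x)^~ xt.2) xt.1)).
    exact: chart_map_cvg.
  rewrite [chart_map b m]surjective_pairing.
  have H := @joint_smooth R _ _ _ _ [:: i] (chart_map b m).1 (chart_map b m).2
    (@chart_change_smooth _ _ F a b).
  apply: H; apply: open_nbhs_nbhs; split; first exact: change_slice_open.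
  by split; [exact: chart_map_disk|rewrite chart_point].
have cf : {for (m, v), continuous (@fst M (plane R))} by exact: cvg_fst.
have cs : {for (m, v), continuous (@snd M (plane R))} by exact: cvg_snd.
have cDf i : {for (m, v), continuous (fun nv : M * plane R => D i nv.1)}.
  by apply: (@continuous_comp _ _ _ fst (D i)).
apply: (@near_eq_cont _ _ _ (fun nv : M * plane R =>
  hpoint (nv.2 0 0 * D 0 nv.1 0 0 + nv.2 0 1 * D 1 nv.1 0 0)
         (nv.2 0 0 * D 0 nv.1 0 1 + nv.2 0 1 * D 1 nv.1 0 1))).
  have n1 : \forall nv \near (m, v), chart_dom a nv.1 := cf _ (near_dom am).
  have n2 : \forall nv \near (m, v), chart_dom b nv.1 := cf _ (near_dom bm).
  apply: filterS2 n1 n2 => -[n u] /= an bn.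
  have Db : chart_disk b (chart_map b n).1 by exact: chart_map_disk.
  have an' : chart_dom a (chart_inv ((chart_map b n).1, (chart_map b n).2)) by rewrite chart_point.
  have dc := @change_smooth _ _ F a b _ _ [::] Db an'.
  exact: (etrans (derive_plane u dc) (esym (hpoint_lin _ _ _ _))).
by apply: vec_cont; apply: contD; apply: contM; exact: ventry_cont.
Qed.

(** [ut_open] imposes a condition in every chart. A condition in one chart suffices because the
    components in any other chart depend continuously on the base point and the vector. *)
Lemma chart_nbhs (u : unit_tangent F) (P : set (M * plane R)) a :
  chart_dom a (ut_base u) -> nbhs (ut_base u, ut_vec u a) P ->
  nbhs u [set u' : unit_tangent F | chart_dom a (ut_base u') /\ P (ut_base u', ut_vec u' a)].
Proof.
move=> au; rewrite nbhsE => -[Q [oQ Qu] QP].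
pose B : set (unit_tangent F) :=
  [set u' : unit_tangent F | chart_dom a (ut_base u') /\ Q (ut_base u', ut_vec u' a)].
have oB : open B.
  move=> b.
  pose S := [set nv : M * plane R | [/\ chart_dom a nv.1, chart_dom b nv.1 &
    Q (nv.1, 'D_(nv.2) (chart_change a (chart_map b nv.1).2) (chart_map b nv.1).1)]].
  exists S; last first.
    move=> w bw; split => [[aw Qw]|[aw _ Qw]].
      by split => //=; rewrite -(ut_vec_change aw bw).
    by split => //; rewrite (ut_vec_change aw bw).
  rewrite openE => -[m v] [/= am bm Qm].
  have cf : {for (m, v), continuous (@fst M (plane R))} by exact: cvg_fst.
  have n1 : \forall nv \near (m, v), chart_dom a nv.1 := cf _ (near_dom am).
  have n2 : \forall nv \near (m, v), chart_dom b nv.1 := cf _ (near_dom bm).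
  have nQ : nbhs (m, 'D_v (chart_change a (chart_map b m).2) (chart_map b m).1) Q.
    exact: open_nbhs_nbhs.
  have n3 : \forall nv \near (m, v), Q (nv.1,
      'D_(nv.2) (chart_change a (chart_map b nv.1).2) (chart_map b nv.1).1).
    exact: (cvg_pair cf (change_der_cont am bm (v := v))) _ nQ.
  suff : \forall nv \near (m, v), S nv by [].
  by apply: filterS3 n1 n2 n3 => nv h1 h2 h3; split.
rewrite nbhsE; exists B; first by split.
by move=> u' [au' Qu']; split => //; exact: QP.
Qed.

Lemma ut_base_cont : continuous (@ut_base _ _ F).
Proof.
move=> u V nV; have [a au] := chart_cover F (ut_base u).
have cf : {for (ut_base u, ut_vec u a), continuous (@fst M (plane R))} by exact: cvg_fst.
by apply: filterS (chart_nbhs au (cf _ nV)) => u' [].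
Qed.

(** The separation property by which continuity of translations yields their uniqueness. *)
Lemma ut_separated (u w : unit_tangent F) : (forall V, nbhs u V -> V w) -> u = w.
Proof.
move=> H; have [a au] := chart_cover F (ut_base u).
have cf : {for (ut_base u, ut_vec u a), continuous (@fst M (plane R))} by exact: cvg_fst.
have cs : {for (ut_base u, ut_vec u a), continuous (@snd M (plane R))} by exact: cvg_snd.
apply: (@ut_ext_chart _ _ _ _ _ a) => //.
  apply: (@metric_hausdorff _ M) => A B nA nB; exists (ut_base w); split.
    by have := H _ (chart_nbhs au (cf _ nA)) => -[].
  exact: nbhs_singleton nB.
apply: (@norm_hausdorff _ (plane R)) => A B nA nB; exists (ut_vec w a); split.
  by have := H _ (chart_nbhs au (cs _ nA)) => -[].
exact: nbhs_singleton nB.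
Qed.

Hypothesis hyp : hyperbolic_leaves F.

(** Along an ultrafilter the base points converge to some [m], since [M] is compact, and the
    components in a chart around [m] converge, since unit vectors are bounded there. The limit has
    norm 1 by continuity of the metric, and a uniformization of the leaf of [m] realizes it as a
    unit tangent vector. *)
Lemma ut_compact : compact [set: unit_tangent F].
Proof.
rewrite compact_ultra /= => FF UF _.
have PF : ProperFilter FF by exact: ultra_proper.
have ultra_cvg (T : topologicalType) (f : unit_tangent F -> T) (K : set T) :
    compact K -> FF (f @^-1` K) -> exists2 q, K q & f @ FF `=>` nbhs q.
  rewrite compact_ultra /= => cK FK.
  have UI : UltraFilter (f @ FF).
    split; first exact: fmap_proper_filter.
    move=> G PG sG; apply/seteqP; split => A; last exact: sG.
    move=> GA; have [//|Fc] := in_ultra_setVsetC (f @^-1` A) UF.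
    exfalso; have GC : G (~` A) by apply: sG.
    have : G (A `&` ~` A) by exact: filterI.
    by rewrite setICr => /(@filter_not_empty _ G).
  by have [q [Kq fq]] := cK _ UI FK; exists q.
have [m _ bm] : exists2 q, [set: M] q & (@ut_base _ _ F) @ FF `=>` nbhs q.
  by apply: ultra_cvg; [exact: (lam_compact F)|exact: filterT].
have [a am] := chart_cover F m.
have [C C0 HC] := metric_bound (chart_map a m).2 (chart_map_disk am).
have cm : {for m, continuous (@chart_map _ _ F a)} by exact: chart_map_cvg.
rewrite -surjective_pairing in HC.
have nC : FF [set u : unit_tangent F | chart_dom a (ut_base u) /\ `|ut_vec u a| <= C].
  have h1 : \forall u \near FF, chart_dom a (ut_base u) := bm _ (near_dom am).
  have h2 := bm _ (cm _ HC).
  apply: filterS2 h1 h2 => u au Cu; split => //; apply: Cu; exact: ut_vec_unit.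
have [v vC bv] : exists2 q, cball 0 C q & (fun u : unit_tangent F => ut_vec u a) @ FF `=>` nbhs q.
  apply: ultra_cvg; first exact: compact_cball.
  by apply: filterS nC => u [_]; rewrite /cball /= subr0.
have cg := @metric_cont a (chart_map a m).1 (chart_map a m).2 [::] (chart_map_disk am).
rewrite /= -surjective_pairing in cg.
have cgm : {for m, continuous (fun n => metric (chart_map a n).1 (chart_map a n).2)}.
  by apply: (@continuous_comp _ _ _ (@chart_map _ _ F a)
    (fun xt : plane R * transversal a => metric xt.1 xt.2)).
have cf : {for (m, v), continuous (@fst M (plane R))} by exact: cvg_fst.
have cs : {for (m, v), continuous (@snd M (plane R))} by exact: cvg_snd.
have cb : {for (m, v), continuous (fun nv : M * plane R =>
    bilinear_form (metric (chart_map a nv.1).1 (chart_map a nv.1).2) nv.2 nv.2)}.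
  apply: bilinear_cont => //.
  by apply: (@continuous_comp _ _ _ fst (fun n => metric (chart_map a n).1 (chart_map a n).2)).
have bpair : (fun u : unit_tangent F => (ut_base u, ut_vec u a)) @ FF `=>` nbhs (m, v).
  exact: (cvg_pair bm bv).
have gv : bilinear_form (metric (chart_map a m).1 (chart_map a m).2) v v = 1.
  apply: (@norm_hausdorff _ R^o) => A B nA nB; exists 1; split; last exact: nbhs_singleton nB.
  have h1 : \forall u \near FF, A (bilinear_form (metric (chart_map a (ut_base u)).1
      (chart_map a (ut_base u)).2) (ut_vec u a) (ut_vec u a)) := bpair _ (cb _ nA).
  have [u [/= Au [au _]]] := filter_ex (filterI h1 nC).
  by have := ut_vec_unit au; rewrite /= => <-.
have [G [p U]] := hyp m.
have [u [um uv]] := vector_surj U (same_leaf_refl F m) am gv.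
exists u; split => // V nV.
have au : chart_dom a (ut_base u) by rewrite um.
have [P nP HP] := nbhs_chart nV au.
rewrite um uv in nP.
have h1 : \forall u \near FF, P (ut_base u, ut_vec u a) := bpair _ nP.
by apply: filterS2 h1 nC => w /= Pw [aw _]; exact: HP.
Qed.

End UnitTangentTopology.

(** * Continuous dependence of the geodesic flow *)

Section Curves.
Context {R : realType}.

Lemma is_derive_mx m n (f : R -> 'M[R]_(m.+1, n.+1)) (d : 'M[R]_(m.+1, n.+1)) (t : R) :
  (forall i j, is_derive t 1 (fun s => f s i j) (d i j)) -> is_derive t 1 f d.
Proof.
move=> H; have df : derivable f t 1.
  apply/derivable1_diffP; apply: differentiable_mx => i j.
  by apply/derivable1_diffP; have [] := H i j.
apply: DeriveDef => //; apply/matrixP => i j.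
by rewrite -(derive_entry i j df); have [_ ->] := H i j.
Qed.

Lemma is_derive_entry m n (f : R -> 'M[R]_(m.+1, n.+1)) (d : 'M[R]_(m.+1, n.+1)) (t : R) i j :
  is_derive t 1 f d -> is_derive t 1 (fun s => f s i j) (d i j).
Proof.
move=> [df <-]; apply: DeriveDef; last exact: derive_entry.
apply/derivable1_diffP; apply: differentiable_entry.
exact/derivable1_diffP.
Qed.

Lemma mvt_mx m n (f d : R -> 'M[R]_(m.+1, n.+1)) (s t C : R) : s <= t ->
  (forall r : R, s <= r <= t -> is_derive r 1 f (d r)) ->
  (forall r : R, s <= r <= t -> `|d r| <= C) ->
  `|f t - f s| <= C * (t - s).
Proof.
move=> st df dC.
have C0 : 0 <= C by apply: le_trans (dC s _); rewrite ?lexx.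
apply: norm_mx_le => i j; rewrite !mxE.
have dfi (r : R) : s <= r <= t -> is_derive r 1 (fun s => f s i j) (d r i j).
  by move=> rst; exact: is_derive_entry (df r rst).
have [r rst ->] : exists2 r, r \in `[s, t]%R & f t i j - f s i j = d r i j * (t - s).
  apply: (@MVT_segment _ (fun s => f s i j) (fun s => d s i j)) => //.
    by move=> x; rewrite in_itv /= => /andP[/ltW sx /ltW xt]; apply: dfi; rewrite sx xt.
  apply: derivable_within_continuous => x; rewrite in_itv /= => xst.
  by have [] := dfi x xst.
rewrite normrM (ger0_norm (x := t - s)) ?subr_ge0//.
apply: ler_wpM2r; first by rewrite subr_ge0.
by apply: le_trans (coord_le _ _ _) _; apply: dC; move: rst; rewrite in_itv.
Qed.

(** Induction on a real interval: the supremum of the times up to which [Q] holds is reached by the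
    first hypothesis and, if less than [T], exceeded by the second. *)
Lemma real_ind (Q : R -> Prop) (T : R) :
  (forall s : R, 0 <= s <= T -> (forall r : R, 0 <= r < s -> Q r) -> Q s) ->
  (forall s : R, 0 <= s < T -> (forall r : R, 0 <= r <= s -> Q r) ->
     exists2 d, 0 < d & forall r : R, s < r < s + d -> r <= T -> Q r) ->
  forall s : R, 0 <= s <= T -> Q s.
Proof.
move=> Hc Ho s0 /andP[s00 s0T].
have T0 := le_trans s00 s0T.
pose B : set R := [set s | 0 <= s <= T /\ forall r : R, 0 <= r <= s -> Q r].
have B0 : B 0.
  split; first by rewrite lexx.
  move=> r /andP[r0 r0']; have -> : r = 0 by apply/eqP; rewrite eq_le r0 r0'.
  apply: Hc; first by rewrite lexx.
  by move=> q /andP[q0 q0']; have := lt_le_trans q0' q0; rewrite ltxx.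
have sB : has_sup B by split; [exists 0|exists T => x [/andP[]]].
pose s := sup B.
have sT : s <= T by apply: ge_sup; [exists 0|move=> x [/andP[]]].
have s0' : 0 <= s by exact: ub_le_sup sB.2 _ B0.
have lts (r : R) : 0 <= r < s -> Q r.
  move=> /andP[r0 rs]; have sr : 0 < s - r by rewrite subr_gt0.
  have [x Bx rx] := sup_adherent sr sB.
  by apply: Bx.2; rewrite r0 ltW//; move: rx; rewrite -/s subKr.
have Qs : Q s by apply: Hc => //; rewrite s0' sT.
have Bs : B s.
  split; first by rewrite s0' sT.
  move=> r /andP[r0]; rewrite le_eqVlt => /orP[/eqP->//|rs].
  by apply: lts; rewrite r0.
have [sT'|] := ltP s T; last first.
  by move=> Ts; apply: Bs.2; rewrite s00; apply: le_trans Ts.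
have [d d0 Hd] : exists2 d, 0 < d & forall r : R, s < r < s + d -> r <= T -> Q r.
  by apply: Ho; [rewrite s0' sT'|exact: Bs.2].
pose x := Num.min T (s + d / 2).
have sx : s < x by rewrite /x lt_min sT' ltrDl divr_gt0.
have xd : x < s + d by rewrite /x gt_min ltrD2l ltr_pdivrMr// mulr_natr mulr2n ltrDl d0 orbT.
have xT : x <= T by rewrite /x ge_min lexx.
have : B x.
  split; first by rewrite xT (le_trans s0') // ltW.
  move=> r /andP[r0 rx]; have [rs|sr] := leP r s; first by apply: Bs.2; rewrite r0.
  by apply: Hd; [rewrite sr (le_lt_trans rx)|exact: le_trans xT].
by move/(ub_le_sup sB.2); rewrite -/s leNgt sx.
Qed.

End Curves.

(** * The vector field of the frame equation *)

Section FrameField.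
Context {R : realType}.

(* Derivative of the metric in the direction [c], given its two partial
   derivatives [H]. *)
Definition dgf (H : 'M[R]_2 * 'M[R]_2) (c : plane R) : 'M[R]_2 :=
  c 0 0 *: H.1 + c 0 1 *: H.2.

(** The right-hand sides found in [frame_ode], with the derivatives of the metric as a parameter
    [H]: polynomials in [H], [u] and [v], hence bounded and Lipschitz on balls. *)
Definition field1 (H : 'M[R]_2 * 'M[R]_2) (u v : plane R) : plane R :=
  - (bilinear_form (dgf H v) u u / 2) *: u - (bilinear_form (dgf H u) v v / 2) *: v.
Definition field2 (H : 'M[R]_2 * 'M[R]_2) (u v : plane R) : plane R :=
  (bilinear_form (dgf H u) v v / 2 - bilinear_form (dgf H v) v u) *: u
  - (bilinear_form (dgf H v) v v / 2) *: v.

Lemma bl_ext (V : normedModType R) (S : set V) (f g : V -> R) : (forall z, f z = g z) ->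
  bounded_lipschitz S g -> bounded_lipschitz S f.
Proof. by move=> /funext ->. Qed.

Let V := ((plane R * plane R) * ('M[R]_2 * 'M[R]_2))%type.

Lemma norm_fst (W W' : normedModType R) (z : W * W') : `|z.1| <= `|z|.
Proof. by rewrite [leRHS]prod_normE le_max lexx. Qed.
Lemma norm_snd (W W' : normedModType R) (z : W * W') : `|z.2| <= `|z|.
Proof. by rewrite [leRHS]prod_normE le_max lexx orbT. Qed.

Lemma bl_coord m n (W : normedModType R) (C : R) (h : W -> 'M[R]_(m.+1, n.+1)) i j : 0 <= C ->
  (forall z, `|h z| <= `|z|) -> (forall z z', h (z - z') = h z - h z') ->
  bounded_lipschitz [set z | `|z| <= C] (fun z => h z i j).
Proof.
move=> C0 h1 hB; exists (C + 1); first by rewrite addr_ge0.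
split=> [z zC|z z' _ _].
  by apply: le_trans (coord_le _ _ _) _; apply: le_trans (h1 _) _; rewrite (le_trans zC) ?lerDl.
have -> : h z i j - h z' i j = (h z - h z') i j by rewrite !mxE.
rewrite -hB; apply: le_trans (coord_le _ _ _) _; apply: le_trans (h1 _) _.
by rewrite mulrDl mul1r lerDr mulr_ge0.
Qed.

Lemma bl_bilinear_dgf (W : normedModType R) (S : set W) (H : W -> 'M[R]_2 * 'M[R]_2)
    (a b c : W -> plane R) :
  (forall i j, bounded_lipschitz S (fun z => (H z).1 i j)) ->
  (forall i j, bounded_lipschitz S (fun z => (H z).2 i j)) ->
  (forall j, bounded_lipschitz S (fun z => a z 0 j)) ->
  (forall j, bounded_lipschitz S (fun z => b z 0 j)) ->
  (forall j, bounded_lipschitz S (fun z => c z 0 j)) ->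
  bounded_lipschitz S (fun z => bilinear_form (dgf (H z) (a z)) (b z) (c z)).
Proof.
move=> H1 H2 Ha Hb Hc.
have E i j : bounded_lipschitz S (fun z => dgf (H z) (a z) i j).
  apply: (@bl_ext _ _ _ (fun z => a z 0 0 * (H z).1 i j + a z 0 1 * (H z).2 i j)).
    by move=> z; rewrite !mxE.
  by apply: blD; apply: blM.
apply: (bl_ext (fun z => bilinearE _ _ _)).
by apply: blD; apply: blD; apply: blM => //; apply: blM.
Qed.

Lemma bl_comb (W : normedModType R) (S : set W) (f g : W -> R) (a b : W -> plane R) j :
  bounded_lipschitz S f -> bounded_lipschitz S g ->
  (forall j, bounded_lipschitz S (fun z => a z 0 j)) ->
  (forall j, bounded_lipschitz S (fun z => b z 0 j)) ->
  bounded_lipschitz S (fun z => (f z *: a z - g z *: b z) 0 j).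
Proof.
move=> Hf Hg Ha Hb.
apply: (@bl_ext _ _ _ (fun z => f z * a z 0 j + - (g z * b z 0 j))).
  by move=> z; rewrite !mxE.
by apply: blD; [|apply: blN]; apply: blM.
Qed.

Lemma field_bl (C : R) : 0 <= C -> exists2 L, 0 <= L &
  (forall z : V, `|z| <= C -> `|field1 z.2 z.1.1 z.1.2| <= L /\ `|field2 z.2 z.1.1 z.1.2| <= L) /\
  (forall z z' : V, `|z| <= C -> `|z'| <= C ->
     `|field1 z.2 z.1.1 z.1.2 - field1 z'.2 z'.1.1 z'.1.2| <= L * `|z - z'| /\
     `|field2 z.2 z.1.1 z.1.2 - field2 z'.2 z'.1.1 z'.1.2| <= L * `|z - z'|).
Proof.
move=> C0; pose S : set V := [set z | `|z| <= C].
have H1 i j : bounded_lipschitz S (fun z => z.2.1 i j).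
  apply: (@bl_coord 1 1 V C (fun z => z.2.1)) => // z.
  exact: le_trans (norm_fst _) (norm_snd _).
have H2 i j : bounded_lipschitz S (fun z => z.2.2 i j).
  apply: (@bl_coord 1 1 V C (fun z => z.2.2)) => // z.
  exact: le_trans (norm_snd _) (norm_snd _).
have Ha j : bounded_lipschitz S (fun z => z.1.1 0 j).
  apply: (@bl_coord 0 1 V C (fun z => z.1.1)) => // z.
  exact: le_trans (norm_fst _) (norm_fst _).
have Hb j : bounded_lipschitz S (fun z => z.1.2 0 j).
  apply: (@bl_coord 0 1 V C (fun z => z.1.2)) => // z.
  exact: le_trans (norm_snd _) (norm_fst _).
have D (a b c : V -> plane R) : (forall j, bounded_lipschitz S (fun z => a z 0 j)) ->
    (forall j, bounded_lipschitz S (fun z => b z 0 j)) ->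
    (forall j, bounded_lipschitz S (fun z => c z 0 j)) ->
    bounded_lipschitz S (fun z => bilinear_form (dgf z.2 (a z)) (b z) (c z)).
  by move=> aS bS cS; apply: bl_bilinear_dgf.
have F1 j : bounded_lipschitz S (fun z => field1 z.2 z.1.1 z.1.2 0 j).
  apply: bl_comb => //; last by apply: blM; [exact: D|exact: bl_cst].
  by apply: blN; apply: blM; [exact: D|exact: bl_cst].
have F2 j : bounded_lipschitz S (fun z => field2 z.2 z.1.1 z.1.2 0 j).
  apply: bl_comb => //; last by apply: blM; [exact: D|exact: bl_cst].
  by apply: blD; [apply: blM; [exact: D|exact: bl_cst]|apply: blN; exact: D].
have U (f : V -> plane R) : (forall j, bounded_lipschitz S (fun z => f z 0 j)) ->
    exists2 L, 0 <= L & (forall z, S z -> `|f z| <= L) /\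
      forall z z', S z -> S z' -> `|f z - f z'| <= L * `|z - z'|.
  move=> Hf; have [L0 L00 [A0 B0]] := Hf 0; have [L1 L10 [A1 B1]] := Hf 1.
  exists (L0 + L1); first exact: addr_ge0.
  split=> [z Sz|z z' Sz Sz']; apply: norm_mx_le => i j; rewrite ord1; move: j; apply: ord2P.
  - by apply: le_trans (A0 _ Sz) _; rewrite lerDl.
  - by apply: le_trans (A1 _ Sz) _; rewrite lerDr.
  - have -> : (f z - f z') 0 0 = f z 0 0 - f z' 0 0 by rewrite !mxE.
    by apply: le_trans (B0 _ _ Sz Sz') _; apply: ler_wpM2r => //; rewrite lerDl.
  - have -> : (f z - f z') 0 1 = f z 0 1 - f z' 0 1 by rewrite !mxE.
    by apply: le_trans (B1 _ _ Sz Sz') _; apply: ler_wpM2r => //; rewrite lerDr.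
have [L1 L10 [A1 B1]] := U _ F1; have [L2 L20 [A2 B2]] := U _ F2.
exists (L1 + L2); first exact: addr_ge0.
split=> [z Sz|z z' Sz Sz']; split.
- by apply: le_trans (A1 _ Sz) _; rewrite lerDl.
- by apply: le_trans (A2 _ Sz) _; rewrite lerDr.
- by apply: le_trans (B1 _ _ Sz Sz') _; apply: ler_wpM2r => //; rewrite lerDl.
- by apply: le_trans (B2 _ _ Sz Sz') _; apply: ler_wpM2r => //; rewrite lerDr.
Qed.

End FrameField.

(** A base point and two frame vectors stacked into one matrix, so that [gronwall_mx] treats the
    whole state at once. *)
Definition mk3 {R : realType} (c u v : plane R) : 'M[R]_(3, 2) :=
  \matrix_(i < 3, j < 2) (nth 0 [:: c; u; v] i) 0 j.

Section MatrixOfThreeRows.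
Context {R : realType}.

Lemma field1E (H : 'M[R]_2 * 'M[R]_2) (D : plane R -> 'M[R]_2) (u v : plane R) :
  (forall c, D c = dgf H c) ->
  - (bilinear_form (D v) u u / 2) *: u - (bilinear_form (D u) v v / 2) *: v = field1 H u v.
Proof. by move=> HD; rewrite !HD. Qed.

Lemma field2E (H : 'M[R]_2 * 'M[R]_2) (D : plane R -> 'M[R]_2) (u v : plane R) :
  (forall c, D c = dgf H c) ->
  (bilinear_form (D u) v v / 2 - bilinear_form (D v) v u) *: u
  - (bilinear_form (D v) v v / 2) *: v = field2 H u v.
Proof. by move=> HD; rewrite !HD. Qed.

Lemma near_is_derive (W : normedModType R) (f g : R -> W) (t : R) d :
  (\forall s \near t, f s = g s) -> is_derive t 1 g d -> is_derive t 1 f d.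
Proof.
by move=> fg; apply: near_eq_is_derive; apply: filterS fg => s ->.
Qed.

Lemma shift_is_derive (W : normedModType R) (f : R -> W) (c t : R) d :
  is_derive (t - c) 1 f d -> is_derive t 1 (fun s => f (s - c)) d.
Proof.
move=> [df <-].
have E : (fun h : R => h^-1 *: (f (h *: 1 + t - c) - f (t - c))) =
         (fun h : R => h^-1 *: ((f \o shift (t - c)) (h *: 1) - f (t - c))).
  by apply/funext => h /=; rewrite addrA.
apply: DeriveDef; first by rewrite /derivable /= E.
by rewrite /derive /= E.
Qed.

Lemma ord3P (P : 'I_3 -> Prop) : P 0 -> P 1 -> P 2%R -> forall i, P i.
Proof.
move=> P0 P1 P2 [[|[|[|//]]] Hi].
- by rewrite (_ : Ordinal Hi = 0)//; exact/val_inj.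
- by rewrite (_ : Ordinal Hi = 1)//; exact/val_inj.
- by rewrite (_ : Ordinal Hi = 2%R)//; exact/val_inj.
Qed.

Lemma mk3_is_derive (c u v : R -> plane R) (c' u' v' : plane R) (t : R) :
  is_derive t 1 c c' -> is_derive t 1 u u' -> is_derive t 1 v v' ->
  is_derive t 1 (fun s => mk3 (c s) (u s) (v s)) (mk3 c' u' v').
Proof.
move=> dc du dv; apply: is_derive_mx => i j.
have E (f : R -> plane R) (d : plane R) (k : 'I_3) : is_derive t 1 f d ->
    (forall s, mk3 (c s) (u s) (v s) k j = f s 0 j) -> mk3 c' u' v' k j = d 0 j ->
    is_derive t 1 (fun s => mk3 (c s) (u s) (v s) k j) (mk3 c' u' v' k j).
  move=> df /funext -> ->; exact: is_derive_entry.
by move: i; apply: ord3P; [apply: (E _ _ _ dc)|apply: (E _ _ _ du)|apply: (E _ _ _ dv)];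
  move=> *; rewrite mxE.
Qed.

Lemma mk3_le (c u v c' u' v' : plane R) e : `|c - c'| <= e -> `|u - u'| <= e ->
  `|v - v'| <= e -> `|mk3 c u v - mk3 c' u' v'| <= e.
Proof.
move=> hc hu hv; apply: norm_mx_le => i j.
have E (x y : plane R) : `|x - y| <= e -> `|x 0 j - y 0 j| <= e.
  by move=> xy; have := le_trans (coord_le (x - y) 0 j) xy; rewrite !mxE.
by move: i; apply: ord3P; rewrite !mxE /=; exact: E.
Qed.

Lemma le_mk3 (c u v c' u' v' : plane R) :
  [/\ `|c - c'| <= `|mk3 c u v - mk3 c' u' v'|,
      `|u - u'| <= `|mk3 c u v - mk3 c' u' v'| &
      `|v - v'| <= `|mk3 c u v - mk3 c' u' v'|].
Proof.
set N := mk3 c u v - _.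
have E (k : 'I_3) (x y : plane R) : (forall j, N k j = x 0 j - y 0 j) -> `|x - y| <= `|N|.
  by move=> H; apply: norm_mx_le => i j; rewrite ord1 !mxE -H; exact: coord_le.
by split; [apply: (E 0)|apply: (E 1)|apply: (E 2%R)] => j; rewrite !mxE.
Qed.

Lemma gd_mobius (p : R) z : 0 < p -> mobius (gd p) z = p ^+ 2 *: z.
Proof.
move=> p0; have pn := lt0r_neq0 p0.
rewrite /mobius det_gd// !mx2E; apply: plane_eq; rewrite hpointE mxE; by field.
Qed.

Definition gtm (t : R) : 'M[R]_2 := gd (expR (t / 2)).

Lemma det_gtm (t : R) : \det (gtm t) = 1.
Proof. by rewrite det_gd// expR_gt0. Qed.

Lemma gtmD (s t : R) : gtm (s + t) = gtm s * gtm t.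
Proof. by rewrite /gtm gdM -expRD mulrDl. Qed.

Lemma gtm0 : gtm 0 = 1.
Proof. by rewrite /gtm mul0r expR0 gd1. Qed.

Lemma gtm_mobius (t : R) z : mobius (gtm t) z = expR t *: z.
Proof.
rewrite gd_mobius ?expR_gt0// -expRM_natl; congr (expR _ *: _).
by rewrite -mulr_natl; field.
Qed.

End MatrixOfThreeRows.

Section GeodesicFrames.
Context {R : realType} (M : metricType R) (F : riemannian_lamination M).
Variables (G : set 'M[R]_2) (p : plane R -> M) (L : set M).
Hypothesis U : uniformization F G p L.

Lemma scale_half (k : R) z : 0 < k -> half_plane z -> half_plane (k *: z).
Proof. by move=> k0; rewrite !half_planeE mxE; exact: mulr_gt0. Qed.

Lemma fr_gt A (a : chart F) t z : \det A = 1 -> half_plane z ->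
  fr p (A * gtm t) a z = fr p A a (expR t *: z).
Proof. by move=> dA Hz; rewrite /fr (mobius_comp dA (det_gtm _) Hz) gtm_mobius. Qed.

Lemma fr_differentiable A (a : chart F) z : \det A = 1 -> half_plane z ->
  chart_dom a (p (mobius A z)) -> differentiable (fr p A a) z.
Proof.
move=> dA Hz az; rewrite fr_comp; apply: differentiable_comp.
  exact: (mobius_der 0 dA Hz).1.
exact: nbhs_singleton (unif_diff2 U (mobius_half dA Hz) az).1.1.
Qed.

Lemma fr_gt_der A (a : chart F) t z v : \det A = 1 -> half_plane z ->
  chart_dom a (p (mobius A (expR t *: z))) ->
  'D_v (fr p (A * gtm t) a) z = expR t *: 'D_v (fr p A a) (expR t *: z).
Proof.
move=> dA Hz az; have k0 := expR_gt0 t; set k := expR t in az k0 *.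
have dS x : differentiable (fun y : plane R => k *: y) x by exact: differentiableZ.
have Dk : 'D_v (fun y : plane R => k *: y) z = k *: v.
  by rewrite deriveZ ?derive_id//; exact: derivable_id.
have df := fr_differentiable dA (scale_half k0 Hz) az.
rewrite (@derive_near_eq _ _ _ (fr p A a \o (fun y : plane R => k *: y))); last first.
  by apply: filterS (near_half Hz) => y Hy /=; rewrite fr_gt.
rewrite (derive_comp _ (dS z) df) Dk deriveZv//.
Qed.

Lemma ray_is_derive (h : plane R -> plane R) : differentiable h ii ->
  is_derive (0 : R) 1 (fun s => h (expR s *: ii)) ('D_(e_ 1) h ii).
Proof.
move=> dh.
have dr : is_derive (0 : R) 1 (fun s : R => expR s *: (ii : plane R)) (ii : plane R).
  apply: is_derive_mx => i j.
  have H : is_derive (0 : R) 1 (fun s : R => expR s * (ii : plane R) i j) (ii i j).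
    have [de De] := is_derive_expR (0 : R).
    have dc : derivable (fun=> (ii : plane R) i j) (0 : R) 1 by exact: derivable_cst.
    apply: DeriveDef; first exact: (derivableM de dc).
    have -> := deriveM de dc.
    by rewrite De derive_cst expR0 scaler0 add0r [_ *: 1]mulr1.
  have -> // : (fun s : R => (expR s *: (ii : plane R)) i j) = (fun s => expR s * ii i j).
  by apply/funext => s; rewrite mxE.
have e1 : expR 0 *: (ii : plane R) = ii by rewrite expR0 scale1r.
have dr' : differentiable (fun s : R => expR s *: (ii : plane R)) (0 : R).
  by apply/derivable1_diffP; have [] := dr.
have dh' : differentiable h (expR 0 *: (ii : plane R)) by rewrite e1.
apply: DeriveDef.
  by apply/derivable1_diffP; exact: (differentiable_comp dr' dh').
have -> := derive_comp (1 : R) dr' dh'.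
by have [_ ->] := dr; rewrite e1 -hpoint01.
Qed.

Definition st (A : 'M[R]_2) (a : chart F) (t : R) : 'M[R]_(3, 2) :=
  let h := fr p (A * gtm t) a in mk3 (h ii) ('D_(e_ 0) h ii) ('D_(e_ 1) h ii).

Definition gder (a : chart F) (t : transversal a) (x : plane R) : 'M[R]_2 * 'M[R]_2 :=
  ('D_(e_ 0) ((@metric _ _ F a)^~ t) x, 'D_(e_ 1) ((@metric _ _ F a)^~ t) x).

Definition vfield (H : 'M[R]_2 * 'M[R]_2) (u v : plane R) : 'M[R]_(3, 2) :=
  mk3 v (field1 H u v) (field2 H u v).

Lemma metric_differentiable (a : chart F) x (t : transversal a) : chart_disk a x ->
  differentiable ((@metric _ _ F a)^~ t) x.
Proof.
move=> Dx; have [sf _] := @metric_smooth _ _ F a.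
have E : [set x | (chart_disk a `*` [set: transversal a]) (x, t)] = chart_disk a.
  by apply/seteqP; split => y //= [].
have sD := sf t; rewrite E in sD.
exact: (@smooth_on_differentiable R 1 1 _ _ (@disk_open R _ _) sD [::] x Dx).
Qed.

(** The frame vectors at time [s] are [expR s] times partial derivatives of [h] at [expR s *: ii].
    Differentiating the factor [expR s] produces the summands [u] and [v] on the left of
    [frame_ode]. Other times follow by replacing [A] with [A * gtm t]. *)
Lemma st_is_derive0 A (a : chart F) : \det A = 1 -> chart_dom a (p (mobius A ii)) ->
  let h := fr p A a in
  is_derive (0 : R) 1 (st A a)
    (vfield (gder (chart_map a (p (mobius A ii))).2 (h ii)) ('D_(e_ 0) h ii) ('D_(e_ 1) h ii)).
Proof.
move=> dA aA h; set t := (chart_map a (p (mobius A ii))).2.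
have [dh ddh] := fr_diff2 U dA aA.
have dh0 := nbhs_singleton dh.
have nA := fr_near U dA aA.
have Dc : chart_disk a (h ii) by exact: fr_disk.
have nD : \forall z \near ii, chart_disk a (h z).
  exact: (differentiable_continuous dh0) (near_disk Dc).
have sym : \forall z \near ii, (metric (h z) t)^T = metric (h z) t.
  by apply: filterS nD => z Dz; exact: metric_sym.
have [ode1 ode2] := frame_ode (fr_diff2 U dA aA) (metric_differentiable t Dc) sym (fr_iso U dA aA).
have Dg c : 'D_c ((@metric _ _ F a)^~ t) (h ii) = dgf (gder t (h ii)) c.
  exact: (derive_plane _ (metric_differentiable t Dc)).
have vf1 : 'D_(e_ 1) h ii + 'D_(e_ 1) ('D_(e_ 1) h) ii =
    field2 (gder t (h ii)) ('D_(e_ 0) h ii) ('D_(e_ 1) h ii).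
  exact: (etrans ode1 (field2E _ _ Dg)).
have vf0 : 'D_(e_ 0) h ii + 'D_(e_ 1) ('D_(e_ 0) h) ii =
    field1 (gder t (h ii)) ('D_(e_ 0) h ii) ('D_(e_ 1) h ii).
  exact: (etrans ode2 (field1E _ _ Dg)).
clear ode1 ode2.
have DE (k : 'I_2) : is_derive (0 : R) 1 (fun s => expR s *: 'D_(e_ k) h (expR s *: ii))
    ('D_(e_ k) h ii + 'D_(e_ 1) ('D_(e_ k) h) ii).
  (* On the ray the second coordinate of [z] is [expR s], so [hk] restricts to the curve to be
     differentiated. *)
  pose hk (z : plane R) := z 0 1 *: 'D_(e_ k) h z.
  have dhk : differentiable hk ii.
    by apply: differentiable_scale => //; exact: diff_x.
  have := ray_is_derive dhk.
  have -> : (fun s => hk (expR s *: ii)) = (fun s => expR s *: 'D_(e_ k) h (expR s *: ii)).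
    by apply/funext => s; rewrite /hk mxE hpoint1 mulr1.
  have -> // : 'D_(e_ 1) hk ii = 'D_(e_ k) h ii + 'D_(e_ 1) ('D_(e_ k) h) ii.
  have dk1 : derivable hk ii (e_ 1) by exact: diff_derivable.
  have dk2 : derivable ('D_(e_ k) h) ii (e_ 1) by apply: diff_derivable; exact: ddh.
  apply/matrixP => i j; rewrite ord1 -(derive_entry _ _ dk1).
  have -> : (fun y : plane R => hk y 0 j) = (fun y : plane R => y 0 1 * 'D_(e_ k) h y 0 j).
    by apply/funext => y; rewrite mxE.
  have d1 : derivable (fun y : plane R => y 0 1) ii (e_ 1).
    by apply: diff_derivable; exact: diff_x.
  have d2 : derivable (fun y : plane R => 'D_(e_ k) h y 0 j) ii (e_ 1).
    by apply: diff_derivable; apply: differentiable_entry; exact: ddh.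
  have -> : ('D_(e_ k) h ii + 'D_(e_ 1) ('D_(e_ k) h) ii) 0 j =
      'D_(e_ k) h ii 0 j + 'D_(e_ 1) (fun y : plane R => 'D_(e_ k) h y 0 j) ii.
    by rewrite mxE; congr (_ + _); rewrite (derive_entry 0 j dk2).
  have D1 : 'D_(e_ 1) (fun y : plane R => y 0 1) ii = (e_ 1 : plane R) 0 1.
    by have H := @der_x R 1 ii (e_ 1); exact: (@derive_val _ _ _ _ _ _ _ H).
  rewrite (deriveM d1 d2) D1 hpoint1.
  have -> : e_ 1 0 1 = 1 :> R by rewrite e_E.
  rewrite scale1r addrC; congr (_ + _).
  exact: mulr1.
have nst : \forall s \near (0 : R), st A a s =
    mk3 (h (expR s *: ii)) (expR s *: 'D_(e_ 0) h (expR s *: ii))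
      (expR s *: 'D_(e_ 1) h (expR s *: ii)).
  have cr : {for (0 : R), continuous (fun s : R => expR s *: (ii : plane R))}.
    apply: differentiable_continuous; apply/derivable1_diffP.
    have di : differentiable (@idfun (plane R)) ii by apply: differentiable_mx => i j; rewrite ord1; exact: diff_x.
    by have [] := ray_is_derive di.
  have nA' : \forall z \near expR 0 *: (ii : plane R), chart_dom a (p (mobius A z)).
    by rewrite expR0 scale1r; apply: filterS nA => z [].
  have nB : \forall s \near (0 : R), chart_dom a (p (mobius A (expR s *: ii))) := cr _ nA'.
  apply: filterS nB => s as_.
  have Hi := @ii_half R.
  rewrite /st; have -> : fr p (A * gtm s) a ii = h (expR s *: ii) by exact: fr_gt.
  by rewrite !(fr_gt_der _ dA Hi as_).
have D0 := DE 0; have D1 := DE 1; rewrite vf0 in D0; rewrite vf1 in D1.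
exact: near_is_derive nst (mk3_is_derive (ray_is_derive dh0) D0 D1).
Qed.

Lemma st_is_derive A (a : chart F) (t : R) : \det A = 1 ->
  chart_dom a (p (mobius (A * gtm t) ii)) -> let h := fr p (A * gtm t) a in
  is_derive t 1 (st A a) (vfield (gder (chart_map a (p (mobius (A * gtm t) ii))).2 (h ii))
     ('D_(e_ 0) h ii) ('D_(e_ 1) h ii)).
Proof.
move=> dA aA h; have D := st_is_derive0 (det_mul1 dA (det_gtm t)) aA.
have -> : st A a = fun s => st (A * gtm t) a (s - t).
  by apply/funext => s; rewrite /st -mulrA -gtmD addrC subrK.
by apply: shift_is_derive; rewrite subrr.
Qed.

End GeodesicFrames.

(** * How long a geodesic remains in a chart *)

Section ExitTime.
Context {R : realType} (M : metricType R) (F : riemannian_lamination M).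

Lemma left_near (s : R) (P : set R) : 0 < s -> nbhs s P -> exists2 r : R, 0 <= r < s & P r.
Proof.
move=> s0 /nbhs_ballP[e /= e0 He]; pose d := Num.min (e / 2) s.
have d0 : 0 < d by rewrite lt_min divr_gt0.
have de : d <= e / 2 by rewrite ge_min lexx.
have ds : d <= s by rewrite ge_min lexx orbT.
exists (s - d); first by rewrite subr_ge0 ds ltrBlDr ltrDl.
apply: He; rewrite -ball_normE /= opprB addrC subrK (gtr0_norm d0).
by apply: le_lt_trans de _; rewrite ltr_pdivrMr// mulr_natr mulr2n ltrDl.
Qed.

Section OneUniformization.
Variables (G : set 'M[R]_2) (p : plane R -> M) (L : set M).
Hypothesis U : uniformization F G p L.

Lemma geodesic_continuous A (s : R) : \det A = 1 ->
  {for s, continuous (fun s => p (mobius (A * gtm s) ii))}.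
Proof.
move=> dA; have Hi := @ii_half R.
apply: (@eq_cont _ _ _ (fun s => p (mobius A (expR s *: ii)))).
  by move=> r; rewrite (mobius_comp dA (det_gtm _) Hi) gtm_mobius.
have Hs : half_plane (expR s *: ii : plane R) by apply: scale_half => //; exact: expR_gt0.
apply: (@continuous_comp _ _ _ (fun s => mobius A (expR s *: ii)) p); last first.
  exact: (unif_cont U (mobius_half dA Hs)).
apply: (@continuous_comp _ _ _ (fun s : R => expR s *: (ii : plane R)) (mobius A)); last first.
  by apply: differentiable_continuous; exact: (mobius_der 0 dA Hs).1.
by apply: cvgZl; exact: continuous_expR.
Qed.

Lemma chart_near_time A (a : chart F) (s : R) : \det A = 1 ->
  chart_dom a (p (mobius (A * gtm s) ii)) ->
  \forall r \near s, chart_dom a (p (mobius (A * gtm r) ii)) /\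
    (chart_map a (p (mobius (A * gtm r) ii))).2 = (chart_map a (p (mobius (A * gtm s) ii))).2.
Proof.
move=> dA as_; have Hi := @ii_half R.
have Hs : half_plane (mobius (A * gtm s) ii).
  by apply: mobius_half => //; exact: det_mul1 dA (det_gtm s).
have cm : {for s, continuous (fun s => mobius (A * gtm s) ii)}.
  apply: (@eq_cont _ _ _ (fun s => mobius A (expR s *: ii))).
    by move=> r; rewrite (mobius_comp dA (det_gtm _) Hi) gtm_mobius.
  have He : half_plane (expR s *: ii : plane R) by apply: scale_half => //; exact: expR_gt0.
  apply: (@continuous_comp _ _ _ (fun s : R => expR s *: (ii : plane R)) (mobius A)).
    by apply: cvgZl; exact: continuous_expR.
  by apply: differentiable_continuous; exact: (mobius_der 0 dA He).1.
have nw : \forall r \near s, [/\ half_plane (mobius (A * gtm r) ii),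
    chart_dom a (p (mobius (A * gtm r) ii)),
    (chart_map a (p (mobius (A * gtm r) ii))).2 = (chart_map a (p (mobius (A * gtm s) ii))).2 &
    p (mobius (A * gtm r) ii) = chart_inv ((chart_map a (p (mobius (A * gtm r) ii))).1,
       (chart_map a (p (mobius (A * gtm s) ii))).2)] := cm _ (unif_chart U Hs as_).
by apply: filterS nw => r [].
Qed.

Lemma base_is_derive A (a : chart F) (t : R) : \det A = 1 ->
  chart_dom a (p (mobius (A * gtm t) ii)) ->
  is_derive t 1 (fun s => fr p (A * gtm s) a ii) ('D_(e_ 1) (fr p (A * gtm t) a) ii).
Proof.
move=> dA at_; have D := st_is_derive U dA at_; apply: is_derive_mx => i j; rewrite ord1.
have := is_derive_entry 0 j D.
rewrite mxE /=.
have -> // : (fun s => st p A a s 0 j) = (fun s => fr p (A * gtm s) a ii 0 j).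
by apply/funext => s; rewrite mxE.
Qed.

Lemma fr_unit A (a : chart F) (i : 'I_2) : \det A = 1 -> chart_dom a (p (mobius A ii)) ->
  bilinear_form (metric (fr p A a ii) (chart_map a (p (mobius A ii))).2)
    ('D_(e_ i) (fr p A a) ii) ('D_(e_ i) (fr p A a) ii) = 1.
Proof. by move=> dA aA; rewrite (fr_orthonormal U dA aA) eqxx. Qed.

End OneUniformization.

(* In the chart a unit speed geodesic has speed at most [C], so it takes a time at
   least [r / C] to leave the ball of radius [2 * r]. *)
Lemma exit_time (a : chart F) xs (ts : transversal a) : chart_disk a xs ->
  exists r C, [/\ 0 < r, 0 < C, cball xs (2 * r) `<=` chart_disk a &
    exists2 N, nbhs ts N & forall G p L A, uniformization F G p L -> \det A = 1 ->
      chart_dom a (p (mobius A ii)) -> `|fr p A a ii - xs| <= r ->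
      N (chart_map a (p (mobius A ii))).2 -> forall s : R, 0 <= s <= r / C ->
      [/\ chart_dom a (p (mobius (A * gtm s) ii)),
          (chart_map a (p (mobius (A * gtm s) ii))).2 = (chart_map a (p (mobius A ii))).2,
          `|fr p (A * gtm s) a ii - xs| <= 2 * r,
          `|fr p (A * gtm s) a ii - fr p A a ii| <= C * s &
          forall i, `|'D_(e_ i) (fr p (A * gtm s) a) ii| <= C]].
Proof.
move=> Dxs; have [C C0 nC] := @metric_bound _ _ F a xs ts Dxs.
have [[Q1 Q2] /= [nQ1 nQ2] HQ] := nC.
have [e /= e0 He] := (@nbhs_ballP _ _ xs _).1 (filterI nQ1 (near_disk Dxs)).
pose r := e / 4; have r0 : 0 < r by rewrite divr_gt0.
have Hr x : cball xs (2 * r) x -> Q1 x /\ chart_disk a x.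
  move=> xr; apply: He; rewrite -ball_normE /= distrC; apply: le_lt_trans xr _.
  by rewrite /r; move: e0; clear; lra.
exists r, C; split => //; first by move=> x /Hr[].
exists Q2 => // G p L A U dA aA xr Nt.
set t := (chart_map a (p (mobius A ii))).2 in Nt *.
pose c s := fr p (A * gtm s) a ii.
pose ga s := p (mobius (A * gtm s) ii).
have c0 : c 0 = fr p A a ii by rewrite /c gtm0 mulr1.
have ga0 : ga 0 = p (mobius A ii) by rewrite /ga gtm0 mulr1.
have bnd s : chart_dom a (ga s) -> (chart_map a (ga s)).2 = t -> `|c s - xs| <= 2 * r ->
    forall i, `|'D_(e_ i) (fr p (A * gtm s) a) ii| <= C.
  move=> as_ ts_ cr i; have [Qc _] := Hr _ cr.
  apply: (HQ (c s, t)); first by split.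
  by rewrite /= -ts_; apply: (fr_unit U i _ as_); exact: det_mul1 dA (det_gtm s).
pose Q s := [/\ chart_dom a (ga s), (chart_map a (ga s)).2 = t & `|c s - c 0| <= C * s].
have rC : r / C * C = r by rewrite mulfVK// gt_eqF.
have Qr s : 0 <= s <= r / C -> Q s -> `|c s - xs| <= 2 * r.
  move=> /andP[s0 sr] [_ _ cs].
  have -> : c s - xs = (c s - c 0) + (c 0 - xs) by rewrite addrA subrK.
  have sr' : C * s <= r by rewrite -[leRHS]rC mulrC ler_pM2r.
  apply: le_trans (ler_normD _ _) _.
  by rewrite c0 in cs *; move: cs xr sr'; clear; lra.
have cont_c s : chart_dom a (ga s) -> {for s, continuous c}.
  move=> as_; have [D _] := base_is_derive U dA as_.
  by apply: differentiable_continuous; exact/derivable1_diffP.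
suff HQs : forall s : R, 0 <= s <= r / C -> Q s.
  move=> s sr; have Qs := HQs s sr; have cr := Qr s sr Qs; have [as_ ts_ cs] := Qs.
  by split => //; [rewrite -c0|exact: bnd].
apply: real_ind => s /andP[s0 sr] Hs.
- have [->|sn0] := eqVneq s 0.
    by split; rewrite ?ga0// subrr normr0 mulr0.
  have sp : 0 < s by rewrite lt_neqAle eq_sym sn0.
  (* A compact disk in the plaque is closed in [M]. It contains the geodesic before time [s], hence
     at time [s]: the geodesic neither leaves the chart nor changes plaque. *)
  pose K := (fun x => chart_inv (x, t)) @` cball xs (2 * r).
  have clK : closed K.
    apply: compact_closed; first exact: metric_hausdorff.
    apply: continuous_compact; last exact: compact_cball.
    apply: continuous_in_subspaceT => x; rewrite inE => /Hr[_ Dx].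
    apply: (@continuous_comp _ _ _ (fun y : plane R => (y, t)) (@chart_inv _ _ F a)).
      have ct : (fun=> t) @ x --> t by exact: cvg_cst.
      exact: (cvg_pair cvg_id ct).
    exact: chart_inv_cvg.
  have lK (q : R) : 0 <= q < s -> K (ga q).
    move=> /andP[q0 qs]; have qr : 0 <= q <= r / C by rewrite q0 (le_trans (ltW qs)).
    have Qq := Hs q; rewrite q0 qs in Qq; have {Qq} Qq := Qq isT.
    exists (c q); first exact: Qr.
    by have [aq tq _] := Qq; rewrite -tq /c /fr chart_point.
  have Ks : K (ga s).
    apply: contrapT => nK.
    have oK : nbhs (ga s) (~` K) by apply: open_nbhs_nbhs; split => //; exact: closed_openC.
    have [q qs nq] := left_near sp (geodesic_continuous U dA oK).
    exact: nq (lK q qs).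
  have [x /Hr[_ Dx] xs_] := Ks.
  have as_ : chart_dom a (ga s) by rewrite -xs_; exact: chart_inv_dom.
  split => //; first by rewrite -xs_ chart_invK.
  rewrite leNgt; apply/negP => lt_.
  have cs := cont_c s as_.
  have e1 : 0 < `|c s - c 0| - C * s by rewrite subr_gt0.
  have /cvgrPdist_lt/(_ _ e1) ns := cs.
  have [q qs nq0] := left_near sp ns.
  have nq : `|c s - c q| < `|c s - c 0| - C * s by exact: nq0.
  have [_ _ cq] := Hs q qs; move/andP: qs => [q0 qs].
  have tri : `|c s - c 0| <= `|c s - c q| + `|c q - c 0|.
    have -> : c s - c 0 = (c s - c q) + (c q - c 0) by rewrite addrA subrK.
    exact: ler_normD.
  have Cq : C * q <= C * s by rewrite ler_pM2l// ltW.
  have t2 := le_trans tri (lerD (lexx _) (le_trans cq Cq)).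
  by move: nq; rewrite ltrBrDr => nq; have := le_lt_trans t2 nq; rewrite ltxx.
- have Qs : Q s by apply: Hs; rewrite s0 lexx.
  have [as_ ts_ cs] := Qs.
  have cst : `|c s - xs| < 2 * r.
    have -> : c s - xs = (c s - c 0) + (c 0 - xs) by rewrite addrA subrK.
    have sr' : C * s < r by rewrite -[ltRHS]rC mulrC ltr_pM2r.
    apply: le_lt_trans (ler_normD _ _) _.
    by rewrite c0 in cs *; move: cs xr sr'; clear; lra.
  have nc : \forall q \near s, `|c q - xs| <= 2 * r.
    have e1 : 0 < 2 * r - `|c s - xs| by rewrite subr_gt0.
    have /cvgrPdist_lt/(_ _ e1) ns := cont_c s as_.
    apply: filterS ns => q /=; rewrite distrC => nq.
    have -> : c q - xs = (c q - c s) + (c s - xs) by rewrite addrA subrK.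
    by apply: le_trans (ler_normD _ _) _; move: nq; clear; lra.
  have na := chart_near_time U dA as_.
  have [d /= d0 Hd] := (@nbhs_ballP _ _ s _).1 (filterI na nc).
  exists d => // q /andP[sq qd] qr.
  have Hd' (w : R) : s <= w <= q -> [/\ chart_dom a (ga w), (chart_map a (ga w)).2 = t
      & `|c w - xs| <= 2 * r].
    move=> /andP[sw wq]; have [|[aw tw] cw] := Hd w.
      rewrite -ball_normE /= distrC ger0_norm ?subr_ge0// ltrBlDl.
      exact: le_lt_trans wq qd.
    by split => //; rewrite /ga tw.
  have [aq tq cq] : [/\ chart_dom a (ga q), (chart_map a (ga q)).2 = t
      & `|c q - xs| <= 2 * r] by apply: Hd'; rewrite lexx ltW.
  split => //.
  have cqs : `|c q - c s| <= C * (q - s).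
    apply: (@mvt_mx _ _ _ _ (fun w => 'D_(e_ 1) (fr p (A * gtm w) a) ii)); first exact: ltW.
      by move=> w /Hd'[aw _ _]; exact: base_is_derive U _ _ _ dA aw.
    by move=> w /Hd'[aw tw cw]; exact: bnd.
  have -> : c q - c 0 = (c q - c s) + (c s - c 0) by rewrite addrA subrK.
  have -> : C * q = C * (q - s) + C * s by rewrite -mulrDr subrK.
  exact: le_trans (ler_normD _ _) (lerD cqs cs).
Qed.

End ExitTime.

Section InitialFrame.
Context {R : realType}.

(* Rotation by a right angle of the unit vector [v] in the metric [g]. *)
Definition normal (g : 'M[R]_2) (v : plane R) : plane R :=
  hpoint ((v 0 0 * g 0 1 + v 0 1 * g 1 1) * (Num.sqrt (\det g))^-1)
         (- ((v 0 0 * g 0 0 + v 0 1 * g 1 0) * (Num.sqrt (\det g))^-1)).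

Lemma normal_arith (a b d u0 u1 v0 v1 D : R) : D = u0 * v1 - u1 * v0 -> 
  (v0 * a + v1 * b) * v0 + (v0 * b + v1 * d) * v1 = 1 ->
  u0 * (v0 * a + v1 * b) + u1 * (v0 * b + v1 * d) = 0 ->
  u0 * a * u0 + u0 * b * u1 + (u1 * b * u0 + u1 * d * u1) = 1 ->
  [/\ u0 = (v0 * b + v1 * d) * D, u1 = - ((v0 * a + v1 * b) * D) &
      (a * d - b * b) * D ^+ 2 = 1].
Proof.
move=> -> vv uv uu.
have E0 : u0 = (v0 * b + v1 * d) * (u0 * v1 - u1 * v0).
  transitivity (u0 * ((v0 * a + v1 * b) * v0 + (v0 * b + v1 * d) * v1)
     - v0 * (u0 * (v0 * a + v1 * b) + u1 * (v0 * b + v1 * d))); last by ring.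
  by rewrite vv uv; ring.
have E1 : u1 = - ((v0 * a + v1 * b) * (u0 * v1 - u1 * v0)).
  transitivity (u1 * ((v0 * a + v1 * b) * v0 + (v0 * b + v1 * d) * v1)
     - v1 * (u0 * (v0 * a + v1 * b) + u1 * (v0 * b + v1 * d))); last by ring.
  by rewrite vv uv; ring.
split => //.
transitivity ((u0 * a * u0 + u0 * b * u1 + (u1 * b * u0 + u1 * d * u1)) *
  ((v0 * a + v1 * b) * v0 + (v0 * b + v1 * d) * v1)
  - (u0 * (v0 * a + v1 * b) + u1 * (v0 * b + v1 * d)) ^+ 2); first by ring.
by rewrite uu vv uv; ring.
Qed.

(** The first frame vector is a continuous function of the metric and the second one, so the initial
    state depends only on the unit vector and not on the uniformization. *)
Lemma normalE (g : 'M[R]_2) (u v : plane R) : g^T = g ->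
  bilinear_form g u u = 1 -> bilinear_form g v v = 1 -> bilinear_form g u v = 0 ->
  0 < u 0 0 * v 0 1 - u 0 1 * v 0 0 -> u = normal g v.
Proof.
move=> gT guu gvv guv D0.
have g10 : g 1 0 = g 0 1 by rewrite -[in LHS]gT mxE.
rewrite /normal det2E g10; move: guu gvv guv; rewrite !bilinearE g10.
move: D0; set D := _ - _ => D0 guu gvv guv.
have [||||E0 E1 E2] := @normal_arith (g 0 0) (g 0 1) (g 1 1) (u 0 0) (u 0 1) (v 0 0) (v 0 1) D.
- by [].
- by rewrite -gvv; ring.
- by rewrite -guv; ring.
- by [].
have Dn : D != 0 by rewrite gt_eqF.
have sD : (Num.sqrt (g 0 0 * g 1 1 - g 0 1 * g 0 1))^-1 = D.
  have -> : g 0 0 * g 1 1 - g 0 1 * g 0 1 = D^-1 ^+ 2.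
    by rewrite exprVn -[LHS](mulfK (expf_neq0 2 Dn)) E2 mul1r.
  by rewrite sqrtr_sqr gtr0_norm ?invr_gt0// invrK.
by rewrite sD; apply: plane_eq; rewrite hpointE.
Qed.

Lemma normal_cont (T : topologicalType) (g : T -> 'M[R]_2) (v : T -> plane R) x :
  {for x, continuous g} -> {for x, continuous v} -> 0 < \det (g x) ->
  {for x, continuous (fun y => normal (g y) (v y))}.
Proof.
move=> cg cv dg.
have ck : {for x, continuous (fun y => (Num.sqrt (\det (g y)))^-1)}.
  have cs : {for x, continuous (fun y => Num.sqrt (\det (g y)))}.
    apply: (@continuous_comp _ _ _ (fun y => \det (g y)) (@Num.sqrt R)); first exact: det_cont.
    exact: sqrt_continuous.
  by apply: (cvgV _ cs); rewrite gt_eqF// sqrtr_gt0.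
apply: vec_cont; [|apply: contN]; apply: contM => //; apply: contD; apply: contM;
  by [exact: ventry_cont|exact: entry_cont].
Qed.

End InitialFrame.

(** * Local continuity of the geodesic flow *)

Section LocalFlow.
Context {R : realType} (M : metricType R) (F : riemannian_lamination M).

Lemma ut_vec_cont (u : unit_tangent F) (a : chart F) : chart_dom a (ut_base u) ->
  {for u, continuous (fun u' : unit_tangent F => ut_vec u' a)}.
Proof.
move=> au V nV.
have cs : {for (ut_base u, ut_vec u a), continuous (@snd M (plane R))} by exact: cvg_snd.
by apply: filterS (chart_nbhs au (cs _ nV)) => u' [].
Qed.

Definition init (a : chart F) (u : unit_tangent F) : 'M[R]_(3, 2) :=
  let m := chart_map a (ut_base u) in
  mk3 m.1 (normal (metric m.1 m.2) (ut_vec u a)) (ut_vec u a).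

Lemma coord_cont (u : unit_tangent F) (a : chart F) : chart_dom a (ut_base u) ->
  {for u, continuous (fun u' : unit_tangent F => chart_map a (ut_base u'))}.
Proof.
move=> au; apply: (@continuous_comp _ _ _ (@ut_base _ _ F) (@chart_map _ _ F a)).
  exact: ut_base_cont.
exact: chart_map_cvg.
Qed.

Lemma coord1_cont (u : unit_tangent F) (a : chart F) : chart_dom a (ut_base u) ->
  {for u, continuous (fun u' : unit_tangent F => (chart_map a (ut_base u')).1)}.
Proof.
move=> au; apply: (@continuous_comp _ _ _ _ (@fst (plane R) (transversal a))).
  exact: (coord_cont au).
exact: cvg_fst.
Qed.

Lemma coord2_cont (u : unit_tangent F) (a : chart F) : chart_dom a (ut_base u) ->
  {for u, continuous (fun u' : unit_tangent F => (chart_map a (ut_base u')).2)}.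
Proof.
move=> au; apply: (@continuous_comp _ _ _ _ (@snd (plane R) (transversal a))).
  exact: (coord_cont au).
exact: cvg_snd.
Qed.

Lemma normal_ut_cont (u : unit_tangent F) (a : chart F) : chart_dom a (ut_base u) ->
  {for u, continuous (fun u' : unit_tangent F =>
     normal (metric (chart_map a (ut_base u')).1 (chart_map a (ut_base u')).2) (ut_vec u' a))}.
Proof.
move=> au; have Dm : chart_disk a (chart_map a (ut_base u)).1 by exact: chart_map_disk.
apply: normal_cont; last exact: metric_det_gt0.
  apply: (@continuous_comp _ _ _ (fun u' : unit_tangent F => chart_map a (ut_base u'))
    (fun y : plane R * transversal a => metric y.1 y.2)); first exact: coord_cont.
  have := @metric_cont _ _ F a (chart_map a (ut_base u)).1 (chart_map a (ut_base u)).2 [::] Dm.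
  by rewrite -surjective_pairing.
exact: ut_vec_cont.
Qed.

Lemma init_near (u : unit_tangent F) (a : chart F) e : chart_dom a (ut_base u) -> 0 < e ->
  \forall u' \near u, `|init a u - init a u'| <= e.
Proof.
move=> au e0.
have /cvgrPdist_le/(_ _ e0) h1 := coord1_cont au.
have /cvgrPdist_le/(_ _ e0) h2 := normal_ut_cont au.
have /cvgrPdist_le/(_ _ e0) h3 := ut_vec_cont au.
by apply: filterS3 h1 h2 h3 => u' h1 h2 h3; exact: mk3_le.
Qed.

Lemma st_init G p L A (a : chart F) u : uniformization F G p L -> \det A = 1 ->
  frame_at p A u -> chart_dom a (ut_base u) -> st p A a 0 = init a u.
Proof.
move=> U dA fu au; have bu := frame_base fu.
have aA : chart_dom a (p (mobius A ii)) by rewrite -bu.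
rewrite /st /init gtm0 mulr1 (frame_vec fu au) bu.
congr mk3; apply: normalE.
- exact: (metric_tr aA).
- exact: (fr_unit U 0 dA aA).
- exact: (fr_unit U 1 dA aA).
- by rewrite (fr_orthonormal U dA aA).
- exact: (fr_orient U dA aA).
Qed.

Lemma gder_lipschitz (a : chart F) (t : transversal a) c r : cball c r `<=` chart_disk a ->
  exists2 K, 0 <= K & (forall x, cball c r x -> `|gder t x| <= K) /\
    forall x y, cball c r x -> cball c r y -> `|gder t x - gder t y| <= K * `|x - y|.
Proof.
move=> cD; have [sf _] := @metric_smooth _ _ F a.
have E : [set x | (chart_disk a `*` [set: transversal a]) (x, t)] = chart_disk a.
  by apply/seteqP; split => y //= [].
have sD := sf t; rewrite E in sD.
have H (k i j : 'I_2) : bounded_lipschitz (cball c r)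
    (fun x => 'D_(e_ k) ((@metric _ _ F a)^~ t) x i j).
  have dk x : chart_disk a x -> differentiable ('D_(e_ k) ((@metric _ _ F a)^~ t)) x.
    exact: (@smooth_on_differentiable R 1 1 _ _ (@disk_open R _ _) sD [:: k] x).
  apply: bl_C1 => [x /cD Dx|l x /cD Dx].
    by apply: differentiable_entry; exact: dk.
  apply: (@near_eq_cont _ _ _ (fun y => 'D_(e_ l) ('D_(e_ k) ((@metric _ _ F a)^~ t)) y i j)).
    apply: filterS (near_disk Dx) => y Dy.
    by apply: derive_entry; apply: diff_derivable; exact: dk.
  apply: entry_cont; exact: (sD [:: l; k] x Dx).2.
have H2 k : exists2 K, 0 <= K &
    (forall x, cball c r x -> `|'D_(e_ k) ((@metric _ _ F a)^~ t) x| <= K) /\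
    forall x y, cball c r x -> cball c r y ->
    `|'D_(e_ k) ((@metric _ _ F a)^~ t) x - 'D_(e_ k) ((@metric _ _ F a)^~ t) y| <= K * `|x - y|.
  have [K0 K00 [A0 B0]] := H k 0 0; have [K1 K10 [A1 B1]] := H k 0 1.
  have [K2 K20 [A2 B2]] := H k 1 0; have [K3 K30 [A3 B3]] := H k 1 1.
  pose K := K0 + K1 + (K2 + K3).
  have [L0 L1 L2 L3] : [/\ K0 <= K, K1 <= K, K2 <= K & K3 <= K].
    by rewrite /K; split; move: K00 K10 K20 K30; clear; lra.
  exists K; first by rewrite !addr_ge0.
  split=> [x cx|x y cx cy]; apply: norm_mx_le => i j; move: i j.
    do 2![apply: ord2P]; [apply: le_trans L0|apply: le_trans L1|apply: le_trans L2|apply: le_trans L3];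
    by [exact: A0|exact: A1|exact: A2|exact: A3].
  have S i j (X Y : 'M[R]_2) k' : `|X i j - Y i j| <= k' * `|x - y| -> k' <= K ->
      `|(X - Y) i j| <= K * `|x - y|.
    move=> h1 h2; rewrite !mxE; apply: le_trans h1 _; exact: ler_wpM2r.
  apply: ord2P; apply: ord2P.
  - by apply: S L0; exact: B0.
  - by apply: S L1; exact: B1.
  - by apply: S L2; exact: B2.
  - by apply: S L3; exact: B3.
have [K0 K00 [A0 B0]] := H2 0; have [K1 K10 [A1 B1]] := H2 1.
exists (K0 + K1); first exact: addr_ge0.
split=> [x cx|x y cx cy]; rewrite prod_normE ge_max.
  apply/andP; split; first by apply: le_trans (A0 _ cx) _; rewrite lerDl.
  by apply: le_trans (A1 _ cx) _; rewrite lerDr.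
apply/andP; split; first by apply: le_trans (B0 _ _ cx cy) _; apply: ler_wpM2r; rewrite ?lerDl.
by apply: le_trans (B1 _ _ cx cy) _; apply: ler_wpM2r; rewrite ?lerDr.
Qed.

Lemma gder_near (a : chart F) (t : transversal a) c r e : cball c r `<=` chart_disk a ->
  0 < e -> \forall s \near t, forall x, cball c r x -> `|gder s x - gder t x| <= e.
Proof.
move=> cD e0; have [_ uf] := @metric_smooth _ _ F a.
have sub : cball c r `<=` [set x | (chart_disk a `*` [set: transversal a]) (x, t)].
  by move=> x /cD.
have h0 := uf t [:: 0] _ _ (@compact_cball R c r) sub e0.
have h1 := uf t [:: 1] _ _ (@compact_cball R c r) sub e0.
apply: filterS2 h0 h1 => s h0 h1 x cx; rewrite prod_normE ge_max.
by apply/andP; split; apply: ltW; [exact: h0|exact: h1].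
Qed.

Lemma vfield_lipschitz (C : R) : 0 <= C -> exists2 L, 0 <= L &
  forall (H H' : 'M[R]_2 * 'M[R]_2) (u v u' v' : plane R) (d : R),
  `|H| <= C -> `|H'| <= C -> `|u| <= C -> `|u'| <= C -> `|v| <= C -> `|v'| <= C ->
  `|H - H'| <= d -> `|u - u'| <= d -> `|v - v'| <= d ->
  `|vfield H u v - vfield H' u' v'| <= L * d.
Proof.
move=> C0; have [L L0 [_ HL]] := @field_bl R _ C0; exists (L + 1); first exact: addr_ge0.
move=> H H' u v u' v' d HC HC' uC uC' vC vC' dH du dv.
pose z : (plane R * plane R) * ('M[R]_2 * 'M[R]_2) := ((u, v), H).
pose z' : (plane R * plane R) * ('M[R]_2 * 'M[R]_2) := ((u', v'), H').
have zC : `|z| <= C by rewrite prod_normE ge_max prod_normE ge_max uC vC.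
have zC' : `|z'| <= C by rewrite prod_normE ge_max prod_normE ge_max uC' vC'.
have zz : `|z - z'| <= d.
  by rewrite prod_normE ge_max; apply/andP; split => //; rewrite prod_normE ge_max du.
have d0 : 0 <= d by exact: le_trans dv.
have Ld : L * `|z - z'| <= (L + 1) * d.
  by apply: ler_pM => //; rewrite lerDl.
have [h1 h2] := HL z z' zC zC'.
apply: mk3_le; [|exact: le_trans h1 Ld|exact: le_trans h2 Ld].
by apply: le_trans dv _; rewrite mulrDl mul1r lerDr mulr_ge0.
Qed.

End LocalFlow.

Section LocalFlow2.
Context {R : realType} (M : metricType R) (F : riemannian_lamination M).

(** Stated for the relation, because uniqueness of the translate is not yet known; the
    uniformizations behind the two translations are unrelated. Taking [u' = u] will give
    uniqueness. *)
Definition continuous_translation (B : 'M[R]_2) (u : unit_tangent F) :=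
  forall w, right_translation B u w -> forall V, nbhs w V ->
  exists2 W, nbhs u W & forall u' w', W u' -> right_translation B u' w' -> V w'.

Lemma nbhs_init (w : unit_tangent F) (a : chart F) V : chart_dom a (ut_base w) -> nbhs w V ->
  exists e N, [/\ 0 < e, nbhs (chart_map a (ut_base w)).2 N &
    forall w', chart_dom a (ut_base w') -> N (chart_map a (ut_base w')).2 ->
      `|init a w - init a w'| <= e -> V w'].
Proof.
move=> aw nV; have [P nP PV] := nbhs_chart nV aw.
set x := (chart_map a (ut_base w)).1; set t := (chart_map a (ut_base w)).2.
have Dx : chart_disk a x by exact: chart_map_disk.
have ci := @chart_inv_cvg _ _ F a x t Dx.
have [[P1 P2] /= [nP1 nP2] HP] := nP.
have bw : chart_inv (x, t) = ut_base w by exact: chart_point.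
have nP1' : nbhs (chart_inv (x, t)) P1 by rewrite bw.
have [[Q1 Q2] /= [nQ1 nQ2] HQ] := ci _ nP1'.
have [e1 /= e10 He1] := (@nbhs_ballP _ _ x _).1 nQ1.
have [e2 /= e20 He2] := (@nbhs_ballP _ _ (ut_vec w a) _).1 nP2.
pose e := Num.min e1 e2 / 2.
have e0 : 0 < e by rewrite divr_gt0// lt_min e10.
have ee : e < Num.min e1 e2 by rewrite ltr_pdivrMr// mulr_natr mulr2n ltrDl lt_min e10.
move: ee; rewrite lt_min => /andP[ee1 ee2].
exists e, Q2; split => // w' aw' tw' ew'.
have [c1 _ c3] := le_mk3 x (normal (metric x t) (ut_vec w a)) (ut_vec w a)
  (chart_map a (ut_base w')).1
  (normal (metric (chart_map a (ut_base w')).1 (chart_map a (ut_base w')).2) (ut_vec w' a))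
  (ut_vec w' a).
apply: PV => //; apply: HP; split => /=.
  rewrite -(chart_point aw'); apply: (HQ (_, _)); split => //=.
  apply: He1; rewrite -ball_normE /=; apply: le_lt_trans c1 _.
  exact: le_lt_trans ew' ee1.
apply: He2; rewrite -ball_normE /=; apply: le_lt_trans c3 _.
exact: le_lt_trans ew' ee2.
Qed.

Lemma st_init_at G p L A (a : chart F) w s : uniformization F G p L -> \det A = 1 ->
  frame_at p (A * gtm s) w -> chart_dom a (ut_base w) -> st p A a s = init a w.
Proof.
move=> U dA fw aw.
by rewrite -(st_init U (det_mul1 dA (det_gtm s)) fw aw) /st gtm0 mulr1.
Qed.

Lemma start_near (u : unit_tangent F) (a : chart F) r N : chart_dom a (ut_base u) -> 0 < r ->
  nbhs (chart_map a (ut_base u)).2 N ->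
  \forall u' \near u, [/\ chart_dom a (ut_base u'),
    `|(chart_map a (ut_base u')).1 - (chart_map a (ut_base u)).1| <= r &
    N (chart_map a (ut_base u')).2].
Proof.
move=> au r0 nN.
have h1 : \forall u' \near u, chart_dom a (ut_base u') := ut_base_cont (near_dom au).
have /cvgrPdist_le/(_ _ r0) h2 := coord1_cont au.
have h3 : \forall u' \near u, N (chart_map a (ut_base u')).2 := coord2_cont au nN.
by apply: filterS3 h1 h2 h3 => u' ? h ?; split => //; rewrite distrC.
Qed.

(** The vector field is bounded by [B] near [u0], so for times at most [rho] the state moves by at
    most [eta / 2], uniformly in the starting vector. *)
Lemma local_small (u0 : unit_tangent F) V : nbhs u0 V ->
  exists2 r, 0 < r & exists2 W, nbhs u0 W &
  forall (s : R) u w, 0 <= s <= r -> W u -> right_translation (gtm s) u w -> V w.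
Proof.
move=> nV; have [a au0] := chart_cover F (ut_base u0).
set xs := (chart_map a (ut_base u0)).1; set ts := (chart_map a (ut_base u0)).2.
have Dxs : chart_disk a xs by exact: chart_map_disk.
have [r [C [r0 C0 cD [N nN HN]]]] := exit_time ts Dxs.
have [eta [N' [eta0 nN' HV]]] := nbhs_init au0 nV.
have [K K0 [HK _]] := gder_lipschitz ts cD.
have ngd := gder_near ts cD (ltr01 : (0 : R) < 1).
pose C' := C + K + 1.
have C'0 : 0 <= C' by rewrite !addr_ge0// ltW.
have CC' : C <= C' by rewrite -[C']addrA lerDl addr_ge0.
have KC' : K + 1 <= C' by rewrite -[C']addrA lerDr ltW.
have [L L0 HL] := vfield_lipschitz C'0.
pose B := L * C' + `|vfield (0, 0) 0 (0 : plane R)| + 1.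
have B0 : 0 < B by rewrite ltr_wpDl// addr_ge0// mulr_ge0.
have vB (H : 'M[R]_2 * 'M[R]_2) (u v : plane R) : `|H| <= C' -> `|u| <= C' -> `|v| <= C' ->
    `|vfield H u v| <= B.
  move=> HC uC vC; rewrite -[vfield H u v](subrK (vfield (0, 0) 0 (0 : plane R))).
  apply: le_trans (ler_normD _ _) _; rewrite /B -addrA; apply: lerD; last by rewrite lerDl.
  by apply: HL; rewrite ?normr0// ?subr0//.
pose rho := Num.min (r / C) (eta / 2 / B).
have rho0 : 0 < rho by rewrite lt_min !divr_gt0.
have rho1 : rho <= r / C by rewrite ge_min lexx.
have rho2 : rho <= eta / 2 / B by rewrite ge_min lexx orbT.
exists rho => //.
have e2 : 0 < eta / 2 by rewrite divr_gt0.
exists ([set u | [/\ chart_dom a (ut_base u),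
    `|(chart_map a (ut_base u)).1 - xs| <= r &
    (N `&` N' `&` [set t | forall x, cball xs (2 * r) x -> `|gder t x - gder ts x| <= 1])
      (chart_map a (ut_base u)).2]] `&` [set u | `|init a u0 - init a u| <= eta / 2]).
  apply: filterI; last exact: init_near.
  by apply: start_near => //; apply: filterI => //; exact: filterI.
move=> s u w /andP[s0 sr] [[au xr [[Nt N't] gt1]] iu] [G [p [A [U dA fu fw]]]].
have bu := frame_base fu; rewrite bu in au xr Nt N't gt1.
have H (q : R) : 0 <= q <= s -> [/\ chart_dom a (p (mobius (A * gtm q) ii)),
    (chart_map a (p (mobius (A * gtm q) ii))).2 = (chart_map a (p (mobius A ii))).2,
    `|fr p (A * gtm q) a ii - xs| <= 2 * r &
    forall i, `|'D_(e_ i) (fr p (A * gtm q) a) ii| <= C].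
  move=> /andP[q0 qs]; have [|h1 h2 h3 _ h4] := HN _ _ _ _ U dA au xr Nt q.
    by rewrite q0 (le_trans qs)// (le_trans sr).
  by split.
clear HN.
have [aw tw _ _] : [/\ chart_dom a (p (mobius (A * gtm s) ii)),
    (chart_map a (p (mobius (A * gtm s) ii))).2 = (chart_map a (p (mobius A ii))).2,
    `|fr p (A * gtm s) a ii - xs| <= 2 * r &
    forall i, `|'D_(e_ i) (fr p (A * gtm s) a) ii| <= C].
  by apply: H; rewrite s0 lexx.
have bw := frame_base fw; rewrite -bw in aw tw.
apply: HV => //; first by rewrite tw.
rewrite -(st_init_at U dA fw aw).
have i0 : init a u = st p A a 0 by rewrite (st_init U dA fu)// bu.
have sB : `|st p A a s - st p A a 0| <= B * (s - 0).
  pose vf q := vfield (gder (chart_map a (p (mobius (A * gtm q) ii))).2 (fr p (A * gtm q) a ii))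
    ('D_(e_ 0) (fr p (A * gtm q) a) ii) ('D_(e_ 1) (fr p (A * gtm q) a) ii).
  apply: (@mvt_mx _ _ _ _ vf) => // q qs; have [aq tq xq Dq] := H q qs.
    exact: st_is_derive U _ _ _ dA aq.
  rewrite /vf tq; apply: vB; try by apply: le_trans CC'.
  rewrite -[gder _ _](subrK (gder ts (fr p (A * gtm q) a ii))).
  apply: le_trans (ler_normD _ _) _; apply: le_trans KC'; rewrite addrC.
  by apply: lerD; [exact: HK|exact: gt1].
have Bs : B * (s - 0) <= eta / 2.
  by rewrite subr0 mulrC -ler_pdivlMr// (le_trans sr).
have -> : init a u0 - st p A a s = (init a u0 - init a u) + (st p A a 0 - st p A a s).
  by rewrite i0 addrA subrK.
apply: le_trans (ler_normD _ _) _; rewrite [eta](splitr eta); apply: lerD => //.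
by rewrite distrC; exact: le_trans Bs.
Qed.

(* In a chart all frames solve the same differential equation, up to the uniformly
   small change of the metric with the transversal coordinate: Gronwall applies. *)
Lemma local_flow (u0 : unit_tangent F) :
  exists2 r, 0 < r & exists2 W, nbhs u0 W &
  forall (s : R) u, 0 <= s <= r -> W u -> continuous_translation (gtm s) u.
Proof.
have [a au0] := chart_cover F (ut_base u0).
set xs := (chart_map a (ut_base u0)).1; set ts := (chart_map a (ut_base u0)).2.
have Dxs : chart_disk a xs by exact: chart_map_disk.
have [r [C [r0 C0 cD [N nN HN]]]] := exit_time ts Dxs.
exists (r / C); first by rewrite divr_gt0.
pose W := [set u : unit_tangent F | [/\ chart_dom a (ut_base u),
    `|(chart_map a (ut_base u)).1 - xs| <= r & N (chart_map a (ut_base u)).2]].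
exists W°; first by apply: nbhs_interior; exact: start_near.
move=> s u1 /andP[s0 sr] Wu1 w1 [G1 [p1 [A1 [U1 dA1 fu1 fw1]]]] V nV.
have {}HN G p L A u (q : R) : uniformization F G p L -> \det A = 1 -> frame_at p A u -> W u ->
    0 <= q <= s -> [/\ chart_dom a (p (mobius (A * gtm q) ii)),
    (chart_map a (p (mobius (A * gtm q) ii))).2 = (chart_map a (ut_base u)).2,
    `|fr p (A * gtm q) a ii - xs| <= 2 * r &
    forall i, `|'D_(e_ i) (fr p (A * gtm q) a) ii| <= C].
  move=> U dA fu [au xr Nt] /andP[q0 qs].
  have bu := frame_base fu; rewrite bu in au xr Nt *.
  have [|h1 h2 h3 _ h4] := HN _ _ _ _ U dA au xr Nt q; last by split.
  by rewrite q0 (le_trans qs).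
have Wu1' := nbhs_singleton Wu1.
have ss : 0 <= s <= s by rewrite s0 lexx.
have H1 q := HN _ _ _ _ _ q U1 dA1 fu1 Wu1'.
have [aw1 tw1 _ _] := H1 s ss.
have bw1 := frame_base fw1; rewrite -bw1 in aw1 tw1.
have [eta [N' [eta0 nN' HV]]] := nbhs_init aw1 nV.
rewrite tw1 in nN'; set t1 := (chart_map a (ut_base u1)).2 in nN' tw1 H1.
have [au1 _ _] := Wu1'.
have [K K0 [HK HKl]] := gder_lipschitz t1 cD.
pose C' := C + K + 1.
have C'0 : 0 <= C' by rewrite !addr_ge0// ltW.
have CC' : C <= C' by rewrite -[C']addrA lerDl addr_ge0.
have KC' : K + 1 <= C' by rewrite -[C']addrA lerDr ltW.
have [L L0 HL] := vfield_lipschitz C'0.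
(* The derivatives of the metric differ by [K] times the distance of the states, plus [d] for the
   change of transversal; [(1 + K) * Y + d] dominates this and the distance [Y] itself. *)
have LK0 : 0 <= L * (1 + K) by rewrite mulr_ge0// addr_ge0.
have [Cg Cg0 HG] := @gronwall_mx R 2 1 s (L * (1 + K)) s0 LK0.
have Cg1 : 0 < Cg + 1 by rewrite ltr_wpDl.
pose e := eta / (Cg + 1); have e0 : 0 < e by rewrite divr_gt0.
have L1 : 0 < L + 1 by rewrite ltr_wpDl.
pose d := Num.min 1 (e / (L + 1)).
have d0 : 0 < d by rewrite lt_min ltr01 divr_gt0.
have d1 : d <= 1 by rewrite ge_min lexx.
have Ld : L * d <= e.
  have de : d <= e / (L + 1) by rewrite ge_min lexx orbT.
  have : (L + 1) * d <= e by rewrite mulrC -ler_pdivlMr.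
  by apply: le_trans; rewrite mulrDl mul1r lerDl ltW.
have ngd := gder_near t1 cD d0.
exists (W `&` [set u | [/\ chart_dom a (ut_base u),
    `|(chart_map a (ut_base u)).1 - (chart_map a (ut_base u1)).1| <= r &
    (N' `&` [set t | forall x, cball xs (2 * r) x -> `|gder t x - gder t1 x| <= d])
      (chart_map a (ut_base u)).2]] `&` [set u | `|init a u1 - init a u| <= e]).
  apply: filterI; last exact: init_near.
  by apply: filterI => //; apply: start_near => //; exact: filterI.
move=> u w [[Wu [_ _ [N't gt1]]] iu] [G [p [A [U dA fu fw]]]].
have H q := HN _ _ _ _ _ q U dA fu Wu.
have [au _ _] := Wu.
have [aw tw _ _] := H s ss.
have bw := frame_base fw; rewrite -bw in aw tw.
apply: HV => //; first by rewrite tw.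
rewrite -(st_init_at U1 dA1 fw1 aw1) -(st_init_at U dA fw aw).
set t := (chart_map a (ut_base u)).2 in N't gt1 tw H.
have Ce : Cg * e <= eta.
  have <- : (Cg + 1) * e = eta by rewrite /e mulrC divfK// gt_eqF.
  by rewrite mulrDl mul1r lerDl ltW.
apply: le_trans Ce.
pose vf (p' : plane R -> M) A' t' q := vfield (gder (t' : transversal a) (fr p' (A' * gtm q) a ii))
  ('D_(e_ 0) (fr p' (A' * gtm q) a) ii) ('D_(e_ 1) (fr p' (A' * gtm q) a) ii).
apply: (HG _ _ (vf p1 A1 t1) (vf p A t)) => //; first exact: ltW.
- move=> q /H1[aq tq _ _]; have D := st_is_derive U1 dA1 aq.
  by rewrite /= tq in D.
- move=> q /H[aq tq _ _]; have D := st_is_derive U dA aq.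
  by rewrite /= tq in D.
- move=> q qs; have [_ _ x1 D1] := H1 q qs; have [_ _ x0 D0] := H q qs.
  have [n1 n2 n3] := le_mk3 (fr p1 (A1 * gtm q) a ii) ('D_(e_ 0) (fr p1 (A1 * gtm q) a) ii)
    ('D_(e_ 1) (fr p1 (A1 * gtm q) a) ii) (fr p (A * gtm q) a ii)
    ('D_(e_ 0) (fr p (A * gtm q) a) ii) ('D_(e_ 1) (fr p (A * gtm q) a) ii).
  rewrite -/(st p1 A1 a q) -/(st p A a q) in n1 n2 n3.
  set Y := `|st p1 A1 a q - st p A a q| in n1 n2 n3 *.
  have Y0 : 0 <= Y by exact: normr_ge0.
  have g1 := HK _ x1.
  have g01 := gt1 _ x0.
  have g0 : `|gder t (fr p (A * gtm q) a ii)| <= K + 1.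
    rewrite -[gder _ _](subrK (gder t1 (fr p (A * gtm q) a ii))) addrC.
    by apply: le_trans (ler_normD _ _) _; apply: lerD; [exact: HK|exact: le_trans d1].
  have Yd : Y <= (1 + K) * Y + d.
    by rewrite mulrDl mul1r -addrA lerDl addr_ge0// ?mulr_ge0// ltW.
  apply: (@le_trans _ _ (L * ((1 + K) * Y + d))); last by rewrite mulrDr mulrA lerD2l.
  have g1' : `|gder t1 (fr p1 (A1 * gtm q) a ii)| <= C'.
    by apply: le_trans g1 _; apply: le_trans KC'; rewrite lerDl.
  have gg : `|gder t1 (fr p1 (A1 * gtm q) a ii) - gder t (fr p (A * gtm q) a ii)|
      <= (1 + K) * Y + d.
    rewrite -(subrKA (gder t1 (fr p (A * gtm q) a ii))).
    apply: le_trans (ler_normD _ _) _; apply: lerD; last by rewrite distrC.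
    apply: le_trans (HKl _ _ x1 x0) _; rewrite mulrDl mul1r; apply: ler_wpDl => //.
    exact: ler_wpM2l.
  exact: (HL _ _ _ _ _ _ _ g1' (le_trans g0 KC') (le_trans (D1 0) CC') (le_trans (D0 0) CC')
    (le_trans (D1 1) CC') (le_trans (D0 1) CC') gg (le_trans n2 Yd) (le_trans n3 Yd)).
- by rewrite (st_init U1 dA1 fu1 au1) (st_init U dA fu au).
Qed.

End LocalFlow2.

(** * The action of SL(2,R) *)

Section Rotations.
Context {R : realType}.

Definition rt (c s : R) : 'M[R]_2 := mx2 c (- s) s c.

Lemma det_rt c s : c ^+ 2 + s ^+ 2 = 1 -> \det (rt c s) = 1.
Proof. by move=> <-; rewrite det2E !mx2E; ring. Qed.

Lemma rt_ii c s : c ^+ 2 + s ^+ 2 = 1 -> mobius (rt c s) ii = ii.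
Proof.
move=> cs; have cs2 : (s * 0 + c) ^+ 2 + (s * 1) ^+ 2 = 1 by rewrite mulr0 add0r mulr1.
rewrite /mobius det_rt// !mx2E !hpoint0 !hpoint1 cs2 !divr1 mulr1.
by congr hpoint; ring.
Qed.

(* The left rotation is the one that diagonalizes [B *m B^T]. *)
Lemma cartan (B : 'M[R]_2) : \det B = 1 -> exists c s p c' s',
  [/\ c ^+ 2 + s ^+ 2 = 1, c' ^+ 2 + s' ^+ 2 = 1, 0 < p &
      B = rt c s * gd p * rt c' s'].
Proof.
move=> dB; set x := B 0 0; set y := B 0 1; set z := B 1 0; set w := B 1 1.
have dB' : x * w - y * z = 1 by rewrite -dB det2E.
have [c [s [cs diag]]] : exists c s, c ^+ 2 + s ^+ 2 = 1 /\
    (c * x + s * z) * (c * z - s * x) + (c * y + s * w) * (c * w - s * y) = 0.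
  (* [h] and [b] are the entries of the trace-free part of [B *m B^T]; it has the eigenvector
     [(h + q, b)] with eigenvalue [q], normalized below to [(c, s)]. *)
  pose h := (x ^+ 2 + y ^+ 2 - z ^+ 2 - w ^+ 2) / 2; pose b := x * z + y * w.
  have E c s : (c * x + s * z) * (c * z - s * x) + (c * y + s * w) * (c * w - s * y) =
      b * (c ^+ 2 - s ^+ 2) - 2 * h * (c * s) by rewrite /h /b; field.
  have [b0|bn] := eqVneq b 0.
    by exists 1, 0; split; rewrite ?E ?b0; ring.
  pose q := Num.sqrt (h ^+ 2 + b ^+ 2).
  have q2 : q ^+ 2 = h ^+ 2 + b ^+ 2 by rewrite sqr_sqrtr// addr_ge0 ?sqr_ge0.
  have n0 : 0 < (h + q) ^+ 2 + b ^+ 2.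
    by rewrite ltr_wpDl ?sqr_ge0// lt_neqAle eq_sym sqrf_eq0 bn sqr_ge0.
  pose n := Num.sqrt ((h + q) ^+ 2 + b ^+ 2).
  have n2 : n ^+ 2 = (h + q) ^+ 2 + b ^+ 2 by rewrite sqr_sqrtr// ltW.
  have nn : n != 0 by rewrite gt_eqF// sqrtr_gt0.
  exists ((h + q) / n), (b / n); split.
    by rewrite !expr_div_n -mulrDl -n2 mulfV// expf_neq0.
  rewrite E; have -> : b * (((h + q) / n) ^+ 2 - (b / n) ^+ 2) - 2 * h * ((h + q) / n * (b / n)) =
      b * (q ^+ 2 - h ^+ 2 - b ^+ 2) / n ^+ 2 by field.
  by rewrite q2; ring.
pose x' := c * x + s * z; pose y' := c * y + s * w.
pose z' := c * z - s * x; pose w' := c * w - s * y.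
have orth : x' * z' + y' * w' = 0 by [].
have d1 : x' * w' - y' * z' = 1.
  transitivity ((c ^+ 2 + s ^+ 2) * (x * w - y * z)); last by rewrite cs dB' mulr1.
  by rewrite /x' /y' /z' /w'; ring.
have N0 : 0 < x' ^+ 2 + y' ^+ 2.
  rewrite lt_neqAle addr_ge0 ?sqr_ge0// andbT eq_sym; apply/eqP => /eqP.
  rewrite paddr_eq0 ?sqr_ge0// !sqrf_eq0 => /andP[/eqP x0 /eqP y0].
  by move: d1; rewrite x0 y0 !mul0r subr0 => /eqP; rewrite eq_sym oner_eq0.
pose p := Num.sqrt (x' ^+ 2 + y' ^+ 2).
have p0 : 0 < p by rewrite sqrtr_gt0.
have p2 : p ^+ 2 = x' ^+ 2 + y' ^+ 2 by rewrite sqr_sqrtr// ltW.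
have pn : p != 0 by rewrite gt_eqF.
have zE : z' * p ^+ 2 = - y'.
  rewrite p2; transitivity (x' * (x' * z' + y' * w') - y' * (x' * w' - y' * z')); first by ring.
  by rewrite orth d1; ring.
have wE : w' * p ^+ 2 = x'.
  rewrite p2; transitivity (y' * (x' * z' + y' * w') + x' * (x' * w' - y' * z')); first by ring.
  by rewrite orth d1; ring.
have xR : x = c * x' - s * z' by rewrite /x' /z' -[LHS]mul1r -cs; ring.
have yR : y = c * y' - s * w' by rewrite /y' /w' -[LHS]mul1r -cs; ring.
have zR : z = s * x' + c * z' by rewrite /x' /z' -[LHS]mul1r -cs; ring.
have wR : w = s * y' + c * w' by rewrite /y' /w' -[LHS]mul1r -cs; ring.
exists c, s, p, (x' / p), (- (y' / p)); split => //.
  by rewrite sqrrN !expr_div_n -mulrDl -p2 mulfV// expf_neq0.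
have zz : z' = - y' / p ^+ 2 by rewrite -zE mulfK// expf_neq0.
have ww : w' = x' / p ^+ 2 by rewrite -wE mulfK// expf_neq0.
clearbody x' y' z' w' p.
apply: mx2_eq; rewrite !(mul2E _ (rt _ _)) !(mul2E (rt c s) (gd p)) !mx2E -/x -/y -/z -/w.
- by rewrite xR zz; field.
- by rewrite yR ww; field.
- by rewrite zR zz; field.
- by rewrite wR ww; field.
Qed.

End Rotations.

Lemma pow_unbounded_nat {R : realType} (x : R) : exists n : nat, x <= n.+1%:R.
Proof.
exists (Num.truncn `|x|); apply: le_trans (ler_norm x) _.
by apply: ltW; rewrite truncnS_gt.
Qed.

Section Translations.
Context {R : realType} (M : metricType R) (F : riemannian_lamination M).

Lemma fr_rt G p L A (a : chart F) c s : uniformization F G p L -> \det A = 1 ->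
  c ^+ 2 + s ^+ 2 = 1 -> chart_dom a (p (mobius A ii)) ->
  'D_(e_ 1) (fr p (A * rt c s) a) ii =
    (2 * c * s) *: 'D_(e_ 0) (fr p A a) ii + (c ^+ 2 - s ^+ 2) *: 'D_(e_ 1) (fr p A a) ii.
Proof.
move=> U dA cs aA; have Hi := @ii_half R; have dR := det_rt cs.
have [dm Dm] := mobius_der (e_ 1) dR Hi.
have Emd : mder (rt c s) ii (e_ 1) = hpoint (2 * c * s) (c ^+ 2 - s ^+ 2).
  rewrite mder_ii !e_E !mx2E; have -> : c ^+ 2 + s ^+ 2 = 1 := cs.
  by rewrite expr1n !divr1 !mulr0 !mulr1 !add0r.
have df' : differentiable (fr p A a) ii by exact: fr_differentiable U _ _ _ dA Hi aA.
have df : differentiable (fr p A a) (mobius (rt c s) ii) by rewrite rt_ii.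
have near_comp : \forall z \near ii, fr p (A * rt c s) a z = (fr p A a \o mobius (rt c s)) z.
  by apply: filterS (near_half Hi) => z Hz; rewrite /fr /= mobius_comp.
transitivity ('D_(hpoint (2 * c * s) (c ^+ 2 - s ^+ 2)) (fr p A a) ii).
  rewrite (derive_near_eq _ near_comp); apply: etrans (derive_comp _ dm df) _.
  by rewrite Dm Emd rt_ii.
by apply: etrans (derive_plane _ df') _; rewrite hpoint0 hpoint1.
Qed.

(** A rotation fixes the base point and replaces the vector by a combination of itself and its
    normal, with constant coefficients. *)
Lemma rt_continuous c s (u : unit_tangent F) : c ^+ 2 + s ^+ 2 = 1 ->
  continuous_translation (rt c s) u.
Proof.
move=> cs w rw V nV; have [a au] := chart_cover F (ut_base u).
pose vec (u : unit_tangent F) := (2 * c * s) *: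
  normal (metric (chart_map a (ut_base u)).1 (chart_map a (ut_base u)).2) (ut_vec u a)
  + (c ^+ 2 - s ^+ 2) *: ut_vec u a.
have key u' w' : chart_dom a (ut_base u') -> right_translation (rt c s) u' w' ->
    ut_base w' = ut_base u' /\ ut_vec w' a = vec u'.
  move=> au' [G [p [A [U dA fu fw]]]].
  have bu := frame_base fu; have bw := frame_base fw; have Hi := @ii_half R.
  rewrite (mobius_comp dA (det_rt cs) Hi) rt_ii// -bu in bw.
  have aw' : chart_dom a (ut_base w') by rewrite bw.
  split => //; rewrite (frame_vec fw aw') (fr_rt U dA cs) -?bu//.
  have E := st_init U dA fu au'; rewrite /st /init gtm0 mulr1 in E.
  have [_ h1 h2] := le_mk3 (fr p A a ii) ('D_(e_ 0) (fr p A a) ii) ('D_(e_ 1) (fr p A a) ii)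
    (chart_map a (ut_base u')).1
    (normal (metric (chart_map a (ut_base u')).1 (chart_map a (ut_base u')).2) (ut_vec u' a))
    (ut_vec u' a).
  rewrite E subrr normr0 !normr_le0 !subr_eq0 in h1 h2.
  by rewrite (eqP h1) (eqP h2).
have [bw vw] := key u w au rw.
have aw : chart_dom a (ut_base w) by rewrite bw.
have [P nP PV] := nbhs_chart nV aw.
have cv : {for u, continuous vec}.
  have cc (k : R) (f : unit_tangent F -> plane R) i : {for u, continuous f} ->
      {for u, continuous (fun u => k * f u 0 i)}.
    by move=> cf; apply: contM; [exact: cst_continuous|exact: ventry_cont].
  have cn := normal_ut_cont au; have cu := ut_vec_cont au.
  apply: (eq_cont (fun u => esym (hpoint_lin _ _ _ _))).
  by apply: vec_cont; apply: contD; exact: cc.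
have nu : \forall u' \near u, P (ut_base u', vec u').
  have := cvg_pair (@ut_base_cont _ _ F u) cv; apply.
  by rewrite /= -bw -vw.
have na : \forall u' \near u, chart_dom a (ut_base u') := ut_base_cont (near_dom au).
exists [set u' | P (ut_base u', vec u') /\ chart_dom a (ut_base u')].
  by apply: filterS2 nu na.
move=> u' w' [Pu' au'] /(key _ _ au')[bw' vw'].
by apply: PV; rewrite ?vw' bw'.
Qed.

Definition good (B : 'M[R]_2) := forall u : unit_tangent F, continuous_translation B u.

Lemma leaf_unif G p A (u v : unit_tangent F) : \det A = 1 ->
  uniformization F G p (leaf F (ut_base u)) -> frame_at p A v ->
  leaf F (ut_base v) = leaf F (ut_base u).
Proof.
move=> dA U fv; apply: leaf_eq; rewrite (frame_base fv).
have [_ <- _ _] := U; exists (mobius A ii) => //.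
exact: mobius_half dA (@ii_half R).
Qed.

Lemma translation_mul B B' (u w : unit_tangent F) : \det B = 1 ->
  right_translation (B * B') u w ->
  exists2 v, right_translation B u v & right_translation B' v w.
Proof.
move=> dB [G [p [A [U dA fu fw]]]]; have dAB := det_mul1 dA dB.
have [v fv] := frame_exists U dAB; exists v; first by exists G, p, A.
by exists G, p, (A * B); rewrite (leaf_unif dAB U fv) -mulrA.
Qed.

Lemma good_mul B B' : \det B = 1 -> good B -> good B' -> good (B * B').
Proof.
move=> dB gB gB' u w /(translation_mul dB)[v uv vw] V nV.
have [W nW HW] := gB' v w vw V nV.
have [W' nW' HW'] := gB u v uv W nW.
exists W' => // u' w' Wu' /(translation_mul dB)[v' uv' vw'].
exact: HW (HW' _ _ Wu' uv') vw'.
Qed.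

Lemma good1 : good 1.
Proof.
move=> u w [G [p [A [U dA fu fw]]]] V nV; rewrite mulr1 in fw.
rewrite -(frame_unique fu fw) in nV; exists V => // u' w' Vu' [G' [p' [A' [U' dA' fu' fw']]]].
by rewrite mulr1 in fw'; rewrite -(frame_unique fu' fw').
Qed.

Lemma good_rt c s : c ^+ 2 + s ^+ 2 = 1 -> good (rt c s).
Proof. by move=> cs u; exact: rt_continuous. Qed.

Hypothesis hyp : hyperbolic_leaves F.

(** Compactness of the unit tangent bundle makes the time of [local_flow] uniform. *)
Lemma good_small : exists2 r, 0 < r & forall s : R, 0 <= s <= r -> good (gtm s).
Proof.
have /compact_near_coveringP cov := ut_compact hyp.
pose P (r : R) (u : unit_tangent F) :=
  forall s : R, 0 <= s <= r -> continuous_translation (gtm s) u.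
have nP : \forall r \near (0 : R)^'+, [set: unit_tangent F] `<=` P r.
  apply: cov => u _; have [r r0 [W nW HW]] := local_flow u.
  exists (W, [set x | x <= r]) => /=.
    split => //; apply: filterS (nbhs_right_lt r0) => x /ltW //.
  move=> [u' x] /= [Wu' xr] s /andP[s0 sx]; apply: HW => //.
  by rewrite s0 (le_trans sx).
have nP0 : \forall r \near (0 : R)^'+, 0 < r by exact: nbhs_right_gt.
have PF : ProperFilter (0 : R)^'+ := at_right_proper_filter (0 : R).
have [r [HP r0]] := @filter_ex _ _ PF _ (@filterI _ _ PF _ _ nP nP0).
by exists r => // s sr u; exact: HP.
Qed.

Lemma good_gtm (s : R) : 0 <= s -> good (gtm s).
Proof.
move=> s0; have [r r0 Hr] := good_small.
have [n sn] : exists n : nat, s <= r * n.+1%:R.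
  have [n Hn] := pow_unbounded_nat (s / r); exists n.
  by rewrite mulrC -ler_pdivrMr//.
have : good (gtm (s / n.+1%:R)).
  apply: Hr; rewrite divr_ge0 ?ler0n//=.
  by rewrite ler_pdivrMr ?ltr0n.
move: (s / n.+1%:R) (mulfVK (lt0r_neq0 (ltr0Sn R n)) s) => q <- gq.
elim: n.+1 => [|k IH]; first by rewrite mulr0 gtm0; exact: good1.
rewrite -natr1 mulrDr mulr1 gtmD; apply: good_mul => //; exact: det_gtm.
Qed.

Lemma gtm_ln (p : R) : 0 < p -> gtm (2 * ln p) = gd p.
Proof. by move=> p0; rewrite /gtm mulrC mulrA mulVf ?mul1r ?lnK// pnatr_eq0. Qed.

Lemma good_gd (p : R) : 0 < p -> good (gd p).
Proof.
move=> p0; have [p1|p1] := leP 1 p.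
  by rewrite -gtm_ln//; apply: good_gtm; rewrite mulr_ge0// ln_ge0.
have q0 : 0 < p^-1 by rewrite invr_gt0.
have q1 : 1 <= p^-1 by rewrite invr_ge1 ?ltW// unitfE gt_eqF.
(* [rt 0 1] reverses unit vectors, which reduces negative times to positive ones. *)
have -> : gd p = rt 0 1 * gd p^-1 * rt 0 (-1).
  by apply: mx2_eq; rewrite !mul2E !mx2E ?invrK; ring.
have d1 : \det (rt (0 : R) 1) = 1 by apply: det_rt; ring.
have g1 : good (rt 0 1) by apply: good_rt; ring.
have g2 : good (rt 0 (-1)) by apply: good_rt; ring.
have l0 : 0 <= 2 * ln p^-1 by rewrite mulr_ge0// ln_ge0.
have gq := good_gtm l0; rewrite (gtm_ln q0) in gq.
exact: (good_mul (det_mul1 d1 (det_gd q0)) (good_mul d1 g1 gq) g2).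
Qed.

Lemma all_good B : \det B = 1 -> good B.
Proof.
move=> dB; have [c [s [p [c' [s' [cs cs' p0 ->]]]]]] := cartan dB.
have d1 := det_rt cs; have dp := det_gd p0.
apply: good_mul; [exact: det_mul1| |exact: good_rt].
by apply: good_mul => //; [exact: good_rt|exact: good_gd].
Qed.

(** Continuity at [u] itself: every neighbourhood of [w] contains any other translate of [u],
    whatever uniformization was used. *)
Lemma translation_unique B (u w w' : unit_tangent F) : \det B = 1 ->
  right_translation B u w -> right_translation B u w' -> w = w'.
Proof.
move=> dB uw uw'; apply: ut_separated => V nV.
have [W nW HW] := all_good dB uw nV.
by apply: HW uw'; exact: nbhs_singleton.
Qed.

Local Notation act := (@psl2_action R M F).

Lemma leaf_frame (u : unit_tangent F) : exists G p A,
  [/\ uniformization F G p (leaf F (ut_base u)), \det A = 1 & frame_at p A u].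
Proof.
have [G [p U]] := hyp (ut_base u).
have [A dA fA] := frame_surj U (same_leaf_refl F (ut_base u)).
by exists G, p, A.
Qed.

Lemma act_translation (u : unit_tangent F) B : \det B = 1 -> right_translation B u (act u B).
Proof.
move=> dB; rewrite /psl2_action; apply: (@xgetPex _ u [set w | right_translation B u w]).
have [G [p [A [U dA fA]]]] := leaf_frame u.
have [w fw] := frame_exists U (det_mul1 dA dB).
by exists w; exists G, p, A.
Qed.

Lemma act_eq (u w : unit_tangent F) B : \det B = 1 -> right_translation B u w -> act u B = w.
Proof. by move=> dB; apply: translation_unique dB (act_translation u dB). Qed.

Lemma act_frame G p A (u : unit_tangent F) B :
  uniformization F G p (leaf F (ut_base u)) -> \det A = 1 -> \det B = 1 ->
  frame_at p A u -> frame_at p (A * B) (act u B).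
Proof.
move=> U dA dB fu; have [w fw] := frame_exists U (det_mul1 dA dB).
by rewrite (@act_eq u w B dB)//; exists G, p, A.
Qed.

Lemma act1 (u : unit_tangent F) : act u 1 = u.
Proof.
have [G [p [A [U dA fA]]]] := leaf_frame u.
by apply: act_eq; [exact: det1|exists G, p, A; rewrite mulr1].
Qed.

Lemma actM (u : unit_tangent F) A B : \det A = 1 -> \det B = 1 ->
  act (act u A) B = act u (A * B).
Proof.
move=> dA dB; apply/esym/act_eq; first exact: det_mul1.
have [G [p [C [U dC fC]]]] := leaf_frame u.
exists G, p, C; split => //; rewrite mulrA.
have fuA := act_frame U dC dA fC.
have U' := U; rewrite -(leaf_unif (det_mul1 dC dA) U fuA) in U'.
exact: (act_frame U' (det_mul1 dC dA) dB fuA).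
Qed.

Lemma frame_opp p A (u : unit_tangent F) : frame_at p A u -> frame_at p (- A) u.
Proof.
have E : mobius (- A) = mobius A by apply/funext => z; exact: mobius_opp.
by move=> [bu vu]; split; rewrite E.
Qed.

Lemma actN (u : unit_tangent F) : act u (- 1) = u.
Proof.
have [G [p [A [U dA fA]]]] := leaf_frame u.
have dN : \det (- 1 : 'M[R]_2) = 1 by rewrite det2E !opp2E !one2E; ring.
by apply: act_eq => //; exists G, p, A; split => //; rewrite mulrN1; exact: frame_opp.
Qed.

Lemma act_cont B : \det B = 1 -> continuous (act^~ B).
Proof.
move=> dB u V nV; have [W nW HW] := all_good dB (act_translation u dB) nV.
by apply: filterS nW => u' Wu' /=; exact: HW Wu' (act_translation u' dB).
Qed.

Lemma act_gtm (u : unit_tangent F) V : nbhs u V -> exists2 e, 0 < e &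
  exists2 W, nbhs u W & forall v q, W v -> 1 <= q -> q - 1 < e -> V (act v (gd q)).
Proof.
move=> nV; have [r r0 [W nW HW]] := local_small nV.
have er : 1 < expR (r / 2) by rewrite expR_gt1 divr_gt0.
exists (expR (r / 2) - 1); first by rewrite subr_gt0.
exists W => // v q Wv q1; rewrite ltrBlDr subrK => qe.
have q0 : 0 < q by exact: lt_le_trans q1.
apply: (HW (2 * ln q) v) => //; last first.
  by rewrite gtm_ln//; apply: act_translation; exact: det_gd.
rewrite mulr_ge0 ?ln_ge0//= mulrC -ler_pdivlMr//.
by rewrite -ler_expR lnK// ltW.
Qed.

Lemma act_diag (u : unit_tangent F) V : nbhs u V -> exists2 e, 0 < e &
  exists2 W, nbhs u W & forall v q, W v -> 0 < q -> `|q - 1| < e -> V (act v (gd q)).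
Proof.
move=> nV; have [e1 e10 [W1 nW1 H1]] := act_gtm nV.
have d1 : \det (rt (0 : R) 1) = 1 by apply: det_rt; ring.
have d2 : \det (rt (0 : R) (-1)) = 1 by apply: det_rt; ring.
have r12 : rt 0 1 * rt 0 (-1) = 1 :> 'M[R]_2.
  by apply: mx2_eq; rewrite mul2E !mx2E one2E; ring.
have nV' : nbhs (act u (rt 0 1)) (act^~ (rt 0 (-1)) @^-1` V).
  by apply: (act_cont d2); rewrite actM// r12 act1.
have [e2 e20 [W2 nW2 H2]] := act_gtm nV'.
(* For [1 / 2 < q < 1] and [1 - q < e2 / 2] the inverse satisfies [q^-1 - 1 < e2], as needed after
   reversing the vector. *)
pose e := Num.min e1 (Num.min (e2 / 2) (2^-1)).
have e0 : 0 < e by rewrite !lt_min e10 divr_gt0// invr_gt0 ltr0n.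
have ee1 : e <= e1 by rewrite ge_min lexx.
have ee2 : e <= e2 / 2 by rewrite /e !ge_min lexx orbT.
have ee3 : e <= 2^-1 by rewrite /e !ge_min lexx !orbT.
exists e => //; exists (W1 `&` (act^~ (rt 0 1) @^-1` W2)).
  by apply: filterI => //; exact: act_cont.
move=> v q [W1v W2v] q0 qe; have [q1|q1] := leP 1 q.
  apply: H1 => //; rewrite ger0_norm ?subr_ge0// in qe; exact: lt_le_trans ee1.
have qi : 1 <= q^-1 by rewrite invr_ge1 ?ltW// unitfE gt_eqF.
have qn : q != 0 by rewrite gt_eqF.
have -> : gd q = rt 0 1 * (gd q^-1 * rt 0 (-1)).
  by apply: mx2_eq; rewrite !mul2E !mx2E ?invrK; ring.
have dq : \det (gd q^-1) = 1 by apply: det_gd; rewrite invr_gt0.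
rewrite -actM//; last exact: det_mul1.
rewrite -actM//; apply: H2 => //.
rewrite ltr0_norm ?subr_lt0// in qe.
have q2 : 2^-1 < q by move: qe ee3; clear; lra.
have -> : q^-1 - 1 = (1 - q) / q by field.
by rewrite ltr_pdivrMr//; move: qe ee2 q2 e20; clear; nra.
Qed.

End Translations.

Section OrbitMap.
Context {R : realType} (M : metricType R) (F : riemannian_lamination M).

Lemma contV (T : topologicalType) (f : T -> R) x : {for x, continuous f} -> f x != 0 ->
  {for x, continuous (fun y => (f y)^-1)}.
Proof. by move=> cf f0; exact: (cvgV f0 cf). Qed.

Lemma mx_entry_cont (A : 'M[R]_2) i j : {for A, continuous (fun B : 'M[R]_2 => B i j)}.
Proof. exact: coord_continuous. Qed.

Lemma bottom_gt0 (A : 'M[R]_2) : \det A = 1 -> 0 < A 1 1 ^+ 2 + A 1 0 ^+ 2.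
Proof.
rewrite det2E => dA; rewrite lt_neqAle addr_ge0 ?sqr_ge0// andbT eq_sym.
apply/eqP => /eqP; rewrite paddr_eq0 ?sqr_ge0// !sqrf_eq0 => /andP[/eqP d0 /eqP c0].
by move: dA; rewrite c0 d0 !mulr0 subr0 => /eqP; rewrite eq_sym oner_eq0.
Qed.

Lemma mobius_ii_cont (A : 'M[R]_2) : \det A = 1 ->
  {for A, continuous (fun B : 'M[R]_2 => mobius B ii)}.
Proof.
move=> dA; have E i j := @mx_entry_cont A i j.
have N0 : (A 1 0 * (ii : plane R) 0 0 + A 1 1) ^+ 2 + (A 1 0 * (ii : plane R) 0 1) ^+ 2 != 0.
  by rewrite hpoint0 hpoint1 mulr0 add0r mulr1 gt_eqF// bottom_gt0.
have cd : {for A, continuous (fun B : 'M[R]_2 => \det B)} by apply: det_cont => V.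
have ck k : {for A, continuous (fun B : 'M[R]_2 => k : R)} by exact: cst_continuous.
have cN : {for A, continuous (fun B : 'M[R]_2 =>
    (B 1 0 * (ii : plane R) 0 0 + B 1 1) ^+ 2 + (B 1 0 * (ii : plane R) 0 1) ^+ 2)}.
  by apply: contD; apply: contM; do ?apply: contD => //; apply: contM.
apply: vec_cont; apply: contM; try (by apply: contV); last by apply: contM.
by do ?[apply: contD|apply: contM].
Qed.

Lemma mder_ii_cont (A : 'M[R]_2) v : \det A = 1 ->
  {for A, continuous (fun B : 'M[R]_2 => mder B ii v)}.
Proof.
move=> dA; have E i j := @mx_entry_cont A i j.
have ck k : {for A, continuous (fun B : 'M[R]_2 => k : R)} by exact: cst_continuous.
have cN : {for A, continuous (fun B : 'M[R]_2 => ((B 1 1 ^+ 2 + B 1 0 ^+ 2) ^+ 2)^-1)}.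
  apply: contV; last by rewrite expf_neq0// gt_eqF// bottom_gt0.
  by apply: contM; apply: contD; apply: contM.
apply: (eq_cont (fun B => mder_ii B v)).
apply: vec_cont; apply: contD; apply: contM => //; do ?apply: contN; apply: contM => //;
  try (by apply: contM => //; apply: contM); apply: contD; do ?apply: contN; by apply: contM.
Qed.

Lemma frame_near G p L A (w : unit_tangent F) V : uniformization F G p L -> \det A = 1 ->
  frame_at p A w -> nbhs w V ->
  \forall B \near A, \det B = 1 -> forall w', frame_at p B w' -> V w'.
Proof.
move=> U dA fw nV; have [a aw] := chart_cover F (ut_base w).
have bw := frame_base fw; have aA : chart_dom a (p (mobius A ii)) by rewrite -bw.
have [P nP PV] := nbhs_chart nV aw.
have HA := mobius_half dA (@ii_half R).
pose f (z : plane R) := (chart_map a (p z)).1.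
pose vec (B : 'M[R]_2) := hpoint
  (mder B ii (e_ 1) 0 0 * 'D_(e_ 0) f (mobius B ii) 0 0 +
   mder B ii (e_ 1) 0 1 * 'D_(e_ 1) f (mobius B ii) 0 0)
  (mder B ii (e_ 1) 0 0 * 'D_(e_ 0) f (mobius B ii) 0 1 +
   mder B ii (e_ 1) 0 1 * 'D_(e_ 1) f (mobius B ii) 0 1).
have vecE B w' : \det B = 1 -> frame_at p B w' -> chart_dom a (ut_base w') ->
    ut_vec w' a = vec B.
  move=> dB fw' aw'; have aB : chart_dom a (p (mobius B ii)) by rewrite -(frame_base fw').
  rewrite (frame_vec fw' aw'); have Hi := @ii_half R.
  apply: etrans (fr_der_at U dB _ Hi aB) _.
  have df : differentiable f (mobius B ii).
    exact: nbhs_singleton (unif_diff2 U (mobius_half dB Hi) aB).1.1.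
  apply: etrans (derive_plane _ df) _; exact: esym (hpoint_lin _ _ _ _).
have cm := mobius_ii_cont dA; have cv := @mder_ii_cont A (e_ 1) dA.
have cD i : {for A, continuous (fun B => 'D_(e_ i) f (mobius B ii))}.
  apply: (@continuous_comp _ _ _ (fun B : 'M[R]_2 => mobius B ii) ('D_(e_ i) f)) => //.
  exact: (unif_diff2 U HA aA).2.
have cvec : {for A, continuous vec}.
  by apply: vec_cont; apply: contD; apply: contM; exact: ventry_cont.
have cb : {for A, continuous (fun B : 'M[R]_2 => p (mobius B ii))}.
  apply: (@continuous_comp _ _ _ (fun B : 'M[R]_2 => mobius B ii) p) => //.
  exact: (unif_cont U HA).
have n1 : \forall B \near A, P (p (mobius B ii), vec B).
  have := cvg_pair cb cvec; apply; rewrite /= -bw.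
  by rewrite -(vecE A w dA fw aw).
have n2 : \forall B \near A, chart_dom a (p (mobius B ii)) := cb _ (near_dom aA).
apply: filterS2 n1 n2 => B PB aB dB w' fw'; have bw' := frame_base fw'.
have aw' : chart_dom a (ut_base w') by rewrite bw'.
by apply: PV => //; rewrite (vecE B w' dB fw' aw') bw'.
Qed.

End OrbitMap.

(** * Stabilizers *)

Section Stabilizers.
Context {R : realType}.

Lemma norm_mul2 (A B : 'M[R]_2) : `|A * B| <= 2 * `|A| * `|B|.
Proof.
apply: norm_mx_le => i j; rewrite mul2E.
apply: le_trans (ler_normD _ _) _; rewrite !normrM -mulrA mulr_natl mulr2n.
by apply: lerD; apply: ler_pM => //; exact: coord_le.
Qed.

Lemma fix_ii (A : 'M[R]_2) : \det A = 1 -> mobius A ii = ii -> exists c s,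
  c ^+ 2 + s ^+ 2 = 1 /\ A = rt c s.
Proof.
move=> dA Aii; have N0 := bottom_gt0 dA.
have h1 : A 1 1 ^+ 2 + A 1 0 ^+ 2 = 1.
  have := congr1 (fun z : plane R => z 0 1) Aii.
  rewrite /mobius dA !hpoint1 !hpoint0 mulr0 add0r !mulr1 => h.
  by rewrite -[LHS]invrK -[X in X^-1]mul1r h invr1.
have h0 : A 0 1 * A 1 1 + A 0 0 * A 1 0 = 0.
  have := congr1 (fun z : plane R => z 0 0) Aii.
  rewrite /mobius dA !hpoint1 !hpoint0 !mulr0 !add0r !mulr1 h1 divr1 => <-.
  by rewrite expr1n mulr1.
rewrite det2E in dA; exists (A 1 1), (A 1 0); split => //.
apply: mx2_eq; rewrite !mx2E //.
  transitivity (A 0 0 * (A 1 1 ^+ 2 + A 1 0 ^+ 2)); first by rewrite h1 mulr1.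
  transitivity (A 1 1 * (A 0 0 * A 1 1 - A 0 1 * A 1 0)
    + A 1 0 * (A 0 1 * A 1 1 + A 0 0 * A 1 0)); first by ring.
  by rewrite dA h0; ring.
transitivity (A 0 1 * (A 1 1 ^+ 2 + A 1 0 ^+ 2)); first by rewrite h1 mulr1.
transitivity (A 1 1 * (A 0 1 * A 1 1 + A 0 0 * A 1 0)
  - A 1 0 * (A 0 0 * A 1 1 - A 0 1 * A 1 0)); first by ring.
by rewrite dA h0; ring.
Qed.

Lemma same_ii (A B : 'M[R]_2) : \det A = 1 -> \det B = 1 -> mobius A ii = mobius B ii ->
  exists c s, c ^+ 2 + s ^+ 2 = 1 /\ B = A * rt c s.
Proof.
move=> dA dB E; have dA' : \det (adj2 A) = 1 by rewrite det_adj2.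
have Hi := @ii_half R.
have E' : mobius (adj2 A * B) ii = ii.
  by rewrite mobius_comp// -E -mobius_comp// adj2Kl// mobius_id.
have [c [s [cs D]]] := fix_ii (det_mul1 dA' dB) E'.
by exists c, s; split => //; rewrite -D mulrA adj2K// mul1r.
Qed.

Lemma orthonormal_rotation (g : 'M[R]_2) (u v : plane R) (c s : R) :
  bilinear_form g u u = 1 -> bilinear_form g u v = 0 -> bilinear_form g v u = 0 ->
  bilinear_form g v v = 1 -> c ^+ 2 + s ^+ 2 = 1 ->
  v = (2 * c * s) *: u + (c ^+ 2 - s ^+ 2) *: v -> s = 0 /\ c ^+ 2 = 1.
Proof.
move=> uu uv vu vv cs E.
have c1 : c ^+ 2 - s ^+ 2 = 1.
  have := congr1 (bilinear_form g v) E.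
  by rewrite bilinearDr !bilinearZr vu vv mulr0 add0r mulr1 => <-.
have s0 : s ^+ 2 = 0 by move: cs c1; clear; lra.
by split; [apply/eqP; rewrite -sqrf_eq0 s0|move: cs; rewrite s0 addr0].
Qed.

Lemma rt_le1 (c s : R) : c ^+ 2 + s ^+ 2 = 1 -> `|rt c s| <= 1.
Proof.
move=> cs; have c1 : `|c| <= 1.
  by rewrite -(@ler_pXn2r _ 2%N) ?nnegrE ?normr_ge0 ?ler01 // expr1n real_normK ?num_real // -cs lerDl sqr_ge0.
have s1 : `|s| <= 1.
  by rewrite -(@ler_pXn2r _ 2%N) ?nnegrE ?normr_ge0 ?ler01 // expr1n real_normK ?num_real // -cs lerDr sqr_ge0.
by apply: norm_mx_le; apply: ord2P; apply: ord2P; rewrite !mx2E ?normrN.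
Qed.

End Stabilizers.

Section LeafGroup.
Context {R : realType} (M : metricType R) (F : riemannian_lamination M).
Variables (G : set 'M[R]_2) (p : plane R -> M) (L : set M).
Hypothesis U : uniformization F G p L.

Lemma group_det A : G A -> \det A = 1.
Proof. by have [[H _ _ _ _] _ _ _] := U; exact: H. Qed.

Lemma group_mul A B : G A -> G B -> G (A * B).
Proof. by have [[_ _ H _ _] _ _ _] := U => GA GB; exact: (H A B GA GB).1. Qed.

Lemma group_adj2 A : G A -> G (adj2 A).
Proof.
move=> GA; rewrite -(invmx_adj2 (group_det GA)).
by have [[_ _ H _ _] _ _ _] := U; exact: (H A A GA GA).2.
Qed.

Lemma group_one : G 1.
Proof. by have [[_ [H _] _ _ _] _ _ _] := U. Qed.

Lemma group_opp A : G A -> G (- A).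
Proof.
move=> GA; rewrite -mulN1r; apply: group_mul => //.
by have [[_ [_ H] _ _ _] _ _ _] := U.
Qed.

Lemma group_exp A n : G A -> G (A ^+ n).
Proof.
move=> GA; elim: n => [|n IH]; first by rewrite expr0; exact: group_one.
by rewrite exprS; exact: group_mul.
Qed.

Lemma group_pair C (k : nat -> 'M[R]_2) : (forall n, G (k n) /\ `|k n| <= C) ->
  exists i j, (i < j)%N /\ k i = k j.
Proof.
have [[_ _ _ [e e0 He] _] _ _ _] := U.
apply: (@discrete_pair _ G e C k e0) => //; first exact: group_det.
by move=> A B GA GB; exact: group_mul (group_adj2 GA) GB.
Qed.

Lemma unif_group A z : G A -> half_plane z -> p (mobius A z) = p z.
Proof.
move=> GA Hz; have [_ _ H _] := U.
by apply/esym/H => //; [exact: mobius_half (group_det GA) Hz|exists A].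
Qed.

Lemma unif_eq A B : \det A = 1 -> \det B = 1 -> p (mobius A ii) = p (mobius B ii) ->
  exists2 g, G g & mobius B ii = mobius (g * A) ii.
Proof.
move=> dA dB E; have Hi := @ii_half R; have [_ _ H _] := U.
have [g Gg Eg] := (H _ _ (mobius_half dA Hi) (mobius_half dB Hi)).1 E.
by exists g; rewrite // mobius_comp//; exact: group_det.
Qed.

Lemma frame_group g A (u : unit_tangent F) : G g -> \det A = 1 -> frame_at p A u ->
  frame_at p (g * A) u.
Proof.
move=> Gg dA [bu vu]; have Hi := @ii_half R; have dg := group_det Gg.
split; first by rewrite mobius_comp// unif_group//; exact: mobius_half.
move=> a au; rewrite vu//; apply: derive_near_eq.
apply: filterS (near_half Hi) => z Hz.
by rewrite (mobius_comp dg dA Hz) (unif_group Gg (mobius_half dA Hz)).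
Qed.

(** Equality of base points gives [B = g * A * rt c s] with [g] in [G]; equality of the vectors
    forces the rotation to be [1] or [- 1], and [- g] is also in [G]. *)
Lemma frame_eq A B (u : unit_tangent F) : \det A = 1 -> \det B = 1 ->
  frame_at p A u -> frame_at p B u -> exists2 g, G g & B = g * A.
Proof.
move=> dA dB fA fB.
have E : p (mobius A ii) = p (mobius B ii) by rewrite -(frame_base fA) (frame_base fB).
have [g Gg Eg] := unif_eq dA dB E; have dg := group_det Gg.
have dgA := det_mul1 dg dA.
have [c [s [cs D]]] := same_ii dgA dB (esym Eg).
have fgA := frame_group Gg dA fA.
have [a au] := chart_cover F (ut_base u).
have aA : chart_dom a (p (mobius (g * A) ii)) by rewrite -(frame_base fgA).
have V1 := frame_vec fgA au; have V2 := frame_vec fB au.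
rewrite D (fr_rt U dgA cs aA) V1 in V2.
have O i j := @fr_orthonormal _ _ _ _ _ _ U _ a dgA aA i j.
have [s0 c2] := orthonormal_rotation (O 0 0) (O 0 1) (O 1 0) (O 1 1) cs V2.
move: c2.
move=> /eqP; rewrite sqrf_eq1 => /orP[] /eqP ec; rewrite ec s0 in D.
  exists g => //; rewrite D; have -> : rt 1 0 = 1 :> 'M[R]_2.
    by apply: mx2_eq; rewrite !mx2E !one2E ?oppr0.
  by rewrite mulr1.
exists (- g); first exact: group_opp.
rewrite D; have -> : rt (-1) 0 = - 1 :> 'M[R]_2.
  by apply: mx2_eq; rewrite !mx2E !opp2E !one2E ?oppr0.
by rewrite mulrN1 mulNr.
Qed.

End LeafGroup.

(** * The abstract hypotheses for the unit tangent bundle *)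

Section ActionHypotheses.
Context {R : realType} (M : metricType R) (F : riemannian_lamination M).
Hypothesis hyp : hyperbolic_leaves F.
Local Notation act := (@psl2_action R M F).

Lemma act_orbit (u : unit_tangent F) A V : \det A = 1 -> nbhs (act u A) V ->
  exists2 e : R, 0 < e & forall B, \det B = 1 -> `|B - A| < e -> V (act u B).
Proof.
move=> dA nV; have [G [p [C [U dC fC]]]] := leaf_frame hyp u.
have fA := act_frame hyp U dC dA fC.
have /nbhs_ballP[e /= e0 He] := frame_near U (det_mul1 dC dA) fA nV.
have c0 : 0 < 2 * `|C| + 1 by rewrite ltr_wpDl// mulr_ge0.
exists (e / (2 * `|C| + 1)); first by rewrite divr_gt0.
move=> B dB AB; suff nb : ball (C * A) e (C * B).
  exact: (He _ nb (det_mul1 dC dB) _ (act_frame hyp U dC dB fC)).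
rewrite -ball_normE /= distrC -mulrBr; apply: le_lt_trans (norm_mul2 _ _) _.
apply: le_lt_trans (_ : (2 * `|C| + 1) * `|B - A| < e); first by rewrite ler_wpM2r// lerDl.
by rewrite mulrC -ltr_pdivlMr.
Qed.

Lemma act_stab G p A (u : unit_tangent F) g k : uniformization F G p (leaf F (ut_base u)) ->
  \det A = 1 -> \det k = 1 -> frame_at p A u -> G g -> A * k = g * A -> act u k = u.
Proof.
move=> U dA dk fA Gg E; apply: act_eq => //.
by exists G, p, A; split => //; rewrite E; exact: frame_group U _ _ _ Gg dA fA.
Qed.

(** A stabilizer element is a conjugate by [A] of an element of [G]; the denominator bounds the
    distortion of norms under this conjugation. *)
Lemma act_disc (u : unit_tangent F) : exists2 e : R, 0 < e &
  forall k, \det k = 1 -> act u k = u -> `|k - 1| < e -> k = 1.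
Proof.
have [G [p [A [U dA fA]]]] := leaf_frame hyp u.
have [[_ _ _ [e e0 He] _] _ _ _] := U.
have c0 : 0 < 2 * (2 * `|A|) * `|adj2 A| + 1 by rewrite ltr_wpDl// !mulr_ge0.
exists (e / (2 * (2 * `|A|) * `|adj2 A| + 1)); first by rewrite divr_gt0.
move=> k dk uk k1; have fAk := act_frame hyp U dA dk fA; rewrite uk in fAk.
have [g Gg gE] := frame_eq U dA (det_mul1 dA dk) fA fAk.
have gE' : g = A * k * adj2 A by rewrite gE -mulrA adj2K// mulr1.
have g1 : g = 1.
  apply: He => //; have -> : g - 1 = A * (k - 1) * adj2 A.
    by rewrite gE' mulrBr mulr1 mulrBl adj2K.
  apply: le_lt_trans (norm_mul2 _ _) _.
  apply: le_lt_trans (_ : (2 * (2 * `|A|) * `|adj2 A| + 1) * `|k - 1| < e); last first.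
    by rewrite mulrC -ltr_pdivlMr.
  have h := norm_mul2 A (k - 1).
  have : 2 * `|A * (k - 1)| * `|adj2 A| <= 2 * (2 * `|A| * `|k - 1|) * `|adj2 A|.
    by apply: ler_wpM2r => //; apply: ler_wpM2l.
  have -> : 2 * (2 * `|A| * `|k - 1|) * `|adj2 A| = 2 * (2 * `|A|) * `|adj2 A| * `|k - 1| by ring.
  by move=> /le_trans; apply; apply: ler_wpM2r; rewrite ?lerDl.
by rewrite -[k]mul1r -(adj2Kl dA) -mulrA gE g1 mul1r adj2Kl.
Qed.

Lemma upper_transitive (z : plane R) : half_plane z -> exists2 B : 'M[R]_2,
  \det B = 1 /\ B 1 0 = 0 & mobius B ii = z.
Proof.
rewrite half_planeE => z1; pose q := Num.sqrt (z 0 1).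
have q0 : 0 < q by rewrite sqrtr_gt0.
have qn : q != 0 by rewrite gt_eqF.
have q2 : z 0 1 = q ^+ 2 by rewrite sqr_sqrtr// ltW.
have dB : \det (mx2 q (z 0 0 / q) 0 q^-1) = 1 by rewrite det2E !mx2E; field.
exists (mx2 q (z 0 0 / q) 0 q^-1); first by rewrite mx2E.
by rewrite /mobius dB !mx2E !hpoint0 !hpoint1; apply: plane_eq; rewrite hpointE ?q2; field.
Qed.

(** The projection of [Z] to [M] is closed by compactness, and contains a whole leaf since upper
    triangular matrices act transitively on the half-plane; it is therefore all of [M]. A vector of
    [Z] above the base point of [u] lies over the leaf of [u] and is a translate of [u]. *)
Lemma act_leafd (Z : set (unit_tangent F)) : minimal_lamination F -> closed Z -> Z !=set0 ->
  (forall u B, Z u -> \det B = 1 -> B 1 0 = 0 -> Z (act u B)) ->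
  forall u, exists2 C, \det C = 1 & Z (act u C).
Proof.
move=> Fmin cZ [z0 Zz0] uZ u; have Hi := @ii_half R.
have cK : closed (@ut_base _ _ F @` Z).
  apply: compact_closed; first exact: metric_hausdorff.
  apply: continuous_compact.
    by apply: continuous_subspaceT; exact: ut_base_cont.
  by apply: (subclosed_compact cZ (ut_compact hyp)).
have KT m : (@ut_base _ _ F @` Z) m.
  have lK : leaf F (ut_base z0) `<=` @ut_base _ _ F @` Z.
    have [G [p [A [U dA fA]]]] := leaf_frame hyp z0.
    move=> q; have [_ <- _ _] := U; move=> [w Hw <-].
    have dA' : \det (adj2 A) = 1 by rewrite det_adj2.
    have [B [dB B10] Bw] := upper_transitive (mobius_half dA' Hw).
    exists (act z0 B); first exact: uZ.
    rewrite (frame_base (act_frame hyp U dA dB fA)) mobius_comp// Bw -mobius_comp//.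
    by rewrite adj2K// mobius_id.
  have dl : closure (leaf F (ut_base z0)) m.
    by move=> V; rewrite nbhsE => -[W [oW Wm] WV];
      have [q [Wq lq]] := Fmin (ut_base z0) W (ex_intro _ m Wm) oW; exists q; split => //; exact: WV.
  by rewrite closureE in dl; exact: (dl _ (conj cK lK)).
have [z Zz zu] := KT (ut_base u).
have [G [p [A [U dA fA]]]] := leaf_frame hyp u.
have Lz : leaf F (ut_base u) (ut_base z) by rewrite zu; exact: same_leaf_refl.
have [A' dA' fA'] := frame_surj U Lz.
have dC : \det (adj2 A * A') = 1 by apply: det_mul1 => //; rewrite det_adj2.
exists (adj2 A * A') => //.
have := act_frame hyp U dA dC fA; rewrite mulrA adj2K// mul1r => fu.
by rewrite -(frame_unique fA' fu).
Qed.

End ActionHypotheses.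

(** * Coarsely tame leaves *)

Section Matrices.
Context {R : realType}.

Lemma adj2_adj2 (A : 'M[R]_2) : adj2 (adj2 A) = A.
Proof. by apply: mx2_eq; rewrite !mx2E ?opprK. Qed.

Lemma norm_adj2 (A : 'M[R]_2) : `|adj2 A| <= `|A|.
Proof. by apply: norm_mx_le; apply: ord2P; apply: ord2P; rewrite mx2E ?normrN coord_le. Qed.

Lemma trace_conj (c X : 'M[R]_2) : \det c = 1 ->
  (c * X * adj2 c) 0 0 + (c * X * adj2 c) 1 1 = X 0 0 + X 1 1.
Proof.
rewrite det2E => dc; rewrite !(mul2E (c * X)) !(mul2E c X) !mx2E.
by rewrite -[RHS]mul1r -dc; ring.
Qed.

Lemma gtmE (t : R) : gtm t = mx2 (expR (t / 2)) 0 0 (expR (- (t / 2))).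
Proof. by rewrite /gtm /gd expRN. Qed.

Lemma gtm_le (t T : R) : 0 <= t <= T -> `|gtm t| <= expR (T / 2).
Proof.
move=> /andP[t0 tT]; rewrite gtmE.
have h1 : expR (t / 2) <= expR (T / 2) by rewrite ler_expR ler_pM2r ?invr_gt0.
have h2 : expR (- (t / 2)) <= expR (T / 2).
  by rewrite ler_expR; move: t0 tT; clear; lra.
by apply: norm_mx_le; apply: ord2P; apply: ord2P; rewrite mx2E ?normr0 ?expR_ge0 ?gtr0_norm ?expR_gt0.
Qed.

Lemma rt_inv (c s : R) : c ^+ 2 + s ^+ 2 = 1 -> rt c s * rt c (- s) = 1.
Proof.
move=> cs; apply: mx2_eq; rewrite mul2E !mx2E !one2E; try by ring.
  by rewrite -[RHS]cs; ring.
by rewrite -[RHS]cs; ring.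
Qed.

(** With [z] the image of [ii], the squared lengths of the rows of [c] are [|z| ^ 2 / Im z] and
    [1 / Im z]. *)
Lemma frame_bounded (c : 'M[R]_2) (d D : R) : \det c = 1 -> 0 < d -> d <= mobius c ii 0 1 ->
  `|mobius c ii| <= D -> `|c| <= 1 + (d^-1 + D ^+ 2 / d + D).
Proof.
move=> dc d0; have N0 := bottom_gt0 dc; set z := mobius c ii => z1 zD.
set N := c 1 1 ^+ 2 + c 1 0 ^+ 2 in N0.
have Nn : N != 0 by rewrite gt_eqF.
have E1 : z 0 1 = N^-1.
  by rewrite /z /mobius dc !hpoint1 !hpoint0 mulr0 add0r !mulr1 mul1r.
have E0 : z 0 0 = (c 0 1 * c 1 1 + c 0 0 * c 1 0) / N.
  by rewrite /z /mobius dc !hpoint0 !hpoint1 !mulr0 !add0r !mulr1 expr1n mulr1.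
have zp : 0 < z 0 1 by exact: lt_le_trans z1.
have NE : N = (z 0 1)^-1 by rewrite E1 invrK.
have TE : c 0 0 ^+ 2 + c 0 1 ^+ 2 = z 0 0 ^+ 2 / z 0 1 + z 0 1.
  rewrite E0 E1 invrK; apply: (mulfI Nn).
  transitivity ((c 0 1 * c 1 1 + c 0 0 * c 1 0) ^+ 2 + (c 0 0 * c 1 1 - c 0 1 * c 1 0) ^+ 2).
    by rewrite /N; ring.
  by rewrite -det2E dc; field.
have D0 : 0 <= D by apply: le_trans zD.
have b1 : N <= d^-1 by rewrite NE lef_pV2.
have b2 : z 0 0 ^+ 2 / z 0 1 <= D ^+ 2 / d.
  apply: ler_pM; rewrite ?sqr_ge0 ?invr_ge0 ?(ltW zp)//; last by rewrite lef_pV2.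
  rewrite -real_normK ?num_real// ler_pXn2r ?nnegrE//.
  exact: le_trans (coord_le _ _ _) zD.
have b3 : z 0 1 <= D by apply: le_trans (ler_norm _) _; exact: le_trans (coord_le _ _ _) zD.
have d1 : 0 <= d^-1 by rewrite invr_ge0 ltW.
have d2 : 0 <= D ^+ 2 / d by rewrite divr_ge0 ?sqr_ge0// ltW.
set Q := d^-1 + D ^+ 2 / d + D.
have S (x y : R) : x ^+ 2 + y ^+ 2 <= Q -> `|x| <= 1 + Q.
  move=> xy; have x2 : `|x| ^+ 2 <= Q.
    by rewrite real_normK ?num_real//; apply: le_trans xy; rewrite lerDl sqr_ge0.
  by move: (normr_ge0 x) (sqr_ge0 (`|x| - 1)) x2; move: `|x| => n; clear; nra.
have T1 : c 0 0 ^+ 2 + c 0 1 ^+ 2 <= Q by rewrite TE /Q; move: b2 b3 d1; clear; lra.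
have T2 : c 1 1 ^+ 2 + c 1 0 ^+ 2 <= Q by rewrite -/N /Q; move: b1 d2 D0; clear; lra.
apply: norm_mx_le; apply: ord2P; apply: ord2P.
- exact: S T1.
- by apply: (S _ (c 0 0)); rewrite addrC.
- by apply: (S _ (c 1 1)); rewrite addrC.
- exact: S T2.
Qed.

(** [X] carries the expanded and contracted eigenlines of [gtm l] to those of [gtm l'], so it is
    diagonal; [l = l'] is not assumed. *)
Lemma gtm_commute (X : 'M[R]_2) (l l' : R) : \det X = 1 -> 0 < l -> 0 < l' ->
  gtm l' * X = X * gtm l -> exists r, X = gtm r \/ X = - gtm r.
Proof.
move=> dX l0 l0' E.
have q1 : 1 < expR (l / 2) by rewrite expR_gt1 divr_gt0.
have q1' : 1 < expR (l' / 2) by rewrite expR_gt1 divr_gt0.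
have E01 := congr1 (fun A : 'M[R]_2 => A 0 1) E; have E10 := congr1 (fun A : 'M[R]_2 => A 1 0) E.
rewrite /= !mul2E /gtm !mx2E in E01 E10.
move: E01 E10 q1 q1'; set q := expR (l / 2); set q' := expR (l' / 2) => E01 E10 q1 q1'.
have qn : q != 0 by rewrite gt_eqF// expR_gt0.
have qn' : q' != 0 by rewrite gt_eqF// expR_gt0.
have qq : q * q' - 1 != 0.
  rewrite gt_eqF// subr_gt0.
  by move: q1 q1'; clear; nra.
have x01 : X 0 1 = 0.
  apply: (mulfI qq); rewrite mulr0.
  transitivity (q * (q' * X 0 1 + 0 * X 1 1) - X 0 1); first by ring.
  by rewrite E01; field.
have x10 : X 1 0 = 0.
  apply: (mulfI qq); rewrite mulr0.
  transitivity (q' * (X 1 0 * q + X 1 1 * 0) - X 1 0); first by ring.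
  by rewrite -E10; field.
rewrite det2E x01 mul0r subr0 in dX.
have xn : X 0 0 != 0 by apply/eqP => x0; move: dX; rewrite x0 mul0r => /eqP; rewrite eq_sym oner_eq0.
have x11 : X 1 1 = (X 0 0)^-1 by rewrite -[LHS](mulKf xn) dX mulr1.
have XE : X = gd (X 0 0) by apply: mx2_eq; rewrite !mx2E.
have [xp|xn'] := ltP 0 (X 0 0).
  by exists (2 * ln (X 0 0)); left; rewrite gtm_ln.
have xp : 0 < - X 0 0 by rewrite oppr_gt0 lt_neqAle xn.
exists (2 * ln (- X 0 0)); right; rewrite gtm_ln//.
by apply: mx2_eq; rewrite opp2E !mx2E ?oppr0 ?opprK// invrN opprK.
Qed.

End Matrices.

Lemma gtm_rt {R : realType} (t c s : R) :
  gtm t * rt c s * gtm (- t) = mx2 c (- (s * expR t)) (s * expR (- t)) c.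
Proof.
have et : expR t = expR (t / 2) * expR (t / 2) by rewrite -expRD -splitr.
have en : expR (- t) = (expR (t / 2))^-1 * (expR (t / 2))^-1.
  by rewrite -expRN -expRD -opprD -splitr.
rewrite et en /gtm mulNr [expR (- (t / 2))]expRN.
have := lt0r_neq0 (expR_gt0 (t / 2)); move: (expR (t / 2)) => q qn.
by apply: mx2_eq; rewrite (mul2E (gd q * rt c s)) !(mul2E (gd q)) !mx2E; field.
Qed.

Lemma antisym_sub {R : realType} (a b : R) : a < b -> b - a = a - b -> False.
Proof. by move=> ab; lra. Qed.

(** * Closed geodesics crossed by a ray *)

Section Tame.
Context {R : realType} (M : metricType R) (F : riemannian_lamination M).
Variables (G : set 'M[R]_2) (p : plane R -> M) (L : set M).
Hypothesis U : uniformization F G p L.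

(* Arbitrarily late along the geodesic of [A] there is a hyperbolic element of the
   stabilizer, of bounded size and with trace bounded away from 2. *)
Definition recurrent_hyperbolic (A : 'M[R]_2) :=
  exists2 e : R, 0 < e & exists C : R, forall T : R, exists t k g,
    [/\ T <= t /\ 0 <= t, \det k = 1 /\ `|k| <= C, 2 + e <= k 0 0 + k 1 1, G g &
        A * gtm t * k = g * (A * gtm t)].

Lemma geodesicE (X : topologicalType) (q : plane R -> X) A t : \det A = 1 ->
  geodesic q A t = q (mobius (A * gtm t) ii).
Proof.
move=> dA; rewrite /geodesic (mobius_comp dA (det_gtm t) (@ii_half R)) gtm_mobius.
by congr (q (mobius A _)); apply: plane_eq; rewrite hpointE mxE hpointE ?mulr0 ?mulr1.
Qed.

(* The element of [G] obtained from the periodicity depends a priori on the time; by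
   discreteness the same one serves at two different times, and an isometry of the
   half-plane fixing two points is the identity. *)
Lemma periodic_group B l : \det B = 1 ->
  (forall t, p (mobius (B * gtm (t + l)) ii) = p (mobius (B * gtm t) ii)) ->
  exists2 g, G g & B * gtm l = g * B.
Proof.
move=> dB per; have dBg t : \det (B * gtm t) = 1 by apply: det_mul1 => //; exact: det_gtm.
have dB' : \det (adj2 B) = 1 by rewrite det_adj2.
pose tn (n : nat) : R := n.+1%:R^-1.
(* The rotation [rt c (- s)] conjugated so as to fix the point of the vertical geodesic at time
   [tn n]. The times are distinct and lie in [[0, 1]], so these matrices stay bounded. *)
pose h (n : nat) (c s : R) := mx2 c (s * expR (tn n)) (- (s * expR (- tn n))) c.
have key n : exists gcs : 'M[R]_2 * (R * R), [/\ G gcs.1, gcs.2.1 ^+ 2 + gcs.2.2 ^+ 2 = 1 &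
    gcs.1 = B * gtm l * h n gcs.2.1 gcs.2.2 * adj2 B].
  have [g Gg Eg] := unif_eq U (dBg (tn n)) (dBg (tn n + l)) (esym (per (tn n))).
  have dgB := det_mul1 (group_det U Gg) (dBg (tn n)).
  have [c [s [cs E]]] := same_ii dgB (dBg _) (esym Eg).
  exists (g, (c, s)); split => //=.
  have -> : h n c s = gtm (tn n) * rt c (- s) * gtm (- tn n).
    by rewrite gtm_rt mulNr mulNr opprK.
  rewrite -[LHS]mulr1 -(adj2K (dBg (tn n))) adj2M.
  have -> : adj2 (gtm (tn n)) = gtm (- tn n).
    by rewrite !gtmE; apply: mx2_eq; rewrite !mx2E ?oppr0 ?mulNr ?opprK.
  have -> : g * (B * gtm (tn n) * (gtm (- tn n) * adj2 B)) =
      g * (B * gtm (tn n)) * (rt c s * rt c (- s)) * (gtm (- tn n) * adj2 B).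
    by rewrite rt_inv// mulr1 !mulrA.
  rewrite [g * _ * (rt c s * _)]mulrA -E [tn n + l]addrC gtmD !mulrA.
  by [].
have [f Hf] := choice key.
have [i [j [ij gij]]] : exists i j, (i < j)%N /\ (f i).1 = (f j).1.
  apply: (@group_pair _ _ _ _ _ _ U (2 * (2 * `|B * gtm l| * expR 1) * `|adj2 B|) (fun n => (f n).1)).
  move=> n; have [Gn cs E] := Hf n; split => //; rewrite E.
  apply: le_trans (norm_mul2 _ _) _; apply: ler_wpM2r => //; apply: ler_wpM2l => //.
  apply: le_trans (norm_mul2 _ _) _; apply: ler_wpM2l; first by rewrite mulr_ge0.
  have r1 := rt_le1 cs; move: (f n).2.1 (f n).2.2 r1 => c s r1.
  have c1 : `|c| <= 1 by apply: le_trans r1; have := coord_le (rt c s) 0 0; rewrite mx2E.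
  have s1 : `|s| <= 1 by apply: le_trans r1; have := coord_le (rt c s) 1 0; rewrite mx2E.
  have t0 : 0 <= tn n by rewrite invr_ge0.
  have t1 : tn n <= 1 by rewrite invf_le1 ?ltr0n// ler1n.
  have e1 : 1 <= expR 1 :> R by rewrite ltW// expR_gt1.
  have ce : `|c| <= expR 1 by exact: le_trans e1.
  have se (x : R) : x <= 1 -> `|s * expR x| <= expR 1.
    move=> x1; rewrite normrM (gtr0_norm (expR_gt0 _)) -[leRHS]mul1r.
    by apply: ler_pM => //; rewrite ?expR_ge0// ler_expR.
  apply: norm_mx_le; apply: ord2P; apply: ord2P; rewrite mx2E ?normrN //; apply: se => //.
  by rewrite (le_trans _ t1)// ge0_cp.
have [Gi csi gi] := Hf i; have [Gj csj gj] := Hf j.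
have hij : h i (f i).2.1 (f i).2.2 = h j (f j).2.1 (f j).2.2.
  have dBl := dBg l.
  have C0 (X Y : 'M[R]_2) : B * gtm l * X * adj2 B = B * gtm l * Y * adj2 B -> X = Y.
    move=> E; have E2 : B * gtm l * X = B * gtm l * Y.
      by rewrite -[LHS]mulr1 -(adj2Kl dB) mulrA E -mulrA adj2Kl// mulr1.
    by rewrite -[X]mul1r -(adj2Kl dBl) -mulrA E2 mulrA adj2Kl// mul1r.
  by apply: C0; rewrite -gi -gj.
clear Gj csj gj gij.
move: (f i).1 (f i).2.1 (f i).2.2 (f j).2.1 (f j).2.2 Gi csi gi hij => g c s c' s' Gg cs gE hE.
have E01 := congr1 (fun A : 'M[R]_2 => A 0 1) hE; have E10 := congr1 (fun A : 'M[R]_2 => A 1 0) hE.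
rewrite /= !mx2E in E01 E10; move/oppr_inj: E10 => E10.
have tij : tn j < tn i by rewrite ltf_pV2 ?posrE ?ltr0n// ltr_nat.
(* Comparing the off-diagonal entries, [s'] equals both [s * expR d] and [s * expR (- d)], where
   [d = tn i - tn j > 0]. *)
have s0 : s = 0.
  have E1 : s * expR (tn i - tn j) = s'.
    by rewrite expRD mulrA E01 -mulrA -expRD subrr expR0 mulr1.
  have E2 : s * expR (tn j - tn i) = s'.
    by rewrite addrC expRD mulrA E10 -mulrA -expRD addNr expR0 mulr1.
  have : s * (expR (tn i - tn j) - expR (tn j - tn i)) = 0 by rewrite mulrBr E1 E2 subrr.
  move/eqP; rewrite mulf_eq0 subr_eq0 => /orP[/eqP//|/eqP/expR_inj].
  by move/(antisym_sub tij).
have hc : h i c s = c%:M by rewrite /h s0; apply: mx2_eq; rewrite mx2E ?mul0r ?oppr0 !mxE.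
have c2 : c ^+ 2 = 1 by rewrite -cs s0 expr0n addr0.
have gE' : g * B = c *: (B * gtm l).
  rewrite gE hc -[_ * adj2 B * B]mulrA adj2Kl// mulr1; exact: mul_mx_scalar.
move/eqP: c2; rewrite sqrf_eq1 => /orP[] /eqP c1; rewrite c1 in gE'.
  by exists g; rewrite // gE' scale1r.
by exists (- g); [exact: (group_opp U)|rewrite mulNr gE' scaleN1r opprK].
Qed.

Lemma same_axis (B B' g : 'M[R]_2) (l l' : R) : \det B = 1 -> \det B' = 1 -> 0 < l -> 0 < l' ->
  B * gtm l = g * B -> B' * gtm l' = g * B' -> exists r, B = B' * gtm r \/ B = - (B' * gtm r).
Proof.
move=> dB dB' l0 l0' E E'; have dA : \det (adj2 B') = 1 by rewrite det_adj2.
have com : gtm l' * (adj2 B' * B) = adj2 B' * B * gtm l.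
  have gE : gtm l' = adj2 B' * (g * B') by rewrite -E' mulrA adj2Kl// mul1r.
  by rewrite gE -!mulrA (mulrA B') adj2K// mul1r E.
have [r [X|X]] := gtm_commute (det_mul1 dA dB) l0 l0' com; exists r; [left|right];
  by rewrite -?mulrN -X mulrA adj2K// mul1r.
Qed.

Lemma range_shift (X : topologicalType) (q : plane R -> X) B r : \det B = 1 ->
  range (geodesic q (B * gtm r)) = range (geodesic q B).
Proof.
move=> dB; have dBr := det_mul1 dB (det_gtm r); apply/seteqP; split => _ [t _ <-].
  by exists (r + t) => //; rewrite !geodesicE// gtmD mulrA.
by exists (t - r) => //; rewrite !geodesicE// -mulrA -gtmD addrC subrK.
Qed.

Lemma range_opp (X : topologicalType) (q : plane R -> X) B :
  range (geodesic q (- B)) = range (geodesic q B).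
Proof.
have -> // : geodesic q (- B) = geodesic q B.
by apply/funext => t; rewrite /geodesic mobius_opp.
Qed.

Local Notation pl := (p : plane R -> leaf_space F).

(** The closed geodesic is lifted through the crossing point, so its frame [B] differs from that of
    the ray by a rotation. The element [g] translating along the lift is thereby tied to the frame
    of the ray at that time. *)
Lemma closed_crossing b C A t : \det A = 1 -> closed_geodesic pl b C -> C (geodesic pl A t) ->
  exists B l g, [/\ \det B = 1 /\ C = range (geodesic pl B), 0 < l <= b, G g, B * gtm l = g * B &
    exists c s, c ^+ 2 + s ^+ 2 = 1 /\ B = A * gtm t * rt c s].
Proof.
move=> dA [A' [l [dA' lb per ->]]] [s _ Es].
have dAt := det_mul1 dA (det_gtm t); have dAs := det_mul1 dA' (det_gtm s).
have Es' : p (mobius (A' * gtm s) ii) = p (mobius (A * gtm t) ii).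
  by rewrite -(geodesicE pl t dA) -(geodesicE pl s dA').
have [h Gh Eh] := unif_eq U dAs dAt Es'; have dh := group_det U Gh.
have dB := det_mul1 dh dAs.
have gB r : geodesic pl (h * (A' * gtm s)) r = geodesic pl A' (s + r).
  rewrite !geodesicE// gtmD mulrA -!mulrA; have Hi := @ii_half R.
  have d1 := det_mul1 dA' (det_mul1 (det_gtm s) (det_gtm r)).
  by rewrite (mobius_comp dh d1 Hi); exact: (unif_group U Gh (mobius_half d1 Hi)).
have [g Gg Eg] : exists2 g, G g & h * (A' * gtm s) * gtm l = g * (h * (A' * gtm s)).
  apply: periodic_group => // r.
  by have := per (s + r); rewrite -addrA -!gB !geodesicE.
exists (h * (A' * gtm s)), l, g; split => //; last first.
  by have [c [s' [cs E]]] := same_ii dAt dB Eh; exists c, s'.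
split => //; apply/seteqP; split => _ [r _ <-]; last by exists (s + r); rewrite ?gB.
by exists (r - s) => //; rewrite gB addrC subrK.
Qed.

Lemma axis_power (B g : 'M[R]_2) (l : R) n : B * gtm l = g * B -> B * gtm (l *+ n) = g ^+ n * B.
Proof.
move=> E; elim: n => [|n IH]; first by rewrite mulr0n gtm0 expr0 mulr1 mul1r.
by rewrite mulrSr gtmD mulrA IH -mulrA E mulrA -exprSr.
Qed.

(* Closed geodesics of bounded length that meet a bounded piece of a geodesic have axes
   given by elements of [G] of bounded size, of which there are finitely many. *)
Lemma infinite_crossings A b T : \det A = 1 -> 0 <= T ->
  infinite_set [set C | closed_geodesic pl b C /\ exists2 t, 0 <= t & C (geodesic pl A t)] ->
  exists C t, [/\ closed_geodesic pl b C, C (geodesic pl A t) & T < t].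
Proof.
move=> dA T0 inf; apply: contrapT => no.
have [f [fS finj]] := infinite_seq inf.
have key n : exists Bgl : 'M[R]_2 * 'M[R]_2 * R, [/\ \det Bgl.1.1 = 1 /\
    f n = range (geodesic pl Bgl.1.1), 0 < Bgl.2 <= b, G Bgl.1.2,
    Bgl.1.1 * gtm Bgl.2 = Bgl.1.2 * Bgl.1.1 & `|Bgl.1.1| <= 2 * (2 * `|A| * expR (T / 2))].
  have [cf [t t0 ft]] := fS n.
  have tT : t <= T by rewrite leNgt; apply/negP => Tt; apply: no; exists (f n), t.
  have [B [l [g [[dB fB] lb Gg E [c [s [cs BE]]]]]]] := closed_crossing dA cf ft.
  exists (B, g, l); split => //=; rewrite BE.
  apply: le_trans (norm_mul2 _ _) _.
  apply: (@le_trans _ _ (2 * `|A * gtm t| * 1)).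
    by apply: ler_wpM2l; [rewrite mulr_ge0|exact: rt_le1].
  rewrite mulr1; apply: ler_wpM2l => //; apply: le_trans (norm_mul2 _ _) _.
  by apply: ler_wpM2l; [rewrite mulr_ge0|apply: gtm_le; rewrite t0].
have [h Hh] := choice key.
set K := 2 * (2 * `|A| * expR (T / 2)) in Hh.
have K0 : 0 <= K by rewrite !mulr_ge0// expR_ge0.
have [i [j [ij gij]]] : exists i j, (i < j)%N /\ (h i).1.2 = (h j).1.2.
  apply: (@group_pair _ _ _ _ _ _ U (2 * (2 * K * expR (b / 2)) * K) (fun n => (h n).1.2)) => n.
  have [[dB _] lb Gg E BK] := Hh n; split => //.
  have -> : (h n).1.2 = (h n).1.1 * gtm (h n).2 * adj2 (h n).1.1.
    by rewrite E -mulrA adj2K// mulr1.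
  apply: le_trans (norm_mul2 _ _) _; apply: ler_pM; rewrite ?mulr_ge0//.
  - apply: ler_wpM2l => //; apply: le_trans (norm_mul2 _ _) _; apply: ler_pM; rewrite ?mulr_ge0//.
    + exact: ler_wpM2l.
    + by apply: gtm_le; move/andP: lb => [/ltW -> ->].
  - exact: le_trans (norm_adj2 _) BK.
have [[dB fB] /andP[l0 _] _ E _] := Hh i; have [[dB' fB'] /andP[l0' _] _ E' _] := Hh j.
rewrite gij in E.
have [r rE] := same_axis dB dB' l0 l0' E E'.
have : f i = f j.
  by rewrite fB fB'; case: rE => ->; rewrite ?range_opp range_shift.
by move/finj => eij; rewrite eij ltnn in ij.
Qed.

(** Seen from the crossing vector, the translation along the closed geodesic is [gtm l] conjugated
    by a rotation. Closed geodesics may be arbitrarily short, so a power of length between [b] and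
    [2 * b] is used: its size is bounded and its trace is at least [Y + Y^-1 > 2], with
    [Y = expR (b / 2)]. *)
Lemma recurrent_closed A b : \det A = 1 -> 0 < b ->
  infinite_set [set C | closed_geodesic pl b C /\ exists2 t, 0 <= t & C (geodesic pl A t)] ->
  recurrent_hyperbolic A.
Proof.
move=> dA b0 inf; set Y := expR (b / 2).
have Y1 : 1 < Y by rewrite expR_gt1 divr_gt0.
have Y0 : 0 < Y by exact: expR_gt0.
have Yn : Y != 0 by rewrite gt_eqF.
exists (Y + Y^-1 - 2).
  have -> : Y + Y^-1 - 2 = (Y - 1) ^+ 2 / Y by field.
  have Ym : 0 < Y - 1 by rewrite subr_gt0.
  exact: divr_gt0 (exprn_gt0 2 Ym) Y0.
exists (2 * (2 * 1 * expR (2 * b / 2)) * 1) => T.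
have T0 : 0 <= Num.max 0 T by rewrite le_max lexx.
have [C [t [cC Ct Tt]]] := infinite_crossings dA T0 inf.
have [B [l [g [[dB _] /andP[l0 lb] Gg E [c [s [cs BE]]]]]]] := closed_crossing dA cC Ct.
have [n [n1 n2]] : exists n : nat, b <= l *+ n /\ l *+ n <= 2 * b.
  have bl : 0 <= b / l by rewrite divr_ge0 ?ltW.
  exists (Num.truncn (b / l)).+1; rewrite -[l *+ _]mulr_natl.
  have h1 := ltW (truncnS_gt (b / l)); have h2 : (Num.truncn (b / l))%:R <= b / l by rewrite truncn_le.
  split; first by rewrite -ler_pdivrMr.
  have -> : 2 * b = b + b by rewrite mulr_natl mulr2n.
  rewrite -natr1 mulrDl mul1r; apply: lerD => //.
  by rewrite -ler_pdivlMr.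
exists t, (rt c s * gtm (l *+ n) * rt c (- s)), (g ^+ n).
have cs' : c ^+ 2 + (- s) ^+ 2 = 1 by rewrite sqrrN.
have adR : adj2 (rt c s) = rt c (- s) by apply: mx2_eq; rewrite !mx2E ?opprK.
have ln0 : 0 <= l *+ n by apply: le_trans n1; exact: ltW.
split.
- by move: Tt; rewrite gt_max => /andP[/ltW t0 /ltW ->].
- split; first by rewrite !detM2 det_rt// det_gtm det_rt// !mulr1.
  apply: le_trans (norm_mul2 _ _) _; apply: ler_pM; rewrite ?mulr_ge0//.
    apply: ler_wpM2l => //; apply: le_trans (norm_mul2 _ _) _; apply: ler_pM; rewrite ?mulr_ge0//.
    + by apply: ler_wpM2l => //; exact: rt_le1.
    + by apply: gtm_le; rewrite ln0.
  exact: rt_le1.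
- rewrite -adR trace_conj ?det_rt// gtmE !mx2E expRN.
  have XY : Y <= expR (l *+ n / 2) by rewrite ler_expR ler_pM2r.
  move: XY; move: (expR _) => X XY; rewrite addrC subrK.
  have X0 : 0 < X by apply: lt_le_trans XY; exact: lt_trans ltr01 Y1.
  have Xn : X != 0 by rewrite gt_eqF.
  rewrite -subr_ge0; have -> : X + X^-1 - (Y + Y^-1) = (X - Y) * (X * Y - 1) / (X * Y).
    by field; rewrite Xn Yn.
  have XY1 : 1 <= X * Y.
    by rewrite -[leLHS]mulr1; apply: ler_pM => //; [apply: le_trans XY|]; exact: ltW.
  by rewrite divr_ge0 ?mulr_ge0 ?subr_ge0// ltW// (lt_trans ltr01).
- exact: (group_exp U).
- have E2 : A * gtm t = B * rt c (- s) by rewrite BE -mulrA rt_inv// mulr1.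
  have -> : A * gtm t * (rt c s * gtm (l *+ n) * rt c (- s)) = B * gtm (l *+ n) * rt c (- s).
    by rewrite BE !mulrA.
  by rewrite (axis_power n E) -mulrA -E2.
Qed.

End Tame.

Lemma trace_mul_diag {R : realType} (X : 'M[R]_2) (a b : R) :
  (X * mx2 a 0 0 b) 0 0 + (X * mx2 a 0 0 b) 1 1 = X 0 0 * a + X 1 1 * b.
Proof. by rewrite !mul2E !mx2E; ring. Qed.

Lemma conj_shift {R : realType} (g c X : 'M[R]_2) : \det c = 1 -> \det g = 1 ->
  adj2 g * c * (adj2 c * X * c) = adj2 g * X * g * (adj2 g * c).
Proof.
move=> dc dg; rewrite -!(mulrA (adj2 g)); congr (_ * _).
by rewrite -!(mulrA X) !mulrA adj2K// mul1r -(mulrA X) adj2K// mulr1.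
Qed.

(** * Rays that stay in a compact region *)

Section TameCompact.
Context {R : realType} (M : metricType R) (F : riemannian_lamination M).
Variables (G : set 'M[R]_2) (p : plane R -> M) (L : set M).
Hypothesis U : uniformization F G p L.
Local Notation pl := (p : plane R -> leaf_space F).

(** Openness for the leaf topology, in which compactness of [K] is meant: points of the leaf near
    [p z] lift to points near [z]. *)
Lemma unif_open z V : half_plane z -> nbhs z V -> nbhs (pl z) (pl @` V).
Proof.
move=> Hz nV; pose W := V° `&` half_plane.
have oW : open (pl @` W).
  have -> : open (pl @` W) = leaf_open (pl @` W) by [].
  move=> a t; rewrite openE => x [/= Dx [w [Vw Hw] pw]].
  have aw : chart_dom a (p w) by rewrite pw; exact: chart_inv_dom.
  have xw : (chart_map a (p w)).1 = x by rewrite pw chart_invK.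
  have tw : (chart_map a (p w)).2 = t by rewrite pw chart_invK.
  pose f (z : plane R) := (chart_map a (p z)).1.
  have nw := unif_chart U Hw aw.
  have n1 : \forall y \near w, [/\ half_plane y, chart_dom a (p y) & V° y].
    have nVw : \forall y \near w, V° y by exact: nbhs_interior.
    by apply: filterS2 nw nVw => y [].
  have n2 : \forall y \near w, W y /\ p y = chart_inv (f y, t).
    by apply: filterS2 nw n1 => y [_ _ _ py] [Hy _ Vy]; rewrite -tw.
  have : nbhs (f w) (f @` [set y | W y /\ p y = chart_inv (f y, t)]).
    apply: (local_surj n1) n2 => y [Hy ay _].
      exact: nbhs_singleton (unif_diff2 U Hy ay).1.1.
    by rewrite unitmxE unitfE gt_eqF//; exact: (unif_det U Hy ay).
  rewrite /f xw => nx; apply: filterS2 nx (near_disk Dx) => y [v [Wv pv] vy] Dy.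
  by split => //; exists v => //; rewrite pv /f vy.
have nW : nbhs (pl z) (pl @` W).
  apply: open_nbhs_nbhs; split => //; exists z => //; split => //.
by apply: filterS nW => _ [w [Vw _] <-]; exists w => //; exact: interior_subset.
Qed.

(** The points at integer times have a cluster point in [K]. Lifted to a fixed ball around a
    preimage [w0], the returning frames are bounded by [frame_bounded], with a bound independent of
    [n]. *)
Lemma recurrent_subsequence A K : \det A = 1 -> compact (K : set (leaf_space F)) ->
  K `<=` pl @` half_plane -> (forall t, 0 <= t -> K (geodesic pl A t)) ->
  exists C, forall n : nat, exists m g, [/\ (n <= m)%N, G g & `|g * (A * gtm m%:R)| <= C].
Proof.
move=> dA cK Kp HK; have Hi := @ii_half R.
pose x (n : nat) : leaf_space F := geodesic pl A n%:R.
have PF : ProperFilter (x @ \oo) by exact: fmap_proper_filter.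
have FK : (x @ \oo) K by exists 0%N => // n _; exact: HK.
have [y [Ky cy]] := cK _ PF FK.
have [w0 Hw0 wy] := Kp y Ky; rewrite -wy in cy.
pose d := w0 0 1 / 2; have d0 : 0 < d by rewrite divr_gt0.
exists (1 + (d^-1 + (`|w0| + d) ^+ 2 / d + (`|w0| + d))) => n.
have nB := unif_open Hw0 (nbhs_cball w0 d0).
have nA : (x @ \oo) (x @` [set m | (n <= m)%N]).
  by exists n => // m /= nm; exists m.
have [_ [[m nm <-] [w wd xw]]] := cy _ _ nA nB.
have dAm := det_mul1 dA (det_gtm (m%:R : R)).
have w1 : d <= w 0 1.
  have := coord_le (w - w0) 0 1; rewrite !mxE => h; have := le_trans h wd.
  by rewrite ler_norml /d => /andP[+ _]; lra.
have Hw : half_plane w by rewrite half_planeE; exact: lt_le_trans w1.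
have wD : `|w| <= `|w0| + d.
  by rewrite -(subrK w0 w) addrC; apply: le_trans (ler_normD _ _) _; rewrite lerD2l.
have E : p (mobius (A * gtm m%:R) ii) = p w.
  by rewrite -(geodesicE pl _ dA); exact: esym xw.
have [_ _ H _] := U; have [g Gg Eg] := (H _ _ (mobius_half dAm Hi) Hw).1 E.
have dg := group_det U Gg.
exists m, g; split => //.
have dc := det_mul1 dg dAm.
have cw : mobius (g * (A * gtm m%:R)) ii = w by rewrite mobius_comp.
by apply: frame_bounded => //; rewrite cw.
Qed.

Lemma increasing_choice (P : nat -> Prop) : (forall n, exists2 m, (n <= m)%N & P m) ->
  exists f : nat -> nat, (forall n, P (f n)) /\ forall i k, (f i + k <= f (i + k))%N.
Proof.
move=> H; have /choice[h Hh] : forall n, exists m, (n <= m)%N /\ P m.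
  by move=> n; have [m nm Pm] := H n; exists m.
pose f := fix f n := if n is n'.+1 then h (f n').+1 else h 0%N.
exists f; split; first by case=> [|n]; exact: (Hh _).2.
move=> i; elim=> [|k IH]; first by rewrite !addn0.
by rewrite !addnS; apply: leq_trans (Hh _).1; rewrite ltnS.
Qed.

(* Two almost equal elements [c i] and [c j] of the bounded subsequence differ by an
   element of [G] close to a conjugate of the geodesic flow at a large time. *)
Lemma recurrent_compact A K : \det A = 1 -> compact (K : set (leaf_space F)) ->
  K `<=` pl @` half_plane -> (forall t, 0 <= t -> K (geodesic pl A t)) ->
  recurrent_hyperbolic G A.
Proof.
move=> dA cK Kp HK; have [C HC] := recurrent_subsequence dA cK Kp HK.
have [|m [Hm mD]] := @increasing_choice (fun m => exists g, G g /\ `|g * (A * gtm m%:R)| <= C).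
  by move=> n; have [m [g [nm Gg gC]]] := HC n; exists m => //; exists g.
have [g Hg] := choice Hm.
pose c n := g n * (A * gtm (m n)%:R).
have cC n : `|c n| <= C := (Hg n).2.
have C0 : 0 <= C by exact: le_trans (cC 0%N).
have dg n : \det (g n) = 1 := group_det U (Hg n).1.
have dAm n := det_mul1 dA (det_gtm ((m n)%:R : R)).
have dc n : \det (c n) = 1 := det_mul1 (dg n) (dAm n).
have ep : 0 < (2 * (2 * C + 1))^-1 by rewrite invr_gt0 mulr_gt0// ltr_wpDl// mulr_ge0.
(* The tolerance [ep] gives [|k - 1| <= 1 / 2], so the diagonal of [k] is at least [1 / 2]. The gap
   14 gives [T >= 14], hence [expR (T / 2) >= 8], and the trace of [g0] is at least 4. *)
have [i [j [ij cij]]] := bounded_near_pair cC ep 14.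
pose k := adj2 (c i) * c j.
have k1 : `|k - 1| <= 2^-1.
  have -> : k - 1 = adj2 (c i) * (c j - c i) by rewrite /k mulrBr adj2Kl.
  apply: le_trans (norm_mul2 _ _) _.
  have h1 : `|adj2 (c i)| <= C by apply: le_trans (norm_adj2 _) _.
  have h2 : `|c j - c i| <= (2 * (2 * C + 1))^-1 by rewrite distrC ltW.
  have h3 : 2 * `|adj2 (c i)| * `|c j - c i| <= (2 * C + 1) * (2 * (2 * C + 1))^-1.
    apply: ler_pM; rewrite ?mulr_ge0//.
    by apply: le_trans (_ : 2 * C <= _); [rewrite ler_pM2l|rewrite lerDl].
  apply: le_trans h3 _; rewrite invfM mulrCA mulfV ?mulr1// gt_eqF//.
  by rewrite ltr_wpDl// mulr_ge0.
have kd : 2^-1 <= k 0 0 /\ 2^-1 <= k 1 1.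
  have H (a : 'I_2) : 2^-1 <= k a a.
    have := le_trans (coord_le (k - 1) a a) k1; rewrite sub2E.
    have -> : (1 : 'M[R]_2) a a = 1 by rewrite mxE eqxx.
    by rewrite ler_norml => /andP[+ _]; lra.
  by split.
pose T : R := (m j)%:R - (m i)%:R.
have T14 : 14 <= T.
  have ijE : (j = i + (j - i))%N by rewrite subnKC// (leq_trans _ ij)// leq_addl.
  have h : (m i + 14 <= m j)%N.
    rewrite ijE; apply: leq_trans (mD _ _); rewrite leq_add2l.
    by rewrite leq_subRL ?(leq_trans _ ij) ?leq_addl// addnC.
  by rewrite /T lerBrDl -natrD ler_nat.
pose g0 := g j * adj2 (g i).
have Gg0 : G g0 by apply: (group_mul U (Hg j).1); exact: group_adj2 U _ (Hg i).1.
have g0E : g0 = c i * (k * gtm (- T)) * adj2 (c i).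
  have cj : c j = g0 * c i * gtm T.
    rewrite /g0 /c -!mulrA -gtmD [(m i)%:R + T]addrC subrK.
    by rewrite (mulrA (adj2 (g i))) adj2Kl// mul1r.
  have -> : c i * (k * gtm (- T)) * adj2 (c i) = c j * gtm (- T) * adj2 (c i).
    by rewrite mulrA /k (mulrA (c i)) (adj2K (dc i)) mul1r.
  by rewrite cj -(mulrA (g0 * c i)) -gtmD subrr gtm0 mulr1 -(mulrA g0) (adj2K (dc i)) mulr1.
have tr0 : 4 <= g0 0 0 + g0 1 1.
  rewrite g0E trace_conj// gtmE trace_mul_diag mulNr opprK.
  have e8 : 8 <= expR (T / 2).
    by apply: le_trans (expR_ge1Dx _); move: T14; lra.
  have em : 0 <= expR (- (T / 2)) by exact: expR_ge0.
  have [k0 k11] := kd.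
  have h1 : 0 <= k 0 0 * expR (- (T / 2)) by rewrite mulr_ge0// (le_trans _ k0)// invr_ge0.
  have h2 : 2^-1 * 8 <= k 1 1 * expR (T / 2) by apply: ler_pM => //; rewrite invr_ge0.
  by lra.
exists 2 => //; exists (2 * (2 * C * `|g0|) * C) => T'.
have [n nT] := pow_unbounded_nat T'.
(* The single element [g0] serves for every later time of the subsequence: conjugated by the bounded
   matrix [c n.+1] it keeps its trace and stays bounded. *)
exists (m n.+1)%:R, (adj2 (c n.+1) * g0 * c n.+1), (adj2 (g n.+1) * g0 * g n.+1).
have da : \det (adj2 (c n.+1)) = 1 by rewrite det_adj2.
split.
- split; last exact: ler0n.
  by apply: le_trans nT _; rewrite ler_nat; apply: leq_trans (mD 0%N n.+1); rewrite leq_addl.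
- split; first exact: det_mul1 (det_mul1 da (group_det U Gg0)) (dc _).
  apply: le_trans (norm_mul2 _ _) _; apply: ler_pM; rewrite ?mulr_ge0//.
  apply: ler_wpM2l => //; apply: le_trans (norm_mul2 _ _) _; apply: ler_wpM2r => //.
  by apply: ler_wpM2l => //; apply: le_trans (norm_adj2 _) _.
- have := trace_conj g0 da; rewrite adj2_adj2 => ->.
  by apply: le_trans tr0; lra.
- apply: (group_mul U _ (Hg _).1); apply: (group_mul U _ Gg0).
  exact: group_adj2 U _ (Hg _).1.
- have cE : A * gtm (m n.+1)%:R = adj2 (g n.+1) * c n.+1.
    by rewrite /c mulrA adj2Kl// mul1r.
  by rewrite cE; exact: conj_shift.
Qed.

End TameCompact.

Lemma act_tame (R : realType) (M : metricType R) (F : riemannian_lamination M)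
    (hyp : hyperbolic_leaves F) (u : unit_tangent F) : coarsely_tame_leaf F (ut_base u) ->
  exists2 e : R, 0 < e & exists C : R, forall T : R,
    exists p k, [/\ T <= p /\ 1 <= p, \det k = 1, `|k| <= C, 2 + e <= k 0 0 + k 1 1 &
      psl2_action (psl2_action u (gd p)) k = psl2_action u (gd p)].
Proof.
move=> [G [p [U [_ [b b0 tame]]]]].
have [A dA fA] := frame_surj U (same_leaf_refl F (ut_base u)).
have [e e0 [C HC]] : recurrent_hyperbolic G A.
  have [[K [cK Kp KA]]|inf] := tame A dA; first exact: recurrent_compact U _ _ dA cK Kp KA.
  exact: (recurrent_closed U dA b0 inf).
(* Time [2 * T] suffices because [p = expR (t / 2) >= 1 + t / 2]. *)
exists e => //; exists C => T; have [t [k [g [[Tt t0] [dk kC] tr Gg E]]]] := HC (2 * T).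
have dt := det_gtm t.
have Tp : T <= expR (t / 2) by apply: le_trans (expR_ge1Dx _); move: Tt; lra.
have p1 : 1 <= expR (t / 2) by rewrite -expR0 ler_expR divr_ge0.
have fAt := act_frame hyp U dA dt fA; have dAt := det_mul1 dA dt.
have U' := U; rewrite -(leaf_unif dAt U fAt) in U'.
have fix_k := act_stab hyp U' dAt dk fAt Gg E.
by exists (expR (t / 2)), k; split; [split| | | |exact: fix_k].
Qed.

Theorem theorem3 (R : realType) (M : metricType R) (F : hyperbolic_lamination M)
    (Fmin : minimal_lamination F)
    (Ftame : forall m : M, coarsely_tame_leaf F m) :
  minimal_flow (@horocycle_flow R M F).
Proof.
move=> u; have hyp := @hl_hyperbolic _ _ F.
have hsE s : 1 + s *: delta_mx 0 1 = hs s :> 'M[R]_2.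
  by apply: mx2_eq; rewrite !mxE /= ?mulr0 ?mulr1 ?addr0 ?add0r.
have -> : [set horocycle_flow s u | s in [set: R]] =
    [set psl2_action u (hs s) | s in [set: R]].
  have hf s : horocycle_flow s u = psl2_action u (hs s) := congr1 (psl2_action u) (hsE s).
  by apply/seteqP; split => _ [s sT <-]; (exists s; [exact: sT|]); [exact: esym|exact: hf].
have tame (v : unit_tangent F) := act_tame hyp (Ftame (ut_base v)).
have leafd (Z : set (unit_tangent F)) := @act_leafd R M F hyp Z Fmin.
exact: (@horocycle_orbits_dense R (unit_tangent F) (@psl2_action R M F) (ut_compact hyp)
  (act1 hyp) (actN hyp) (actM hyp) (act_cont hyp) (act_orbit hyp) (act_diag hyp)
  (act_disc hyp) tame leafd u).
Qed.
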